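(* Let $\varepsilon>0$. Let $X$ be a complex Banach space with continuously varying symplectic structures $\omega(s)$, $s\in(-\varepsilon,\varepsilon)$. Let $(\lambda(s),\mu(s))$, $s\in(-\varepsilon,\varepsilon)$, be a path of Fredholm pairs of Lagrangian subspaces of $(X,\omega(s))$ of index $0$. Let $V(s)$, $s\in(-\varepsilon,\varepsilon)$, be a path of finite dimensional linear subspaces of $X$ such that $X=V(0)\oplus(\lambda(0)+\mu(0))$. Set $$\lambda_0(s):=\lambda(s)\cap(V(s)+\mu(s)),\quad \lambda_1(s):=V(s)^{\omega(s)}\cap\lambda(s),$$ $$\mu_0(s):=\mu(s)\cap(V(s)+\lambda(s)),\quad \mu_1(s):=V(s)^{\omega(s)}\cap\mu(s),$$ $$X_0(s):=(V(s)+\lambda(s))\cap(V(s)+\mu(s)),\quad X_1(s):=\lambda_1(s)+\mu_1(s).$$ Then there exists $\delta\in(0,\varepsilon)$ such that the following hold for all $s\in(-\delta,\delta)$ and all $[s_1,s_2]\subset(-\delta,\delta)$. (a) $X_0(s)=X_1(s)^{\omega(s)}$, $X_1(s)=X_0(s)^{\omega(s)}$, and $X_0(s)$, $X_1(s)$ vary continuously in $s$. (b) $X_0(s)=V(s)\oplus\lambda_0(s)=V(s)\oplus\mu_0(s)$, $X_1(s)=\lambda_1(s)\oplus\mu_1(s)$, $\dim V(0)=\dim V(s)=\dim\lambda_0(s)=\dim\mu_0(s)=\frac12\dim X_0(s)$, and $X=X_0(s)\oplus X_1(s)$. (c) $\lambda(s)=\lambda_0(s)\oplus\lambda_1(s)$,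 $\mu(s)=\mu_0(s)\oplus\mu_1(s)$; $\lambda_0(s)$ and $\mu_0(s)$ are paths of Lagrangian subspaces of $(X_0(s),\omega(s)|_{X_0(s)})$; $\lambda_1(s)$ and $\mu_1(s)$ are paths of Lagrangian subspaces of $(X_1(s),\omega(s)|_{X_1(s)})$. (d) $\operatorname{Mas}_{\pm}\{\lambda(s),\mu(s);\,s\in[s_1,s_2]\}=\operatorname{Mas}_{\pm}\{\lambda_0(s),\mu_0(s);\,s\in[s_1,s_2]\}$. (e) Assume that there is a path $W(s)$, $s\in(-\delta,\delta)$, of Lagrangian subspaces of $(X_0(s),\omega(s)|_{X_0(s)})$ such that $W(s)\cap\lambda_0(s)=W(s)\cap\mu_0(s)=\{0\}$. Then there is a linear operator $A(s):\mu_0(s)\to W(s)$ such that $\lambda_0(s)=\operatorname{graph}(A(s))=\{y+A(s)y:\ y\in\mu_0(s)\}$. Define $Q(s)(x,y):=\omega(s)(x,A(s)y)$ for $x,y\in\mu_0(s)$. Then each form $Q(s)$ is symmetric and $$\operatorname{Mas}_{+}\{\lambda(s),\mu(s);\,s\in[s_1,s_2]\}=m^+(Q(s_2))-m^+(Q(s_1)),$$ $$\operatorname{Mas}_{-}\{\lambda(s),\mu(s);\,s\in[s_1,s_2]\}=m^-(Q(s_1))-m^-(Q(s_2)),$$ $$\dim(\lambda(s)\cap\mu(s))=m^0(Q(s)).$$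
   Context: A symplectic form $\omega$ on a complex vector space $X$ is a non-degenerate sesquilinear form (linear in the first, conjugate-linear in the second variable) with $\omega(y,x)=-\overline{\omega(x,y)}$. On a Banach space it is moreover required to be bounded, $|\omega(x,y)|\le C\|x\|\|y\|$ (the induced map to the dual need not be surjective). ''Continuously varying'' symplectic structures $\omega(s)$: symplectic forms depending continuously on $s$ in the norm of bounded sesquilinear forms. ''Symmetric form'' means Hermitian-symmetric form; $m^{+}(Q)$, $m^{-}(Q)$, $m^0(Q)$ are its positive Morse index, negative Morse index and nullity. For a subspace $\lambda$, $\lambda^\omega=\{x:\omega(x,y)=0\ \forall y\in\lambda\}$; $\lambda$ is Lagrangian if $\lambda=\lambda^\omega$. A pair $(\lambda,\mu)$ of subspaces is Fredholm if $\dim(\lambda\cap\mu)<\infty$ and $\dim X/(\lambda+\mu)<\infty$; its index is $\dim(\lambda\cap\mu)-\dim X/(\lambda+\mu)$. A ''path'' of closed subspaces is a family continuous in the gap topology. Maslov index. (i) Finite dimensional case: let $\alpha(s),\beta(s)$, $s\in[a,b]$, be continuous families of Lagrangian subspaces of a continuous family of finite dimensional symplectic spaces $(E(s),\sigma(s))$. Choose $a=t_0<\dots<t_N=b$ and on each $[t_{k-1},t_k]$ a continuous family of Lagrangian subspaces $L_k(s)$ with $L_k(s)\cap\alpha(s)=L_k(s)\cap\beta(s)=\{0\}$. Write $\alpha(s)=\{y+A_k(s)y:y\in\beta(s)\}$ with $A_k(s):\beta(s)\to L_k(s)$ and put $q_k(s)(x,y)=\sigma(s)(x,A_k(s)y)$,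 a Hermitian form on $\beta(s)$. Then $\operatorname{Mas}_+\{\alpha,\beta\}=\sum_k[m^+(q_k(t_k))-m^+(q_k(t_{k-1}))]$ and $\operatorname{Mas}_-\{\alpha,\beta\}=\sum_k[m^-(q_k(t_{k-1}))-m^-(q_k(t_k))]$; these do not depend on the choices. (ii) General case: for a path $(\lambda(s),\mu(s))$ of Fredholm pairs of index $0$ of Lagrangian subspaces of $(X,\omega(s))$, each $t$ admits a finite dimensional $V_t$ with $X=V_t\oplus(\lambda(t)+\mu(t))$; for $s$ near $t$ one has $V_t\cap\lambda(s)=V_t\cap\mu(s)=\{0\}$ and $X=V_t+(V_t^{\omega(s)}\cap\lambda(s))+\mu(s)$, and with $W_s:=V_t+\lambda(s)$ (coisotropic, $W_s^{\omega(s)}=V_t^{\omega(s)}\cap\lambda(s)$) the reduced spaces $R(\eta):=(\eta\cap W_s+W_s^{\omega(s)})/W_s^{\omega(s)}$, $\eta=\lambda(s),\mu(s)$, are continuous families of Lagrangian subspaces of the finite dimensional symplectic spaces $W_s/W_s^{\omega(s)}$ (with the induced form). $\operatorname{Mas}_\pm\{\lambda(s),\mu(s)\}$ is the sum of the finite dimensional indices $\operatorname{Mas}_\pm$ of these reduced pairs over the intervals of a sufficiently fine partition; it is independent of the choices. $\operatorname{Mas}:=\operatorname{Mas}_+$. *)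

(* Defs.v *)
From HB Require Import structures.
From mathcomp Require Import all_boot all_order all_algebra.
From mathcomp Require Import sesquilinear complex.
From mathcomp Require Import all_classical all_reals all_analysis.

Set Implicit Arguments.
Unset Strict Implicit.
Unset Printing Implicit Defensive.

Import Order.TTheory GRing.Theory Num.Theory.
Import numFieldNormedType.Exports.

Local Open Scope classical_set_scope.
Local Open Scope ring_scope.
Local Open Scope complex_scope.

Section Subspaces.
Variables (R : realType) (X : completeNormedModType R[i]).
Implicit Types A B M N P Z : set X.

Definition subspace_of_space A : Prop := GRing.submod_closed (mem A).

Definition sumset A B : set X := [set x + y | x in A & y in B].

Definition is_dsum M A B : Prop :=
  M = sumset A B /\ A `&` B = [set 0].

(* [qdim P N n]: for linear subspaces N and P with N `<=` P, dim (P / N) = n;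
   the composite of f with the projection P -> P / N is an isomorphism. *)
Definition qdim P N (n : nat) : Prop :=
  exists f : {linear 'rV[R[i]]_n -> X},
    [/\ range f `<=` P, forall c, N (f c) -> c = 0 & P `<=` sumset (range f) N].

Definition has_dim A (n : nat) : Prop := qdim A [set 0] n.

Definition fredholm_pair A B (k : int) : Prop :=
  exists m n : nat,
    [/\ has_dim (A `&` B) m, qdim setT (sumset A B) n & k = m%:Z - n%:Z].

(* The norm of X takes its values in the nonnegative reals of R[i]. *)
Definition rnorm (x : X) : R := complex.Re `|x|.

Definition dist_to (x : X) A : R := inf [set rnorm (x - y) | y in A].

(* Mathcomp's sup is 0 on the empty set, so the semi-gap from [set 0] is 0. *)
Definition semigap A B : R :=
  sup [set dist_to x B | x in [set x | A x /\ rnorm x = 1]].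

Definition gap A B : R := Num.max (semigap A B) (semigap B A).

Definition path_on (D : set R) (M : R -> set X) : Prop :=
  (forall s, D s -> subspace_of_space (M s) /\ closed (M s)) /\
  (forall s0, D s0 -> gap (M s) (M s0) @[s --> within D (nbhs s0)] --> (0 : R)).

End Subspaces.

(* Linear in the first variable, conjugate-linear in the second, and
   w x y = - Num.conj (w y x). *)
Notation skewform X := {hermitian X for true & Num.conj}.

Section Symplectic.
Variables (R : realType) (X : completeNormedModType R[i]).
Implicit Types (w : skewform X) (P A B : set X).

Definition symplectic_on P w : Prop :=
  forall x, P x -> (forall y, P y -> w x y = 0) -> x = 0.

Definition bounded_form w : Prop :=
  exists C : R[i], forall x y, `|w x y| <= C * `|x| * `|y|.

Definition symplectic w : Prop := bounded_form w /\ symplectic_on setT w.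

Definition form_continuous_on (D : set R) (w : R -> skewform X) : Prop :=
  forall s0, D s0 -> forall e : R[i], 0 < e ->
    \forall s \near within D (nbhs s0),
      forall x y, `|w s x y - w s0 x y| <= e * `|x| * `|y|.

Definition ann w A : set X := [set x | forall y, A y -> w x y = 0].

(* A is Lagrangian in (P, w|_P). When w|_P has a radical N this says that A
   contains N and that A / N is Lagrangian in P / N. *)
Definition lagrangian_in w P A : Prop :=
  subspace_of_space A /\ A = P `&` ann w A.

Definition lagrangian w A : Prop := lagrangian_in w setT A.

End Symplectic.

Section Morse.
Variables (R : realType) (X : completeNormedModType R[i]).
Implicit Types (B N L : set X) (q : X -> X -> R[i]) (T : X -> X).

Definition definite_dim B q (n : nat) : Prop :=
  exists Z : set X, [/\ subspace_of_space Z, Z `<=` B, has_dim Z n &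
    forall x, Z x -> x != 0 -> 0 < q x x].

(* If N is contained in the radical of q|_B, a positive definite subspace of B
   meets N trivially, so this is also the index of the form induced on B / N. *)
Definition morse_pos B q : nat :=
  xget 0%N [set n | definite_dim B q n /\
                    forall m, definite_dim B q m -> (m <= n)%N].

Definition morse_neg B q : nat := morse_pos B (fun x y => - q x y).

Definition nullity B q : nat :=
  xget 0%N (has_dim [set x | B x /\ forall y, B y -> q x y = 0]).

(* T is a lift of a linear operator from B / N to L / N. *)
Definition quotient_operator B L N T : Prop :=
  [/\ forall x, B x -> L (T x), forall x, N x -> N (T x) &
      forall (a : R[i]) x y, B x -> B y ->
        N (T (a *: x + y) - (a *: T x + T y))].

Definition graph_over B N T : set X := sumset [set y + T y | y in B] N.

Definition linear_operator B L T : Prop :=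
  (forall x, B x -> L (T x)) /\
  (forall (a : R[i]) x y, B x -> B y -> T (a *: x + y) = a *: T x + T y).

End Morse.

Section Maslov.
Variables (R : realType) (X : completeNormedModType R[i]).
Implicit Types (w : R -> skewform X) (a b u v : R).

Inductive mas_sign := MasPlus | MasMinus.

Definition morse_jump (sg : mas_sign) (B : R -> set X)
    (q : R -> X -> X -> R[i]) u v : int :=
  match sg with
  | MasPlus => (morse_pos (B v) (q v))%:Z - (morse_pos (B u) (q u))%:Z
  | MasMinus => (morse_neg (B u) (q u))%:Z - (morse_neg (B v) (q v))%:Z
  end.

Definition node a b (t : seq R) (k : nat) : R := nth b (a :: t) k.

(* Continuous families of finite dimensional symplectic spaces are given as
   quotients P s / N s, where N s is the radical of w s on P s, and subspaces
   of P s / N s by their inverse images in P s, which contain N s. *)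
Definition maslov_chart w (P N al be : R -> set X) u v
    (L : R -> set X) (T : R -> X -> X) : Prop :=
  path_on `[u, v] L /\
  forall s, s \in `[u, v] ->
    [/\ lagrangian_in (w s) (P s) (L s),
        L s `&` al s = N s, L s `&` be s = N s,
        quotient_operator (be s) (L s) (N s) (T s) &
        al s = graph_over (be s) (N s) (T s)].

Definition fd_maslov_value (sg : mas_sign) w (P N al be : R -> set X) a b
    (k : int) : Prop :=
  exists (t : seq R) (L : nat -> R -> set X) (T : nat -> R -> X -> X),
    [/\ itv_partition a b t,
        forall i, (i < size t)%N ->
          maslov_chart w P N al be (node a b t i) (node a b t i.+1) (L i) (T i) &
        k = \sum_(i < size t)
              morse_jump sg be (fun s x y => w s x (T i s y))
                (node a b t i) (node a b t i.+1)].

(* The inverse image in W of the reduced space (M `&` W + N) / N. *)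
Definition reduction (W N M : set X) : set X := sumset (M `&` W) N.

(* The second clause says that V is a complement of la s + mu s at some
   parameter s of [u, v]; the third one holds near that parameter, and requiring
   it on all of [u, v] is what makes the partition sufficiently fine. *)
Definition reducing_space w (la mu : R -> set X) u v (V : set X) : Prop :=
  [/\ exists n, has_dim V n,
      exists2 s, s \in `[u, v] & is_dsum setT V (sumset (la s) (mu s)) &
      forall s, s \in `[u, v] ->
        [/\ V `&` la s = [set 0], V `&` mu s = [set 0] &
            setT = sumset (sumset V (ann (w s) V `&` la s)) (mu s)]].

Definition maslov_value (sg : mas_sign) w (la mu : R -> set X) a b
    (k : int) : Prop :=
  exists (t : seq R) (V : nat -> set X) (kk : nat -> int),
    [/\ itv_partition a b t,
        forall i, (i < size t)%N ->
          reducing_space w la mu (node a b t i) (node a b t i.+1) (V i),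
        forall i, (i < size t)%N ->
          let W s := sumset (V i) (la s) in
          let N s := ann (w s) (W s) in
          fd_maslov_value sg w W N
            (fun s => reduction (W s) (N s) (la s))
            (fun s => reduction (W s) (N s) (mu s))
            (node a b t i) (node a b t i.+1) (kk i) &
        k = \sum_(i < size t) kk i].

(* The choices entering the definition of the index exist and all give k. *)
Definition fd_maslov_is (sg : mas_sign) w (P N al be : R -> set X) a b
    (k : int) : Prop :=
  fd_maslov_value sg w P N al be a b = [set k].

Definition maslov_is (sg : mas_sign) w (la mu : R -> set X) a b
    (k : int) : Prop :=
  maslov_value sg w la mu a b = [set k].

End Maslov.

(* Main.v *)
(* The decomposition X = V (+) (V^omega cap la) (+) mu holds at the base parameter
   and persists under small perturbations of the closed subspaces, by the open
   mapping theorem; (a)-(c) are linear algebra in it, and the continuity of all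
   the subspaces follows from the stability of direct sums in the gap.

   A chart of either Maslov index amounts to a Lagrangian complement L of mu with
   la / (la cap L) finite dimensional, and its form to q_L(a, a') = omega(m, a')
   on la, where m is the mu-component of a along L; the radical is la cap mu.
   Near a parameter s0, fix a chart whose form vanishes at s0.  Perturbing maximal
   definite subspaces shows that m^+(q_L(s)) is at least m^+(q_L(s0)) plus the
   index of the fixed chart at s, and likewise for m^-; since m^+ + m^- + m^0 is
   the constant dimension, equality holds.  So the indices of all charts have the
   same increments, namely those of one function on the interval: every
   admissible partition gives the same value, which yields (d) and (e).  Charts
   exist near every parameter, because among n + 1 explicit Lagrangian complements
   of la0 in X0 at least one is transversal to mu0. *)

Require Import Defs.
From HB Require Import structures.
From mathcomp Require Import all_boot all_order all_algebra.
From mathcomp Require Import sesquilinear complex.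
From mathcomp Require Import all_classical all_reals all_analysis.
From mathcomp Require Import ring lra zify.
From mathcomp Require spectral.

Set Implicit Arguments.
Unset Strict Implicit.
Unset Printing Implicit Defensive.

Import Order.TTheory GRing.Theory Num.Theory.
Import numFieldNormedType.Exports.

Local Open Scope classical_set_scope.
Local Open Scope ring_scope.
Local Open Scope complex_scope.

(** The form merely embeds [X] into its dual and no inner product is available, so closed subspaces
    need not equal their double annihilators, and intersections need not vary continuously. Finite
    biorthogonal families ([dual_family]) take the place of orthogonal projections, and an
    intersection is shown to converge only once it is a component of a topological direct sum.

    Index 0 enters as dim V = dim (la cap mu): this makes la cap mu a complement of V^omega cap la
    in la.

    The delicate point in comparing charts is that the positive values of the fixed chart's form
    have no lower bound as s tends to s0: its definite vectors do not survive an ordinary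
    perturbation. But the forms of two charts differ by a term quadratic in the component of a
    vector along the fixed chart. A shift in the dual directions gains a multiple of the squared
    coordinates of this component. The multiple can be as large as required, because the fixed form
    tends to 0 on the shift itself. *)

Section RealNorms.
Variables (R : realType) (X : completeNormedModType R[i]).
Implicit Types (a b : R[i]) (x y : X).

(** Norms of [R[i]] and [X] have values in [R[i]], which is only partially ordered; real parts move
    all estimates to [R], where [lra] and [nra] apply. *)
Definition cabs (a : R[i]) : R := complex.Re `|a|.

Lemma cabsE a : `|a| = (cabs a)%:C.
Proof. by rewrite /cabs RRe_real// normr_real. Qed.

Lemma rnormE x : `|x| = (rnorm x)%:C.
Proof. by rewrite /rnorm RRe_real// normr_real. Qed.

Lemma cabs_ge0 a : 0 <= cabs a.
Proof. by rewrite -lecR -cabsE normr_ge0. Qed.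

Lemma rnorm_ge0 x : 0 <= rnorm x.
Proof. by rewrite -lecR -rnormE normr_ge0. Qed.

Lemma cabsM a b : cabs (a * b) = cabs a * cabs b.
Proof. by apply: complexI; rewrite rmorphM -!cabsE normrM. Qed.

Lemma cabsD a b : cabs (a + b) <= cabs a + cabs b.
Proof. by rewrite -lecR rmorphD -!cabsE ler_normD. Qed.

Lemma cabsN a : cabs (- a) = cabs a.
Proof. by apply: complexI; rewrite -!cabsE normrN. Qed.

Lemma cabs0 : cabs 0 = 0.
Proof. by apply: complexI; rewrite -cabsE normr0. Qed.

Lemma cabs0_eq0 a : cabs a = 0 -> a = 0.
Proof. by move=> h; apply/eqP; rewrite -normr_eq0 cabsE h. Qed.

Lemma cabs_real (r : R) : cabs r%:C = `|r|.
Proof. by rewrite /cabs normc_def /= expr0n addr0 sqrtr_sqr. Qed.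

Lemma cabs_conj a : cabs (Num.conj a) = cabs a.
Proof. by apply: complexI; rewrite -!cabsE norm_conjC. Qed.

Lemma Re_cabs a : complex.Re a <= cabs a.
Proof.
have := normc_ge_Re a; rewrite cabsE lecR; exact/le_trans/ler_norm.
Qed.

Lemma conjM_cabs a : a * Num.conj a = (cabs a ^+ 2)%:C.
Proof. by rewrite -normCK cabsE rmorphXn. Qed.

Lemma rnormZ a x : rnorm (a *: x) = cabs a * rnorm x.
Proof.
apply: complexI; rewrite -rnormE normrZ cabsE rnormE.
by rewrite -(rmorphM (real_complex R)).
Qed.

Lemma rnormD x y : rnorm (x + y) <= rnorm x + rnorm y.
Proof.
by rewrite -lecR (rmorphD (real_complex R)) /= -!rnormE ler_normD.
Qed.

Lemma rnormN x : rnorm (- x) = rnorm x.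
Proof. by apply: complexI; rewrite -!rnormE normrN. Qed.

Lemma rnormB x y : rnorm (x - y) <= rnorm x + rnorm y.
Proof. by rewrite (le_trans (rnormD _ _))// rnormN. Qed.

Lemma rdistC x y : rnorm (x - y) = rnorm (y - x).
Proof. by rewrite -rnormN opprB. Qed.

Lemma rnorm0 : rnorm (0 : X) = 0.
Proof. by apply: complexI; rewrite -rnormE normr0. Qed.

Lemma rnorm0_eq0 x : rnorm x = 0 -> x = 0.
Proof. by move=> h; apply/eqP; rewrite -normr_eq0 rnormE h. Qed.

Lemma rnorm_gt0 x : x != 0 -> 0 < rnorm x.
Proof. by move=> x0; rewrite -ltcR -rnormE normr_gt0. Qed.

Lemma rnorm_dist z x y : rnorm (x - y) <= rnorm (x - z) + rnorm (z - y).
Proof. by rewrite (le_trans _ (rnormD _ _))// addrA subrK. Qed.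

Lemma rnorm_le_dist x y : rnorm x <= rnorm y + rnorm (x - y).
Proof. by rewrite -{1}(subrK y x) addrC rnormD. Qed.

Lemma rnorm_sum n (x : 'I_n -> X) :
  rnorm (\sum_i x i) <= \sum_i rnorm (x i).
Proof.
elim/big_ind2: _ => [|u s v t us vt|//]; first by rewrite rnorm0.
by rewrite (le_trans (rnormD _ _))// lerD.
Qed.

Lemma cabs_sum n (a : 'I_n -> R[i]) :
  cabs (\sum_i a i) <= \sum_i cabs (a i).
Proof.
elim/big_ind2: _ => [|u s v t us vt|//]; first by rewrite cabs0.
by rewrite (le_trans (cabsD _ _))// lerD.
Qed.

Lemma rnorm_ballE x y (e : R) : ball x e%:C y <-> rnorm (x - y) < e.
Proof. by rewrite -ball_normE /= rnormE ltcR. Qed.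

(** Positivity in [R[i]] includes being real, so the balls of [X], whose radii lie in [R[i]], are
    balls with real radii. *)
Lemma pos_complexP (e : R[i]) : 0 < e -> exists2 r : R, 0 < r & e = r%:C.
Proof.
move=> e0; exists (complex.Re e); last by rewrite RRe_real// gtr0_real.
by move: e0; rewrite ltcE => /andP[].
Qed.

Lemma closed_rnormP (A : set X) : closed A <->
  forall x, (forall e : R, 0 < e -> exists2 y, A y & rnorm (x - y) <= e) -> A x.
Proof.
split=> [cA x hx|h x hx].
  apply: cA => B /nbhs_ballP[e /= /pos_complexP[r r0 ->] sub].
  have [|y Ay hy] := hx (r / 2); first by lra.
  by exists y; split=> //; apply: sub; apply/rnorm_ballE; lra.
apply: h => e e0.
have [|y [Ay]] := hx (ball x e%:C).
  by apply: nbhsx_ballx; rewrite ltcR.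
by move=> /rnorm_ballE hy; exists y => //; exact: ltW.
Qed.

Lemma rnorm_complete (u : nat -> X) :
  (forall e : R, 0 < e -> exists N, forall m n, (N <= m)%N -> (N <= n)%N ->
     rnorm (u m - u n) <= e) ->
  exists l, forall e : R, 0 < e -> exists N, forall n, (N <= n)%N ->
     rnorm (u n - l) <= e.
Proof.
move=> cu.
have : cvg (u @ \oo).
  apply/cauchy_cvgP/cauchy_ballP => _ /pos_complexP[r r0 ->].
  have [|N hN] := cu (r / 2); first by lra.
  exists ([set u n | n in [set n | (N <= n)%N]], [set u n | n in [set n | (N <= n)%N]]).
    by split; exists N => // n /= Nn; exists n.
  move=> [_ _] [/= [m /= Nm <-] [n /= Nn <-]].
  by apply/rnorm_ballE; have := hN _ _ Nm Nn; lra.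
move=> /cvg_ex[l ul]; exists l => e e0.
have /= := ul (ball l e%:C) (nbhsx_ballx l _ _).
rewrite ltcR => /(_ e0)[N _ hN]; exists N => n Nn.
by rewrite rdistC; apply/ltW/rnorm_ballE; exact: hN.
Qed.

End RealNorms.

(** * Sums of subspaces *)

Section LinearSets.
Variables (R : realType) (X : completeNormedModType R[i]).
Implicit Types (a b : R[i]) (x y : X) (A B M N P : set X).

Lemma lin_intro A : A 0 -> (forall a x y, A x -> A y -> A (a *: x + y)) ->
  subspace_of_space A.
Proof.
move=> A0 AZ; split; first by rewrite inE.
by move=> a x y; rewrite !inE; exact: AZ.
Qed.

Section Closure.
Variables (A : set X) (lA : subspace_of_space A).

Lemma lin0 : A 0.
Proof. by case: lA => + _; rewrite inE. Qed.

Lemma linP a x y : A x -> A y -> A (a *: x + y).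
Proof. by case: lA => _ /(_ a x y); rewrite !inE. Qed.

Lemma linD x y : A x -> A y -> A (x + y).
Proof. by move=> Ax Ay; rewrite -[x]scale1r; exact: linP. Qed.

Lemma linZ a x : A x -> A (a *: x).
Proof. by move=> Ax; rewrite -[_ *: _]addr0; apply: linP => //; exact: lin0. Qed.

Lemma linN x : A x -> A (- x).
Proof. by move=> Ax; rewrite -scaleN1r; exact: linZ. Qed.

Lemma linB x y : A x -> A y -> A (x - y).
Proof. by move=> Ax Ay; apply: linD => //; exact: linN. Qed.

Lemma lin_sum n (x : 'I_n -> X) : (forall i, A (x i)) -> A (\sum_i x i).
Proof.
by move=> Ax; elim/big_ind: _ => [|u v Au Av|//]; [exact: lin0|exact: linD].
Qed.

End Closure.

Lemma lin_set0 : subspace_of_space [set 0 : X].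
Proof. by apply: lin_intro => //= a x y -> ->; rewrite scaler0 addr0. Qed.

Lemma linT : subspace_of_space [set: X].
Proof. exact: lin_intro. Qed.

Lemma linI A B : subspace_of_space A -> subspace_of_space B ->
  subspace_of_space (A `&` B).
Proof.
move=> lA lB; apply: lin_intro; first by split; exact: lin0.
by move=> a x y [Ax Bx] [Ay By]; split; exact: linP.
Qed.

Lemma sumsetP A B x : sumset A B x <-> exists2 a, A a & B (x - a).
Proof.
split=> [[a Aa [b Bb <-]]|[a Aa Bxa]].
  by exists a => //; rewrite addrAC subrr add0r.
by exists a => //; exists (x - a) => //; rewrite addrC subrK.
Qed.

Lemma sumset_lin A B : subspace_of_space A -> subspace_of_space B ->
  subspace_of_space (sumset A B).
Proof.
move=> lA lB; apply: lin_intro.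
  by exists 0; [exact: lin0|exists 0; [exact: lin0|rewrite addr0]].
move=> a _ _ [x Ax [y By <-]] [u Au [v Bv <-]].
exists (a *: x + u); first exact: linP.
by exists (a *: y + v); [exact: linP|rewrite scalerDr addrACA].
Qed.

Lemma sumset_l A B : subspace_of_space B -> A `<=` sumset A B.
Proof. by move=> lB x Ax; exists x => //; exists 0; [exact: lin0|rewrite addr0]. Qed.

Lemma sumset_r A B : subspace_of_space A -> B `<=` sumset A B.
Proof. by move=> lA x Bx; exists 0; [exact: lin0|exists x; rewrite ?add0r]. Qed.

Lemma sumsetS A B M N : A `<=` M -> B `<=` N -> sumset A B `<=` sumset M N.
Proof. by move=> AM BN _ [x /AM Mx [y /BN Ny <-]]; exists x => //; exists y. Qed.

Lemma sumset_sub A B M : subspace_of_space M -> A `<=` M -> B `<=` M ->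
  sumset A B `<=` M.
Proof. by move=> lM AM BM _ [x /AM Mx [y /BM My <-]]; exact: linD. Qed.

Lemma sumsetC A B : sumset A B = sumset B A.
Proof.
by rewrite predeqE => x; split=> -[u Au [v Bv <-]]; exists v => //; exists u;
  rewrite // addrC.
Qed.

Lemma sumsetA A B M : sumset A (sumset B M) = sumset (sumset A B) M.
Proof.
rewrite predeqE => x; split.
  move=> [u Au [_ [v Bv [z Mz <-]] <-]]; exists (u + v).
    by exists u => //; exists v.
  by exists z; rewrite // addrA.
move=> [_ [u Au [v Bv <-]] [z Mz <-]]; exists u => //.
by exists (v + z); [exists v => //; exists z|rewrite addrA].
Qed.

Lemma sumset0 A : sumset A [set 0] = A.
Proof.
rewrite predeqE => x; split=> [[u Au [_ -> <-]]|Ax]; first by rewrite addr0.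
by exists x => //; exists 0; rewrite ?addr0.
Qed.

Lemma capset0 A B : subspace_of_space A -> subspace_of_space B ->
  (forall x, A x -> B x -> x = 0) -> A `&` B = [set 0].
Proof.
move=> lA lB h; rewrite predeqE => x; split=> [[Ax Bx]|->] /=; first exact: h.
by split; exact: lin0.
Qed.

Lemma capset0_eq A B x : A `&` B = [set 0] -> A x -> B x -> x = 0.
Proof. by move=> h Ax Bx; have : (A `&` B) x by []; rewrite h. Qed.

Lemma dsum_uniq A B (a b a' b' : X) : subspace_of_space A -> subspace_of_space B ->
  A `&` B = [set 0] -> A a -> B b -> A a' -> B b' -> a + b = a' + b' ->
  a = a' /\ b = b'.
Proof.
move=> lA lB h Aa Bb Aa' Bb' e.
have e' : a - a' = b' - b by apply/eqP; rewrite subr_eq addrAC eq_sym subr_eq addrC e addrC.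
have z : a - a' = 0.
  by apply: (capset0_eq h); [exact: linB|rewrite e'; exact: linB].
by split; apply/eqP; [rewrite -subr_eq0 z|rewrite eq_sym -subr_eq0 -e' z].
Qed.

End LinearSets.

(** * Topological direct sums and their stability *)

Section BoundedSums.
Variables (R : realType) (X : completeNormedModType R[i]).
Implicit Types (x y : X) (A B M N : set X) (K e : R).

(** Quantitative directness: the inverse of the addition map on A x B has norm at most [K]. Unlike a
    trivial intersection, this survives small perturbations. *)
Definition bsum K A B := forall a b, A a -> B b ->
  rnorm a + rnorm b <= K * rnorm (a + b).

(** One half of a gap estimate, made homogeneous and with the infimum replaced by a witness. *)
Definition subclose e A B := forall x, A x ->
  exists2 y, B y & rnorm (x - y) <= e * rnorm x.

Lemma bsumS K A B M N : A `<=` M -> B `<=` N -> bsum K M N -> bsum K A B.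
Proof. by move=> AM BN h a b /AM Ma /BN Nb; exact: h. Qed.

Lemma bsum_cap0 K A B : subspace_of_space A -> subspace_of_space B ->
  bsum K A B -> A `&` B = [set 0].
Proof.
move=> lA lB h; apply: capset0 => // x Ax Bx.
have /h : A (- x) by exact: linN.
move=> /(_ _ Bx); rewrite addNr rnorm0 mulr0 rnormN => e.
by apply: rnorm0_eq0; have := rnorm_ge0 x; lra.
Qed.

Lemma bsumA K K' A B M : 0 <= K' -> 0 <= K ->
  bsum K A (sumset B M) -> bsum K' B M -> bsum (K * (1 + K')) (sumset A B) M.
Proof.
move=> K0 K'0 h h' _ c [a Aa [b Bb <-]] Mc.
have /(h _ _ Aa) : sumset B M (b + c) by exists b => //; exists c.
rewrite addrA; have := h' _ _ Bb Mc; have := rnormD a b.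
have := rnorm_ge0 a; have := rnorm_ge0 b; have := rnorm_ge0 c.
have := rnorm_ge0 (b + c).
move: (rnorm (a + b + c)) (rnorm (b + c)) => u v.
by move: (rnorm (a + b)) (rnorm a) (rnorm b) (rnorm c) => p q r s *; nra.
Qed.

Lemma half_small (c e : R) : 0 < e -> exists n, c / 2 ^+ n <= e.
Proof.
move=> e0; exists (Num.truncn `|c / e|).+1.
rewrite ler_pdivrMr ?exprn_gt0// mulrC -ler_pdivrMr//.
apply: (le_trans (ler_norm _)); apply: ltW.
apply: (lt_le_trans (truncnS_gt _)).
by rewrite -natrX ler_nat ltnW// ltn_expl.
Qed.

Lemma le_halves (t s c : R) : (forall n, t <= s + c / 2 ^+ n) -> t <= s.
Proof.
move=> h; apply/ler_addgt0Pr => e e0.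
have [n hn] := half_small c e0.
by apply: (le_trans (h n)); rewrite lerD2l.
Qed.

(** Comparison with the geometric series, whose tail from n on is [2 * c / 2 ^+ n]. *)
Lemma geom_cvg (u : nat -> X) (c : R) :
  (forall k, rnorm (u k.+1 - u k) <= c / 2 ^+ k) ->
  exists l, forall n, rnorm (u n - l) <= 2 * c / 2 ^+ n.
Proof.
move=> h; have h2 k : (2 : R) ^+ k > 0 by rewrite exprn_gt0.
have c0 : 0 <= c.
  by have := h 0%N; rewrite expr0 divr1; exact/le_trans/rnorm_ge0.
(* A difference of two tails, rather than one tail, is what makes the induction on k close. *)
have step n k : rnorm (u (n + k)%N - u n) <= 2 * c / 2 ^+ n - 2 * c / 2 ^+ (n + k).
  elim: k => [|k IH]; first by rewrite addn0 !subrr rnorm0.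
  have := rnorm_dist (u (n + k)%N) (u (n + k.+1)%N) (u n).
  have := h (n + k)%N; rewrite -!addnS.
  have -> : 2 * c / 2 ^+ (n + k.+1) = c / 2 ^+ (n + k).
    by rewrite addnS exprS invfM mulrACA mulfV ?mul1r// pnatr_eq0.
  move: IH; have -> : 2 * c / 2 ^+ (n + k) = 2 * (c / 2 ^+ (n + k)) by rewrite mulrA.
  by lra.
have step' n k : (n <= k)%N -> rnorm (u k - u n) <= 2 * c / 2 ^+ n.
  move=> nk; rewrite -(subnKC nk); apply: (le_trans (step _ _)).
  by rewrite gerBl divr_ge0 ?mulr_ge0// ltW.
have [e e0|l hl] := @rnorm_complete _ _ u.
  have [|N hN] := @half_small (2 * c) (e / 2); first by lra.
  exists N => m n Nm Nn; have := rnorm_dist (u N) (u m) (u n).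
  have := step' _ _ Nm; have := step' _ _ Nn; rewrite (rdistC (u N)).
  by lra.
exists l => n; apply/ler_addgt0Pr => e e0.
have [N hN] := hl _ e0.
have := rnorm_dist (u (maxn N n)) (u n) l.
have := step' n (maxn N n) (leq_maxr _ _); rewrite (rdistC (u n) (u _)).
by have := hN (maxn N n) (leq_maxl _ _); lra.
Qed.

(** Successive approximation, as in the second half of the open mapping theorem: the remainder is
    halved at every step, so both components are sums of geometric series. Completeness gives the
    limits and closedness keeps them in [A] and [B]. *)
Lemma iterate_decomposition A B K : 0 <= K ->
  subspace_of_space A -> subspace_of_space B -> closed A -> closed B ->
  (forall x, exists a b, [/\ A a, B b, rnorm a + rnorm b <= K * rnorm x &
     rnorm (x - (a + b)) <= rnorm x / 2]) ->
  forall x, exists a b, [/\ A a, B b, x = a + b &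
     rnorm a + rnorm b <= 2 * K * rnorm x].
Proof.
move=> K0 lA lB /closed_rnormP cA /closed_rnormP cB h x.
have h2 k : (2 : R) ^+ k > 0 by rewrite exprn_gt0.
have /choice[f /choice[g fg]] := h.
pose r := fix r n := if n is k.+1 then r k - (f (r k) + g (r k)) else x.
have rN n : rnorm (r n) <= rnorm x / 2 ^+ n.
  elim: n => [|n IH] /=; first by rewrite expr0 divr1.
  have [_ _ _] := fg (r n); move/le_trans; apply.
  by rewrite exprSr invfM mulrA ler_pdivrMr// mulfVK.
pose SA n := \sum_(k < n) f (r k); pose SB n := \sum_(k < n) g (r k).
have ASA n : A (SA n) by apply: lin_sum => // i; case: (fg (r i)).
have BSB n : B (SB n) by apply: lin_sum => // i; case: (fg (r i)).
have fgb k : rnorm (f (r k)) + rnorm (g (r k)) <= K * rnorm x / 2 ^+ k.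
  have [_ _ hk _] := fg (r k); apply: (le_trans hk).
  by rewrite -mulrA ler_wpM2l.
have [k|a ha] := @geom_cvg SA (K * rnorm x).
  rewrite /SA big_ord_recr /= addrAC subrr add0r.
  by have := fgb k; have := rnorm_ge0 (g (r k)); lra.
have [k|b hb] := @geom_cvg SB (K * rnorm x).
  rewrite /SB big_ord_recr /= addrAC subrr add0r.
  by have := fgb k; have := rnorm_ge0 (f (r k)); lra.
set C := K * rnorm x in fgb ha hb.
have xE n : x = r n + (SA n + SB n).
  elim: n => [|n IH]; first by rewrite /SA /SB !big_ord0 !addr0.
  rewrite {1}IH /SA /SB !big_ord_recr /= -/(SA n) -/(SB n).
  by rewrite [X in _ = _ + X]addrACA [X in _ = _ + X]addrC [RHS]addrA subrK.
exists a, b; split.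
- apply: cA => e e0; have [n hn] := half_small (2 * C) e0.
  by exists (SA n) => //; rewrite rdistC; exact: (le_trans (ha n)).
- apply: cB => e e0; have [n hn] := half_small (2 * C) e0.
  by exists (SB n) => //; rewrite rdistC; exact: (le_trans (hb n)).
- apply/eqP; rewrite -subr_eq0; apply/eqP/rnorm0_eq0/le_anti.
  rewrite rnorm_ge0 andbT; apply: (@le_halves _ _ (rnorm x + 4 * C)) => n.
  rewrite add0r {1}(xE n).
  have -> : r n + (SA n + SB n) - (a + b) = r n + ((SA n - a) + (SB n - b)).
    by rewrite opprD -addrA [X in _ + X = _]addrACA.
  have := rnormD (r n) ((SA n - a) + (SB n - b)).
  have := rnormD (SA n - a) (SB n - b); have := ha n; have := hb n; have := rN n.
  by rewrite mulrDl; lra.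
(* Bounding [a] and [b] separately by [geom_cvg] would cost [4 * K]; the joint partial sums give
   [2 * K]. *)
- have sb n : rnorm (SA n) + rnorm (SB n) <= 2 * C - 2 * C / 2 ^+ n.
    elim: n => [|n IH].
      by rewrite /SA /SB !big_ord0 !rnorm0 expr0 divr1 subrr addr0.
    rewrite /SA /SB !big_ord_recr /= -/(SA n) -/(SB n).
    have := rnormD (SA n) (f (r n)); have := rnormD (SB n) (g (r n)).
    have := fgb n.
    have -> : 2 * C / 2 ^+ n.+1 = C / 2 ^+ n.
      by rewrite exprS invfM mulrACA mulfV ?mul1r// pnatr_eq0.
    by move: IH; rewrite -!mulrA; lra.
  rewrite -mulrA -/C; apply: (@le_halves _ _ (4 * C)) => n.
  have := rnorm_le_dist a (SA n); have := rnorm_le_dist b (SB n).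
  rewrite (rdistC a) (rdistC b); have := ha n; have := hb n; have := sb n.
  have : 0 <= C / 2 ^+ n by rewrite divr_ge0 ?mulr_ge0 ?rnorm_ge0// ltW.
  by lra.
Qed.

(** By [bsum], the components of a convergent sequence of sums are themselves Cauchy; a fast
    sequence is chosen so that [geom_cvg] applies to them. *)
Lemma sumset_closed A B K :
  subspace_of_space A -> subspace_of_space B -> closed A -> closed B ->
  0 <= K -> bsum K A B -> closed (sumset A B).
Proof.
move=> lA lB cA cB K0 h; apply/closed_rnormP => x hx.
have h2 k : (2 : R) ^+ k > 0 by rewrite exprn_gt0.
have /choice[f /choice[g fg]] : forall n : nat, exists a b,
    [/\ A a, B b & rnorm (x - (a + b)) <= 1 / 2 ^+ n].
  move=> n; have [|y [a Aa [b Bb <-]] hy] := hx (1 / 2 ^+ n).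
    by rewrite divr_gt0.
  by exists a, b.
have d k : rnorm (f k.+1 - f k) + rnorm (g k.+1 - g k) <= K * 2 / 2 ^+ k.
  have [A1 B1 n1] := fg k; have [A2 B2 n2] := fg k.+1.
  have := h _ _ (linB lA A2 A1) (linB lB B2 B1).
  move/le_trans; apply; rewrite -mulrA ler_wpM2l//.
  have -> : f k.+1 - f k + (g k.+1 - g k) = (x - (f k + g k)) - (x - (f k.+1 + g k.+1)).
    by rewrite opprB [RHS]addrC [RHS]addrA subrK opprD addrACA.
  apply: (le_trans (rnormB _ _)).
  have : 1 / 2 ^+ k.+1 <= 1 / 2 ^+ k :> R.
    by rewrite ler_wpM2l// lef_pV2 ?posrE// ler_eXn2l// ltr1n.
  by lra.
have [k|a ha] := @geom_cvg f (K * 2).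
  by have := d k; have := rnorm_ge0 (g k.+1 - g k); lra.
have [k|b hb] := @geom_cvg g (K * 2).
  by have := d k; have := rnorm_ge0 (f k.+1 - f k); lra.
have ee e : 0 < e -> exists n, rnorm (f n - a) <= e /\ rnorm (g n - b) <= e /\
    rnorm (x - (f n + g n)) <= e.
  move=> e0; have [n hn] := half_small (2 * (K * 2) + 1) e0; exists n.
  have := ha n; have := hb n; have [_ _] := fg n.
  have : 0 <= 1 / 2 ^+ n :> R by rewrite divr_ge0// ltW.
  have : 0 <= 2 * (K * 2) / 2 ^+ n by rewrite divr_ge0 ?mulr_ge0// ltW.
  by move: hn; rewrite mulrDl; lra.
have Aa : A a.
  move/closed_rnormP: cA; apply => e /ee[n [hn _]]; exists (f n).
    by case: (fg n).
  by rewrite rdistC.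
have Bb : B b.
  move/closed_rnormP: cB; apply => e /ee[n [_ [hn _]]]; exists (g n).
    by case: (fg n).
  by rewrite rdistC.
exists a => //; exists b => //; apply/esym/eqP; rewrite -subr_eq0.
apply/eqP/rnorm0_eq0/le_anti; rewrite rnorm_ge0 andbT.
apply/ler_addgt0Pr => e e0; rewrite add0r.
have [|n [h1 [h2' h3]]] := ee (e / 3); first by lra.
have -> : x - (a + b) = (x - (f n + g n)) + ((f n - a) + (g n - b)).
  by rewrite [(_ - a) + _]addrACA [RHS]addrA subrK opprD.
have := rnormD (x - (f n + g n)) ((f n - a) + (g n - b)).
by have := rnormD (f n - a) (g n - b); lra.
Qed.

(** Replacing [a'] and [b'] by neighbours in [A] and [B] costs [e] times |a'| + |b'| on the left and
    [e * K] times it on the right; together this is at most half of the left side and is absorbed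
    there. *)
Lemma bsum_stable A B A' B' K e : 0 <= K -> 0 <= e -> e * (K + 1) <= 1 / 2 ->
  bsum K A B -> subclose e A' A -> subclose e B' B -> bsum (2 * K) A' B'.
Proof.
move=> K0 e0 eK h cA cB a' b' /cA[a Aa ha] /cB[b Bb hb].
have := h _ _ Aa Bb; have := rnorm_le_dist a' a; have := rnorm_le_dist b' b.
have : rnorm (a + b) <= rnorm (a' + b') + e * (rnorm a' + rnorm b').
  have -> : a + b = (a' + b') - ((a' - a) + (b' - b)).
    by rewrite [(a' - a) + _]addrACA opprD addrA subrr add0r opprD !opprK.
  apply: (le_trans (rnormB _ _)); have := rnormD (a' - a) (b' - b).
  by lra.
have := rnorm_ge0 a'; have := rnorm_ge0 b'; move: ha hb.
move: (rnorm (a + b)) (rnorm (a' + b')) => u v.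
move: (rnorm a') (rnorm b') (rnorm a) (rnorm b) (rnorm (a' - a)) (rnorm (b' - b)).
move=> p q r s t z *.
have q1 : p + q <= K * u + e * (p + q) by nra.
have q2 : K * u <= K * (v + e * (p + q)) by rewrite ler_wpM2l.
by nra.
Qed.

(** A vector is decomposed along [A] and [B], and its components are replaced by neighbours in [A']
    and [B']. As [e * K] is at most 1 / 2, the error is at most half of the vector, and the
    procedure is iterated. *)
Lemma sumset_stable A B A' B' K e :
  0 <= K -> 0 <= e -> e <= 1 -> e * K <= 1 / 2 ->
  subspace_of_space A' -> subspace_of_space B' -> closed A' -> closed B' ->
  bsum K A B -> sumset A B = setT -> subclose e A A' -> subclose e B B' ->
  sumset A' B' = setT.
Proof.
move=> K0 e0 e1 eK lA lB cA cB h AB clA clB.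
rewrite -subTset => x _.
have [|y|a [b [Aa Bb -> _]]] :=
    @iterate_decomposition A' B' (2 * K) _ lA lB cA cB _ x.
- by rewrite mulr_ge0.
- have : sumset A B y by rewrite AB.
  move=> [a Aa [b Bb yE]].
  have [a' Aa' ha] := clA _ Aa; have [b' Bb' hb] := clB _ Bb.
  exists a', b'; split=> //.
    have := h _ _ Aa Bb; rewrite yE.
    have := rnorm_le_dist a' a; have := rnorm_le_dist b' b.
    rewrite (rdistC b') (rdistC a'); have := rnorm_ge0 a; have := rnorm_ge0 b.
    move: ha hb; move: (rnorm a') (rnorm b') (rnorm a) (rnorm b) (rnorm y).
    by move: (rnorm (a - a')) (rnorm (b - b')) => *; nra.
  have -> : y - (a' + b') = (a - a') + (b - b') by rewrite -yE addrACA opprD.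
  apply: (le_trans (rnormD _ _)).
  have := h _ _ Aa Bb; rewrite yE => hy.
  have : e * (rnorm a + rnorm b) <= e * K * rnorm y.
    by rewrite -mulrA ler_wpM2l.
  have := rnorm_ge0 y; move: ha hb.
  move: (rnorm a) (rnorm b) (rnorm y) => r s v *; nra.
by exists a => //; exists b.
Qed.

End BoundedSums.

(** * Open mapping and finite dimensional subspaces *)

Section OpenMapping.
Variables (R : realType) (X : completeNormedModType R[i]).
Implicit Types (x y : X) (A B M N : set X) (K e : R).

(* Baire's argument: if no bounded part of [A + B] is dense in a ball, nested
   balls avoiding all of them shrink to a point outside [A + B]. *)
Lemma sumset_bounded_dense A B : sumset A B = setT ->
  exists (n : nat) (x : X) (r : R), 0 < r /\
    forall y, rnorm (y - x) < r -> forall e, 0 < e -> exists a b,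
      [/\ A a, B b, rnorm a <= n%:R, rnorm b <= n%:R &
          rnorm (y - (a + b)) <= e].
Proof.
move=> AB; apply: contrapT => hn.
have step (p : nat * (X * R)) : exists q : X * R, 0 < p.2.2 ->
    [/\ 0 < q.2, rnorm (q.1 - p.2.1) + q.2 <= p.2.2, q.2 <= p.2.2 / 2 &
        forall a b, A a -> B b -> rnorm a <= p.1%:R -> rnorm b <= p.1%:R ->
          q.2 < rnorm (q.1 - (a + b))].
  case: p => n [x r] /=; have [r0|r0] := pselect (0 < r); last by exists (x, r).
  apply: contrapT => hq; apply: hn; exists n, x, r; split=> // y yx e e0.
  apply: contrapT => he; apply: hq.
  pose q := Num.min e (Num.min (r - rnorm (y - x)) r) / 2.
  have q0 : 0 < Num.min e (Num.min (r - rnorm (y - x)) r).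
    by rewrite !lt_min e0 r0 subr_gt0 yx.
  have : q * 2 <= e by rewrite /q mulfVK// ge_min lexx.
  have : q * 2 <= r - rnorm (y - x) by rewrite /q mulfVK// !ge_min lexx orbT.
  have : q * 2 <= r by rewrite /q mulfVK// !ge_min lexx !orbT.
  have : 0 < q by rewrite divr_gt0.
  move: q => q q1 q2 q3 q4; exists (y, q) => _ /=; split; [by []|lra|lra|].
  move=> a b Aa Bb na nb; rewrite ltNge; apply/negP => le; apply: he.
  by exists a, b; split=> //; lra.
have /choice[nx hnx] := step.
pose s := fix s k := if k is k.+1 then nx (k, s k) else (0 : X, 1 : R).
have s0 k : 0 < (s k).2.
  by elim: k => [|k IH] /=; [exact: ltr01|case: (hnx (k, s k) IH)].
have sS k := hnx (k, s k) (s0 k).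
have sN k : (s k).2 <= 1 / 2 ^+ k.
  elim: k => [|k IH]; first by rewrite /= expr0 divr1.
  have [_ _ /= h _] := sS k; apply: (le_trans h).
  by rewrite exprSr invfM mulrA ler_wpM2r// invr_ge0.
have [k|l hl] := @geom_cvg _ _ (fun k => (s k).1) 1.
  apply: le_trans (sN k); have [/= h1 h2 _ _] := sS k.
  by have := s0 k.+1; rewrite /=; lra.
have mono k m : rnorm ((s (k + m)%N).1 - (s k).1) + (s (k + m)%N).2 <= (s k).2.
  elim: m => [|m IH]; first by rewrite addn0 subrr rnorm0 add0r.
  rewrite addnS; have [/= h1 h2 _ _] := sS (k + m)%N.
  by have := rnorm_dist (s (k + m)%N).1 (nx ((k + m)%N, s (k + m)%N)).1 (s k).1; lra.
have lk k : rnorm ((s k).1 - l) <= (s k).2.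
  apply: (@le_halves _ _ _ 2) => n.
  have := mono k n; have := hl (k + n)%N; have := s0 (k + n)%N.
  have := rnorm_dist (s (k + n)%N).1 (s k).1 l; rewrite (rdistC (s k).1 (s (k + n)%N).1).
  have : 2 * 1 / 2 ^+ (k + n) <= 2 / 2 ^+ n :> R.
    rewrite mulr1 ler_wpM2l// lef_pV2 ?posrE ?exprn_gt0// ler_eXn2l ?ltr1n//.
    exact: leq_addl.
  by lra.
have : sumset A B l by rewrite AB.
move=> [a Aa [b Bb lE]].
pose m := (maxn (Num.truncn (rnorm a)).+1 (Num.truncn (rnorm b)).+1).
have ma : rnorm a <= m%:R.
  apply/ltW/(lt_le_trans (truncnS_gt _)); rewrite ler_nat; exact: leq_maxl.
have mb : rnorm b <= m%:R.
  apply/ltW/(lt_le_trans (truncnS_gt _)); rewrite ler_nat; exact: leq_maxr.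
have [_ _ _ /(_ _ _ Aa Bb ma mb)] := sS m.
by rewrite lE /=; have := lk m.+1; rewrite /=; lra.
Qed.

(** Differences of approximations near the centre of the ball found by Baire's argument approximate
    every vector up to half its norm. After iteration the bound holds for some decomposition, and
    directness makes it the given one. *)
Lemma open_mapping A B : subspace_of_space A -> subspace_of_space B ->
  closed A -> closed B -> sumset A B = setT -> A `&` B = [set 0] ->
  exists2 K, 0 <= K & bsum K A B.
Proof.
move=> lA lB cA cB AB AB0.
have [n [x [r [r0 hr]]]] := sumset_bounded_dense AB.
have K0 : 0 <= 8 * n%:R / r by rewrite divr_ge0// ?ltW// mulr_ge0.
have dec := @iterate_decomposition _ _ A B _ K0 lA lB cA cB.
exists (2 * (8 * n%:R / r)); first by rewrite mulr_ge0.
move=> a b Aa Bb; have [y|a' [b' [Aa' Bb' e h]]] := dec _ (a + b); last first.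
  have [-> ->] := dsum_uniq lA lB AB0 Aa Bb Aa' Bb' e.
  by rewrite -e.
have [->|y0] := eqVneq y 0.
  by exists 0, 0; rewrite addr0 subr0 !rnorm0 addr0 !mulr0 mul0r lexx; split=> //; exact: lin0.
have ny := rnorm_gt0 y0.
(* With this scale [c * y] has norm r / 2, inside the ball, and the two errors r / 8 add up to half
   of that norm. The components have total norm at most 4 n, which after division by [c] gives the
   factor 8 n / r. *)
pose c : R := r / (2 * rnorm y).
have c0 : 0 < c by rewrite divr_gt0// mulr_gt0.
have cc : cabs c%:C = c by rewrite cabs_real gtr0_norm.
have cy : c * rnorm y = r / 2.
  by rewrite /c invfM mulrA mulfVK// gt_eqF.
have [||a1 [b1 [A1 B1 na1 nb1 h1]]] := hr (x + c%:C *: y) _ (r / 8).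
- by rewrite addrAC subrr add0r rnormZ cc cy; lra.
- by lra.
have [||a2 [b2 [A2 B2 na2 nb2 h2]]] := hr x _ (r / 8).
- by rewrite subrr rnorm0.
- by lra.
have ci : cabs (c^-1)%:C = c^-1 by rewrite cabs_real gtr0_norm// invr_gt0.
have sc (u : R) v : u <= c * v -> c^-1 * u <= v.
  by move=> uv; rewrite mulrC ler_pdivrMr// mulrC.
exists ((c^-1)%:C *: (a1 - a2)), ((c^-1)%:C *: (b1 - b2)); split.
- by apply: linZ => //; exact: linB.
- by apply: linZ => //; exact: linB.
- rewrite !rnormZ ci -mulrDr; apply: sc.
  have -> : c * (8 * n%:R / r * rnorm y) = 8 * n%:R / r * (c * rnorm y) by ring.
  rewrite cy; have -> : 8 * n%:R / r * (r / 2) = 4 * n%:R.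
    by field; rewrite gt_eqF.
  by have := rnormB a1 a2; have := rnormB b1 b2; lra.
- have -> : y - ((c^-1)%:C *: (a1 - a2) + (c^-1)%:C *: (b1 - b2)) =
      (c^-1)%:C *: ((x + c%:C *: y - (a1 + b1)) - (x - (a2 + b2))).
    rewrite -scalerDr; have {1}-> : y = (c^-1)%:C *: (c%:C *: y).
      by rewrite scalerA -(rmorphM (real_complex R)) mulVf ?gt_eqF// scale1r.
    rewrite -scalerBr; congr (_ *: _).
    have key (u z p q : X) : (u + z - p) - (u - q) = z - (p - q).
      rewrite opprB -addrA (addrC u) -addrA; congr (z + _).
      by rewrite addrCA [u + _]addrC subrK opprB addrC.
    by rewrite key; congr (_ - _); rewrite opprD addrACA.
  rewrite rnormZ ci; apply: sc; rewrite mulrA cy.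
  by have := rnormB (x + c%:C *: y - (a1 + b1)) (x - (a2 + b2)); lra.
Qed.

End OpenMapping.

(** * Finite families and dimensions modulo a subspace *)

Section Combinations.
Variables (R : realType) (X : completeNormedModType R[i]).
Implicit Types (x y : X) (A B M N P : set X) (K e : R).

Definition comb n (e : 'I_n -> X) (c : 'rV[R[i]]_n) : X := \sum_i c 0 i *: e i.

Lemma comb_linear n (e : 'I_n -> X) : linear (comb e).
Proof.
move=> a u v; rewrite /comb scaler_sumr -big_split; apply: eq_bigr => i _ /=.
by rewrite !mxE scalerDl scalerA.
Qed.

HB.instance Definition _ n (e : 'I_n -> X) :=
  GRing.isLinear.Build R[i] 'rV[R[i]]_n X *:%R (comb e) (comb_linear e).

Lemma comb_delta n (e : 'I_n -> X) i : comb e (delta_mx 0 i) = e i.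
Proof.
rewrite /comb (bigD1 i)//= mxE !eqxx scale1r big1 ?addr0// => j ji.
by rewrite mxE eqxx (negbTE ji) scale0r.
Qed.

Lemma linear_comb n (f : {linear 'rV[R[i]]_n -> X}) c :
  f c = comb (fun i => f (delta_mx 0 i)) c.
Proof. by rewrite {1}(row_sum_delta c) linear_sum; apply: eq_bigr => i _; rewrite linearZ. Qed.

Lemma lin_comb A n (e : 'I_n -> X) c : subspace_of_space A ->
  (forall i, A (e i)) -> A (comb e c).
Proof. by move=> lA Ae; apply: lin_sum => // i; exact: linZ. Qed.

Lemma comb_mul m n (e : 'I_n -> X) (H : 'M[R[i]]_(m, n)) c :
  comb (fun i => comb e (row i H)) c = comb e (c *m H).
Proof.
rewrite /comb; under eq_bigr do rewrite scaler_sumr.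
rewrite exchange_big; apply: eq_bigr => j _ /=; rewrite mxE scaler_suml.
by apply: eq_bigr => i _; rewrite scalerA !mxE.
Qed.

Lemma comb_funB n (e e' : 'I_n -> X) c :
  comb (fun i => e i - e' i) c = comb e c - comb e' c.
Proof.
rewrite /comb -sumrB; apply: eq_bigr => i _ /=; exact: scalerBr.
Qed.

Lemma rnorm_comb n (e : 'I_n -> X) c (k : R) : (forall i, rnorm (e i) <= k) ->
  rnorm (comb e c) <= (\sum_i cabs (c 0 i)) * k.
Proof.
move=> ek; apply: (le_trans (rnorm_sum _)); rewrite mulr_suml.
by apply: ler_sum => i _; rewrite rnormZ ler_wpM2l// cabs_ge0.
Qed.

Definition span n (e : 'I_n -> X) : set X := range (comb e).

Lemma span_lin n (e : 'I_n -> X) : subspace_of_space (span e).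
Proof.
apply: lin_intro; first by exists 0; rewrite // linear0.
by move=> a _ _ [u _ <-] [v _ <-]; exists (a *: u + v); rewrite // linearP.
Qed.

Lemma span_mem n (e : 'I_n -> X) i : span e (e i).
Proof. by exists (delta_mx 0 i); rewrite // comb_delta. Qed.

Lemma span_sub n (e : 'I_n -> X) A : subspace_of_space A ->
  (forall i, A (e i)) -> span e `<=` A.
Proof. by move=> lA Ae _ [c _ <-]; exact: lin_comb. Qed.

(** A basis of P / N given by representatives, so that quotient spaces are never formed. *)
Definition basis_mod P N n (e : 'I_n -> X) :=
  [/\ forall i, P (e i), forall c, N (comb e c) -> c = 0 &
      forall x, P x -> exists c, N (x - comb e c)].

Lemma qdimP P N n : subspace_of_space P ->
  qdim P N n <-> exists e : 'I_n -> X, basis_mod P N e.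
Proof.
move=> lP; split=> [[f [fP fN sub]]|[e [eP eN sub]]].
  exists (fun i => f (delta_mx 0 i)); split.
  - by move=> i; apply: fP; exists (delta_mx 0 i).
  - by move=> c; rewrite -linear_comb; exact: fN.
  - move=> x /sub/sumsetP[_ [c _ <-] Nx]; exists c.
    by rewrite -linear_comb.
exists (comb e); split=> //; first exact: span_sub.
move=> x /sub[c Nc]; apply/sumsetP; exists (comb e c) => //.
Qed.

Lemma basis_modP P n (e : 'I_n -> X) : basis_mod P [set 0] e <->
  [/\ forall i, P (e i), forall c, comb e c = 0 -> c = 0 & P `<=` span e].
Proof.
split=> -[eP e0 es]; split=> //.
  by move=> x /es[c /= /subr0_eq ->]; exists c.
by move=> x /es[c _ <-]; exists c; rewrite /= subrr.
Qed.

Lemma spanE P n (e : 'I_n -> X) : subspace_of_space P ->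
  basis_mod P [set 0] e -> P = span e.
Proof.
by move=> lP /basis_modP[eP _ Ps]; apply/seteqP; split=> //; exact: span_sub.
Qed.

Lemma kernel_row m n (H : 'M[R[i]]_(m, n)) : (n < m)%N ->
  exists2 c : 'rV_m, c != 0 & c *m H = 0.
Proof.
move=> nm; have : kermx H != 0.
  rewrite -mxrank_eq0 mxrank_ker subn_eq0 -ltnNge.
  exact: leq_ltn_trans (rank_leq_col H) nm.
move=> /rowV0Pn[c cK c0]; exists c => //.
by apply/sub_kermxP.
Qed.

(** Steinitz by matrices: a coefficient matrix with more rows than columns has a left kernel vector,
    which is a linear relation among the [f i] modulo [N]. *)
Lemma independent_le_spanning N m n (f : 'I_m -> X) (e : 'I_n -> X) :
  subspace_of_space N ->
  (forall i, exists c, N (f i - comb e c)) -> (forall c, N (comb f c) -> c = 0) ->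
  (m <= n)%N.
Proof.
move=> lN /choice[h hh] fN; rewrite leqNgt; apply/negP => nm.
have [c c0 cH] := kernel_row (\matrix_i h i) nm.
move/eqP: c0; apply; apply: fN.
have -> : comb f c = comb (fun i => f i - comb e (h i)) c.
  rewrite comb_funB.
  have -> : comb (fun i => comb e (h i)) c = 0; last by rewrite subr0.
  have -> : (fun i => comb e (h i)) = (fun i => comb e (row i (\matrix_i h i))).
    by apply/funext => i; rewrite rowK.
  by rewrite comb_mul cH linear0.
exact: lin_comb.
Qed.

Lemma qdim_uniq P N m n : subspace_of_space P -> subspace_of_space N ->
  qdim P N m -> qdim P N n -> m = n.
Proof.
move=> lP lN /(qdimP _ _ lP)[e [eP e0 es]] /(qdimP _ _ lP)[f [fP f0 fs]].
apply/anti_leq/andP; split.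
  by apply: (@independent_le_spanning N _ _ e f) => // i; exact: fs.
by apply: (@independent_le_spanning N _ _ f e) => // i; exact: es.
Qed.

Definition join m n (e : 'I_m -> X) (f : 'I_n -> X) (i : 'I_(m + n)) : X :=
  match fintype.split i with inl j => e j | inr j => f j end.

Lemma comb_join m n (e : 'I_m -> X) (f : 'I_n -> X) c :
  comb (join e f) c = comb e (lsubmx c) + comb f (rsubmx c).
Proof.
rewrite /comb big_split_ord /=; congr (_ + _); apply: eq_bigr => i _.
  by rewrite /join (unsplitK (inl i)) !mxE.
by rewrite /join (unsplitK (inr i)) !mxE.
Qed.

Lemma join_in A m n (e : 'I_m -> X) (f : 'I_n -> X) :
  (forall i, A (e i)) -> (forall i, A (f i)) -> forall i, A (join e f i).
Proof. by move=> Ae Af i; rewrite /join; case: (fintype.split i). Qed.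

(** A vector outside the span could be joined to the family and would give n + 1 independent vectors
    modulo [N]. *)
Lemma basis_mod_of_dim P N n (e : 'I_n -> X) :
  subspace_of_space P -> subspace_of_space N -> qdim P N n ->
  (forall i, P (e i)) -> (forall c, N (comb e c) -> c = 0) -> basis_mod P N e.
Proof.
move=> lP lN /(qdimP _ _ lP)[f [fP f0 fs]] eP e0; split=> // x Px.
apply: contrapT => hx.
pose e' := join e (fun _ : 'I_1 => x).
suff : (n + 1 <= n)%N by rewrite addn1 ltnn.
apply: (@independent_le_spanning N _ _ e' f) => //.
  by move=> i; apply: fs; exact: join_in.
move=> c; rewrite comb_join {2}/comb big_ord1 => Nc.
have [r0|r0] := eqVneq (rsubmx c 0 0) 0.
  move: Nc; rewrite r0 scale0r addr0 => /e0 l0.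
  rewrite -[c]hsubmxK l0; have -> : rsubmx c = 0.
    by apply/matrixP => i j; rewrite !ord1 r0 mxE.
  by rewrite row_mx0.
case: hx; exists (- (rsubmx c 0 0)^-1 *: lsubmx c).
rewrite linearZ /= scaleNr opprK.
have -> : x + (rsubmx c 0 0)^-1 *: comb e (lsubmx c) =
    (rsubmx c 0 0)^-1 *: (comb e (lsubmx c) + rsubmx c 0 0 *: x).
  by rewrite scalerDr scalerA mulVf// scale1r addrC.
exact: linZ.
Qed.

Lemma qdimD P M N m n : subspace_of_space P -> subspace_of_space M ->
  N `<=` M -> M `<=` P -> subspace_of_space N ->
  qdim P M m -> qdim M N n -> qdim P N (m + n).
Proof.
move=> lP lM NM MP lN /(qdimP _ _ lP)[e [eP e0 es]] /(qdimP _ _ lM)[f [fM f0 fs]].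
apply/(qdimP _ _ lP); exists (join e f); split.
- by apply: join_in => // i; exact: MP.
- move=> c; rewrite comb_join => Nc.
  have l0 : lsubmx c = 0.
    apply: e0; rewrite -[comb e _](addrK (comb f (rsubmx c))).
    by apply: linB => //; [exact: NM|exact: lin_comb].
  rewrite -[c]hsubmxK l0 (_ : rsubmx c = 0) ?row_mx0//.
  by apply: f0; move: Nc; rewrite l0 linear0 add0r.
- move=> x /es[c /fs[d Nd]]; exists (row_mx c d).
  by rewrite comb_join row_mxKl row_mxKr opprD addrA.
Qed.

Lemma qdim_sub P M N n : subspace_of_space P -> subspace_of_space M ->
  subspace_of_space N -> M `<=` P -> qdim P N n -> exists k, qdim M N k.
Proof.
move=> lP lM lN MP /(qdimP _ _ lP)[e [eP e0 es]].
pose Q k := `[< exists f : 'I_k -> X,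
   (forall i, M (f i)) /\ (forall c, N (comb f c) -> c = 0) >].
have Q0 : Q 0%N.
  apply/asboolP; exists (fun=> 0); split=> [|c _]; first by case.
  by apply/matrixP => i [].
have Qn k : Q k -> (k <= n)%N.
  move=> /asboolP[f [fM f0]]; apply: (@independent_le_spanning N _ _ f e) => //.
  by move=> i; exact/es/MP.
case: (@ex_maxnP Q n (ex_intro Q _ Q0) Qn) => k /asboolP[f [fM f0]] kmax.
exists k; apply/(qdimP _ _ lM); exists f; split=> // x Mx.
apply: contrapT => hx.
suff /kmax : Q (k + 1)%N by rewrite addn1 ltnn.
apply/asboolP; exists (join f (fun _ : 'I_1 => x)); split; first exact: join_in.
move=> c; rewrite comb_join {2}/comb big_ord1 => Nc.
have [r0|r0] := eqVneq (rsubmx c 0 0) 0.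
  move: Nc; rewrite r0 scale0r addr0 => /f0 l0.
  rewrite -[c]hsubmxK l0; have -> : rsubmx c = 0.
    by apply/matrixP => i j; rewrite !ord1 r0 mxE.
  by rewrite row_mx0.
case: hx; exists (- (rsubmx c 0 0)^-1 *: lsubmx c).
rewrite linearZ /= scaleNr opprK.
have -> : x + (rsubmx c 0 0)^-1 *: comb f (lsubmx c) =
    (rsubmx c 0 0)^-1 *: (comb f (lsubmx c) + rsubmx c 0 0 *: x).
  by rewrite scalerDr scalerA mulVf// scale1r addrC.
exact: linZ.
Qed.

(** Closedness makes the distance d from [x] to [M] positive, so |t x + m| >= |t| d. This bounds the
    component on the line by |x| / d, and the triangle inequality bounds the other one. *)
Lemma line_closed_sum M x : subspace_of_space M -> closed M -> ~ M x ->
  exists2 K, 0 <= K & bsum K (span (fun _ : 'I_1 => x)) M.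
Proof.
move=> lM /closed_rnormP cM Mx.
have [d d0 hd] : exists2 d : R, 0 < d & forall y, M y -> d <= rnorm (x - y).
  apply: contrapT => h; apply: Mx; apply: cM => e e0.
  apply: contrapT => he; apply: h; exists e => // y My.
  by rewrite leNgt; apply/negP => lt; apply: he; exists y => //; exact: ltW.
have x0 := rnorm_ge0 x.
have K0 : 0 <= rnorm x / d by rewrite divr_ge0// ltW.
exists (2 * (rnorm x / d) + 1); first by lra.
move=> _ m [c _ <-] Mm; rewrite /comb big_ord1; set t := c 0 0.
have h : rnorm (t *: x) <= rnorm x / d * rnorm (t *: x + m).
  have [->|t0] := eqVneq t 0.
    by rewrite scale0r rnorm0 mulr_ge0// rnorm_ge0.
  have -> : t *: x + m = t *: (x - (- t^-1 *: m)).
    by rewrite scalerBr scalerA mulrN mulfV// scaleN1r opprK.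
  rewrite !rnormZ mulrCA; apply: ler_wpM2l; first exact: cabs_ge0.
  by rewrite -mulrA ler_peMr// mulrC ler_pdivlMr// mul1r hd//; exact: linZ.
have := rnorm_le_dist m (t *: x + m).
by rewrite opprD addrCA subrr addr0 rnormN; lra.
Qed.

Lemma real_cauchy (u : nat -> R) :
  (forall e : R, 0 < e -> exists N : nat, forall m n, (N <= m)%N -> (N <= n)%N ->
     `|u m - u n| <= e) ->
  exists l, forall e : R, 0 < e -> exists N : nat, forall n, (N <= n)%N ->
     `|u n - l| <= e.
Proof.
move=> cu.
have : cvg (u @ \oo).
  apply/cauchy_cvgP/cauchy_ballP => r r0.
  have [|N hN] := cu (r / 2); first by rewrite divr_gt0.
  exists ([set u n | n in [set n | (N <= n)%N]], [set u n | n in [set n | (N <= n)%N]]).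
    by split; exists N => // n /= Nn; exists n.
  move=> [_ _] [/= [m /= Nm <-] [n /= Nn <-]].
  by rewrite -ball_normE /=; have := hN _ _ Nm Nn; lra.
move=> /cvg_ex[l ul]; exists l => e e0.
have [N _ hN] := ul (ball l e) (nbhsx_ballx l _ e0); exists N => n Nn.
by have := hN n Nn; rewrite -ball_normE /= distrC => /ltW.
Qed.

Lemma cabs_ReIm (a : R[i]) : cabs a <= `|complex.Re a| + `|complex.Im a|.
Proof.
rewrite {1}[a]complexE; apply: (le_trans (cabsD _ _)).
rewrite cabsM !cabs_real (_ : cabs 'i%C = 1) ?mul1r//.
by rewrite /cabs normc_def /= expr0n add0r expr1n sqrtr1.
Qed.

Lemma Im_cabs (a : R[i]) : `|complex.Im a| <= cabs a.
Proof.
rewrite -lecR -cabsE normc_def lecR -sqrtr_sqr ler_sqrt ?lerDr ?sqr_ge0//.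
by rewrite addr_ge0 ?sqr_ge0.
Qed.

Lemma Re_abs_cabs (a : R[i]) : `|complex.Re a| <= cabs a.
Proof. by rewrite -lecR -cabsE; exact: normc_ge_Re. Qed.

(** The coefficients of approximating multiples of [x] form a Cauchy sequence; its limit is
    assembled from the limits of the real and imaginary parts. *)
Lemma line_closed x : closed (span (fun _ : 'I_1 => x)).
Proof.
apply/closed_rnormP => y hy.
have [x0|x0] := eqVneq x 0.
  exists 0 => //; rewrite linear0; apply/esym/rnorm0_eq0/le_anti.
  rewrite rnorm_ge0 andbT; apply/ler_addgt0Pr => e /hy[_ [c _ <-]].
  by rewrite /comb big_ord1 x0 scaler0 subr0 add0r.
have nx := rnorm_gt0 x0.
have /choice[t ht] : forall n : nat, exists t : R[i], rnorm (y - t *: x) <= rnorm x / n.+1%:R.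
  move=> n; have [|_ [c _ <-] h] := hy (rnorm x / n.+1%:R); first by rewrite divr_gt0.
  by exists (c 0 0); move: h; rewrite /comb big_ord1.
have d m n : cabs (t m - t n) <= m.+1%:R^-1 + n.+1%:R^-1.
  rewrite -(ler_pM2r nx) -rnormZ scalerBl mulrDl.
  have := rnorm_dist y (t m *: x) (t n *: x); rewrite (rdistC (t m *: x) y).
  by move/le_trans; apply; rewrite ![_^-1 * _]mulrC lerD.
have small e : 0 < e -> exists N : nat, forall n, (N <= n)%N -> n.+1%:R^-1 <= e :> R.
  move=> e0; exists (Num.truncn e^-1) => n Nn.
  rewrite -[e]invrK lef_pV2 ?posrE ?invr_gt0//.
  by apply/ltW/(lt_le_trans (truncnS_gt _)); rewrite ler_nat ltnS.
have dsmall e : 0 < e -> exists N : nat, forall m n, (N <= m)%N -> (N <= n)%N ->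
    cabs (t m - t n) <= e.
  move=> e0; have [|N hN] := small (e / 2); first by lra.
  exists N => m n /hN m1 /hN n1; by apply: (le_trans (d m n)); rewrite [e]splitr lerD.
have [e e0|r hr] := @real_cauchy (fun n => complex.Re (t n)).
  have [N hN] := dsmall e e0; exists N => m n Nm Nn.
  by rewrite -raddfB; exact: le_trans (Re_abs_cabs _) (hN _ _ Nm Nn).
have [e e0|s hs] := @real_cauchy (fun n => complex.Im (t n)).
  have [N hN] := dsmall e e0; exists N => m n Nm Nn.
  by rewrite -raddfB; exact: le_trans (Im_cabs _) (hN _ _ Nm Nn).
exists (const_mx (r +i* s)%C) => //; rewrite /comb big_ord1 mxE.
apply/eqP; rewrite eq_sym -subr_eq0; apply/eqP/rnorm0_eq0/le_anti.
rewrite rnorm_ge0 andbT; apply/ler_addgt0Pr => e e0; rewrite add0r.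
pose h := e / (3 * rnorm x).
have h0 : 0 < h by rewrite divr_gt0// mulr_gt0.
have he : h * rnorm x = e / 3 by rewrite /h invfM mulrA mulfVK// gt_eqF.
have [N1 h1] := hr _ h0; have [N2 h2] := hs _ h0; have [N3 h3] := small _ h0.
pose N := maxn N1 (maxn N2 N3).
have := h1 N (leq_maxl _ _).
have := h2 N (leq_trans (leq_maxl _ _) (leq_maxr _ _)).
have := h3 N (leq_trans (leq_maxr _ _) (leq_maxr _ _)).
move=> g3 g2 g1.
have := rnorm_dist (t N *: x) y ((r +i* s)%C *: x).
rewrite -scalerBl rnormZ => /le_trans; apply.
have : cabs (t N - (r +i* s)%C) <= 2 * h.
  apply: (le_trans (cabs_ReIm _)); rewrite !raddfB /=; lra.
rewrite -(ler_pM2r nx) -mulrA he => g4.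
have := ht N; have : rnorm x / N.+1%:R <= e / 3.
  by rewrite -he mulrC ler_wpM2r// ltW.
move: (rnorm x / _) => u; lra.
Qed.

(** Induction with [M] varying: the line through the first vector is absorbed into [M], which stays
    closed, and [bsumA] reassociates the sum at the end. *)
Lemma finite_dim_sum M n (e : 'I_n -> X) : subspace_of_space M -> closed M ->
  (forall c, M (comb e c) -> c = 0) ->
  exists K, [/\ 0 <= K, bsum K (span e) M & closed (sumset (span e) M)].
Proof.
elim: n e M => [|n IH] e M lM cM h.
  exists 1; split=> //.
    by move=> _ m [c _ <-] Mm; rewrite /comb big_ord0 rnorm0 !add0r mul1r.
  suff -> : sumset (span e) M = M by [].
  rewrite predeqE => x; split=> [[_ [c _ <-] [m Mm <-]]|Mx].
    by rewrite /comb big_ord0 add0r.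
  by exists 0; [exists 0; rewrite // linear0|exists x; rewrite // add0r].
pose f := (fun i => e (lift ord0 i)); pose L := span (fun _ : 'I_1 => e ord0).
have combS c : comb e c = comb f (\row_i c 0 (lift ord0 i)) + c 0 ord0 *: e ord0.
  rewrite /comb big_ord_recl addrC; congr (_ + _).
  by apply: eq_bigr => i _; rewrite mxE.
have spanS : span e = sumset (span f) L.
  rewrite predeqE => x; split=> [[c _ <-]|[_ [c _ <-] [_ [d _ <-] <-]]].
    rewrite combS; exists (comb f (\row_i c 0 (lift ord0 i))); first by eexists.
    exists (c 0 ord0 *: e ord0) => //; exists (const_mx (c 0 ord0)) => //.
    by rewrite /comb big_ord1 mxE.
  exists (\row_i (if unlift ord0 i is Some j then c 0 j else d 0 0)) => //.
  rewrite combS mxE unlift_none /comb big_ord1; congr (_ + _).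
  by apply: eq_bigr => i _; rewrite !mxE liftK.
have Me0 : ~ M (e ord0).
  rewrite -(comb_delta e) => /h/rowP/(_ ord0); rewrite !mxE !eqxx => /eqP.
  by rewrite oner_eq0.
have lL : subspace_of_space L := span_lin _.
have [K K0 hK] := line_closed_sum lM cM Me0.
have cLM := sumset_closed lL lM (@line_closed _) cM K0 hK.
have [c [_ [d _ <-] [m Mm cE]]|K' [K'0 hK' cK']] := IH f _ (sumset_lin lL lM) cLM.
  pose c' : 'rV_n.+1 := \row_i (if unlift ord0 i is Some j then c 0 j else - d 0 0).
  have : M (comb e c').
    rewrite combS mxE unlift_none (_ : \row__ _ = c); last first.
      by apply/rowP => i; rewrite !mxE liftK.
    by rewrite -cE /comb big_ord1 scaleNr addrAC subrr add0r.
  by move/h/rowP => c'0; apply/rowP => i; have := c'0 (lift ord0 i); rewrite !mxE liftK.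
exists (K' * (1 + K)); rewrite spanS -sumsetA; split=> //.
  by rewrite mulr_ge0// addr_ge0.
exact: bsumA.
Qed.

Lemma finite_dim_closed n (e : 'I_n -> X) : (forall c, comb e c = 0 -> c = 0) ->
  closed (span e).
Proof.
move=> h; have c0 : closed [set (0 : X)].
  apply/closed_rnormP => x hx; apply/rnorm0_eq0/le_anti; rewrite rnorm_ge0 andbT.
  by apply/ler_addgt0Pr => e0 /hx[_ ->]; rewrite subr0 add0r.
by have [K [_ _]] := finite_dim_sum (lin_set0 X) c0 h; rewrite sumset0.
Qed.

End Combinations.

(** * Convergence in the gap *)

Section GapConvergence.
Variables (R : realType) (X : completeNormedModType R[i]).
Implicit Types (x y : X) (A B : set X) (e : R).

Lemma dist_to_le x B y : B y -> dist_to x B <= rnorm (x - y).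
Proof.
move=> By; apply: ge_inf; last by exists y.
by exists 0 => _ [z _ <-]; exact: rnorm_ge0.
Qed.

Lemma dist_to_ge0 x B : 0 <= dist_to x B.
Proof.
rewrite /dist_to; have [->|/set0P ne] := eqVneq [set rnorm (x - y) | y in B] set0.
  by rewrite inf0.
by apply: lb_le_inf => // _ [z _ <-]; exact: rnorm_ge0.
Qed.

Lemma dist_to_lt x B e : B !=set0 -> dist_to x B < e ->
  exists2 y, B y & rnorm (x - y) < e.
Proof.
move=> [b Bb] h; have [|_ [y By <-] hy] := @inf_lt _ [set rnorm (x - y) | y in B] _ _ h.
  by exists (rnorm (x - b)); exists b.
by exists y.
Qed.

Lemma semigap_ub A B x : subspace_of_space B -> A x -> rnorm x = 1 ->
  dist_to x B <= semigap A B.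
Proof.
move=> lB Ax x1; apply: ub_le_sup; last by exists x.
exists 1 => _ [z [_ z1] <-]; apply: (le_trans (dist_to_le _ (lin0 lB))).
by rewrite subr0 z1.
Qed.

Lemma semigap_lt A B e : subspace_of_space A -> subspace_of_space B ->
  semigap A B < e -> subclose e A B.
Proof.
move=> lA lB h x Ax; have [->|x0] := eqVneq x 0.
  by exists 0; [exact: lin0|rewrite subr0 rnorm0 mulr0].
have nx := rnorm_gt0 x0.
pose c : R[i] := ((rnorm x)^-1)%:C.
have cc : cabs c = (rnorm x)^-1 by rewrite cabs_real gtr0_norm// invr_gt0.
have u1 : rnorm (c *: x) = 1 by rewrite rnormZ cc mulVf// gt_eqF.
have [||y By hy] := @dist_to_lt (c *: x) B e; first by exists 0; exact: lin0.
  by apply: le_lt_trans h; apply: semigap_ub => //; exact: linZ.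
exists ((rnorm x)%:C *: y); first exact: linZ.
have -> : x - (rnorm x)%:C *: y = (rnorm x)%:C *: (c *: x - y).
  by rewrite scalerBr scalerA -(rmorphM (real_complex R)) mulfV ?gt_eqF// scale1r.
by rewrite rnormZ cabs_real gtr0_norm// mulrC ler_wpM2r// ltW.
Qed.

Lemma semigap_le A B e : 0 <= e -> subclose e A B -> semigap A B <= e.
Proof.
move=> e0 h; rewrite /semigap.
have [->|/set0P ne] :=
    eqVneq [set dist_to x B | x in [set x | A x /\ rnorm x = 1]] set0.
  by rewrite sup0.
apply: ge_sup => // _ [x [Ax x1] <-]; have [y By] := h x Ax.
by rewrite x1 mulr1; apply/le_trans/dist_to_le.
Qed.

Lemma semigap_ge0 A B : subspace_of_space B -> 0 <= semigap A B.
Proof.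
move=> lB; have [e|/set0P[_ [x [Ax x1] _]]] :=
    eqVneq [set dist_to x B | x in [set x | A x /\ rnorm x = 1]] set0.
  by rewrite /semigap e sup0.
exact: le_trans (dist_to_ge0 _ _) (semigap_ub lB Ax x1).
Qed.

Section Filters.
Variables (T : Type) (F : set_system T) (FF : Filter F).

(** Gap convergence with witnesses. The filter is arbitrary because the same families are later
    restricted to smaller parameter sets. *)
Definition gcv (M : T -> set X) (M0 : set X) := forall e, 0 < e ->
  \forall s \near F, subclose e (M s) M0 /\ subclose e M0 (M s).

Definition vcv (x : T -> X) (x0 : X) := forall e, 0 < e ->
  \forall s \near F, rnorm (x s - x0) <= e.

Definition lincl (M : T -> set X) :=
  \forall s \near F, subspace_of_space (M s) /\ closed (M s).

Lemma vcv_cst x : vcv (fun=> x) x.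
Proof. by move=> e e0; apply: nearW => _; rewrite subrr rnorm0 ltW. Qed.

Lemma gcv_cst A : gcv (fun=> A) A.
Proof.
move=> e e0; apply: nearW => _; split=> x Ax; exists x => //;
  by rewrite subrr rnorm0 mulr_ge0 ?rnorm_ge0 ?ltW.
Qed.

(** The selection must not depend on e and the distance to [M s] need not be attained: a vector at
    less than twice the distance serves for all e at once. *)
Lemma gcv_select (M : T -> set X) (M0 : set X) x :
  lincl M -> gcv M M0 -> M0 x ->
  exists2 x' : T -> X, \forall s \near F, M s (x' s) & vcv x' x.
Proof.
move=> Ml Mcv M0x.
have /choice[x' hx'] : forall s, exists y, subspace_of_space (M s) /\ closed (M s) ->
    M s y /\ forall e, 0 < e -> subclose e M0 (M s) -> rnorm (y - x) <= 2 * e * rnorm x.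
  move=> s; have [[lM cM]|//] := pselect (subspace_of_space (M s) /\ closed (M s));
    last by exists 0.
  have [Mx|Mx] := pselect (M s x).
    exists x => _; split=> // e e0 _; rewrite subrr rnorm0.
    by rewrite mulr_ge0 ?rnorm_ge0// mulr_ge0// ltW.
  (* Positivity, which comes from closedness, makes twice the distance strictly larger than the
     distance. *)
  have d0 : 0 < dist_to x (M s).
    rewrite lt_neqAle dist_to_ge0 andbT; apply/negP => /eqP d0; apply: Mx.
    move/closed_rnormP: cM; apply => e e0.
    have [||y My hy] := @dist_to_lt x (M s) e; first by exists 0; exact: lin0.
      by rewrite -d0.
    by exists y => //; exact: ltW.
  have [||y My hy] := @dist_to_lt x (M s) (2 * dist_to x (M s)).
  - by exists 0; exact: lin0.
  - by lra.
  exists y => _; split=> // e e0 /(_ _ M0x)[z Mz hz].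
  by have := dist_to_le x Mz; rewrite (rdistC y); lra.
exists x'; first by apply: filterS Ml => s /hx'[].
move=> e e0; pose e' := e / (2 * (rnorm x + 1)).
have x1 : 0 < rnorm x + 1 by have := rnorm_ge0 x; lra.
have e'0 : 0 < e' by rewrite divr_gt0// mulr_gt0.
have e'E : e' * (2 * (rnorm x + 1)) = e by rewrite mulfVK// gt_eqF// mulr_gt0.
apply: filterS2 Ml (Mcv _ e'0) => s lM [_ cl].
have [_ /(_ _ e'0 cl)] := hx' s lM; move: (rnorm (x' s - x)) => u.
by nra.
Unshelve. all: end_near. Qed.

(** Approximating the two summands gives errors relative to their norms; [bsum], in the limit with
    [K] and nearby with [2 * K], turns them into errors relative to the norm of the sum. *)
Lemma gcv_sumset (A B : T -> set X) (A0 B0 : set X) K : 0 <= K ->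
  bsum K A0 B0 -> gcv A A0 -> gcv B B0 ->
  gcv (fun s => sumset (A s) (B s)) (sumset A0 B0).
Proof.
move=> K0 h cA cB e e0.
pose e' := Num.min (e / (2 * (K + 1))) (1 / (2 * (K + 1))).
have K1 : 0 < 2 * (K + 1) by lra.
have e'0 : 0 < e' by rewrite lt_min !divr_gt0.
have e'1 : e' * (2 * (K + 1)) <= e.
  by rewrite -ler_pdivlMr// ge_min lexx.
have e'2 : e' * (2 * (K + 1)) <= 1.
  by rewrite -ler_pdivlMr// ge_min lexx orbT.
apply: filterS2 (cA _ e'0) (cB _ e'0) => s [A1 A2] [B1 B2].
have hs : bsum (2 * K) (A s) (B s).
  by apply: (@bsum_stable _ _ A0 B0 _ _ _ e') => //; [exact: ltW|lra].
split=> _ [a Aa [b Bb <-]].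
  have [a' Aa' ha] := A1 _ Aa; have [b' Bb' hb] := B1 _ Bb.
  exists (a' + b'); first by exists a' => //; exists b'.
  rewrite opprD addrACA; apply: (le_trans (rnormD _ _)).
  have := hs _ _ Aa Bb; move: ha hb.
  move: (rnorm (a - a')) (rnorm (b - b')) (rnorm_ge0 (a + b)).
  move: (rnorm a) (rnorm b) (rnorm (a + b)) => u v z p q *; nra.
have [a' Aa' ha] := A2 _ Aa; have [b' Bb' hb] := B2 _ Bb.
exists (a' + b'); first by exists a' => //; exists b'.
rewrite opprD addrACA; apply: (le_trans (rnormD _ _)).
have := h _ _ Aa Bb; move: ha hb.
move: (rnorm (a - a')) (rnorm (b - b')) (rnorm_ge0 (a + b)).
move: (rnorm a) (rnorm b) (rnorm (a + b)) => u v z p q *; nra.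
Qed.

(** [a'] and [b'] are first moved into [A0] and [B0]; the bound of the direct sum then applies to
    differences inside [A0] and [B0]. *)
Lemma component_dist A0 B0 A B K e a b a' b' :
  subspace_of_space A0 -> subspace_of_space B0 ->
  0 <= K -> bsum K A0 B0 -> subclose e A A0 -> subclose e B B0 ->
  A0 a -> B0 b -> A a' -> B b' ->
  rnorm (a' - a) + rnorm (b' - b) <=
    K * (rnorm ((a' + b') - (a + b)) + e * (rnorm a' + rnorm b'))
    + e * (rnorm a' + rnorm b').
Proof.
move=> lA lB K0 h cA cB Aa Bb /cA[u Au hu] /cB[v Bv hv].
have := h _ _ (linB lA Au Aa) (linB lB Bv Bb).
have := rnorm_dist u a' a; have := rnorm_dist v b' b.
have hz : rnorm (u - a + (v - b)) <=
    rnorm (a' + b' - (a + b)) + (rnorm (a' - u) + rnorm (b' - v)).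
  have -> : u - a + (v - b) = (a' + b' - (a + b)) - ((a' - u) + (b' - v)).
    rewrite addrACA -opprD (addrACA a') -opprD opprB.
    by rewrite [RHS]addrC addrA subrK.
  by have := rnormB (a' + b' - (a + b)) ((a' - u) + (b' - v)); have := rnormD (a' - u) (b' - v); lra.
move=> h1 h2 h3.
have h4 : K * rnorm (u - a + (v - b)) <=
    K * (rnorm (a' + b' - (a + b)) + e * (rnorm a' + rnorm b')).
  by rewrite ler_wpM2l//; lra.
by lra.
Qed.

Lemma gcv_direct (A B : T -> set X) (A0 B0 : set X) K : 0 <= K ->
  lincl A -> lincl B -> gcv A A0 -> gcv B B0 -> bsum K A0 B0 ->
  sumset A0 B0 = setT ->
  \forall s \near F, bsum (2 * K) (A s) (B s) /\ sumset (A s) (B s) = setT.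
Proof.
move=> K0 Al Bl cA cB h AB; pose e := 1 / (2 * (K + 1)).
have K1 : 0 < 2 * (K + 1) by lra.
have e0 : 0 < e by rewrite divr_gt0.
have eE : e * (2 * (K + 1)) = 1 by rewrite mulfVK// gt_eqF.
have e1 : e <= 1 by rewrite ler_pdivrMr//; lra.
near=> s.
have [//|lA clA] := near Al s; have [//|lB clB] := near Bl s.
have [//|A1 A2] := near (cA _ e0) s; have [//|B1 B2] := near (cB _ e0) s.
split; first by apply: (@bsum_stable _ _ A0 B0 _ _ _ e) => //; [exact: ltW|lra].
by apply: (@sumset_stable _ _ A0 B0 _ _ K e) => //; [exact: ltW|lra].
Unshelve. all: end_near. Qed.

Lemma gcv_bsum (A B : T -> set X) (A0 B0 : set X) K : 0 <= K ->
  gcv A A0 -> gcv B B0 -> bsum K A0 B0 ->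
  \forall s \near F, bsum (2 * K) (A s) (B s).
Proof.
move=> K0 cA cB h; pose e := 1 / (2 * (K + 1)).
have K1 : 0 < 2 * (K + 1) by lra.
have e0 : 0 < e by rewrite divr_gt0.
have eE : e * (2 * (K + 1)) = 1 by rewrite mulfVK// gt_eqF.
apply: filterS2 (cA _ e0) (cB _ e0) => s [A1 A2] [B1 B2].
by apply: (@bsum_stable _ _ A0 B0 _ _ _ e) => //; [exact: ltW|lra].
Qed.

(** Intersections are not continuous in the gap in general. Here [A] lies in [M] and X = A (+) B, so
    M cap B is the set of [B]-components of vectors of [M], and components depend continuously on
    the data. *)
Lemma gcv_cap (A B M : T -> set X) (A0 B0 M0 : set X) K : 0 <= K ->
  lincl A -> lincl B -> lincl M ->
  subspace_of_space A0 -> subspace_of_space B0 -> subspace_of_space M0 ->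
  gcv A A0 -> gcv B B0 -> gcv M M0 -> bsum K A0 B0 -> sumset A0 B0 = setT ->
  (\forall s \near F, A s `<=` M s) -> A0 `<=` M0 ->
  gcv (fun s => M s `&` B s) (M0 `&` B0).
Proof.
move=> K0 Al Bl Ml lA0 lB0 lM0 cA cB cM h AB AM AM0 e e0.
(* Large enough for both inclusions, which need 2 K + 1 and 4 K^2 + 5 K. *)
pose C := 4 * K * (K + 1) + 2 * K + 4 * K + 2.
have C0 : 0 < C by rewrite /C; nra.
pose e' := Num.min (e / C) 1.
have e'0 : 0 < e' by rewrite lt_min ltr01 divr_gt0.
have e'1 : e' * C <= e by rewrite -ler_pdivlMr// ge_min lexx.
have e'2 : e' <= 1 by rewrite ge_min lexx orbT.
have dir := gcv_direct K0 Al Bl cA cB h AB.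
near=> s.
have [//|lA clA] := near Al s; have [//|lB clB] := near Bl s.
have [//|lM clM] := near Ml s.
have [//|A1 A2] := near (cA _ e'0) s; have [//|B1 B2] := near (cB _ e'0) s.
have [//|M1 M2] := near (cM _ e'0) s; have [//|hs ABs] := near dir s.
have AMs : A s `<=` M s by near: s.
split=> x [Mx Bx].
  have [y My hy] := M1 _ Mx.
  have [a Aa [b Bb yE]] : sumset A0 B0 y by rewrite AB.
  have Mb : M0 b.
    have -> : b = y - a by rewrite -yE [RHS]addrC addKr.
    by apply: linB => //; exact: AM0.
  exists b => //.
  have := component_dist lA0 lB0 K0 h A1 B1 Aa Bb (lin0 lA) Bx.
  rewrite !add0r yE rnorm0 add0r; have := rnorm_ge0 (- a).
  have := rnorm_ge0 x; move: hy.
  move: (rnorm (x - y)) (rnorm (- a)) (rnorm (x - b)) (rnorm x) => p q r t h1 h2 h3 h4.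
  have h5 : K * (p + e' * t) <= K * (2 * e' * t) by rewrite ler_wpM2l//; lra.
  have h6 : e' * (2 * K + 1) * t <= e * t.
    rewrite ler_wpM2r//; apply: le_trans e'1; rewrite ler_wpM2l// /C; nra.
  lra.
have [y My hy] := M2 _ Mx.
have [a Aa [b Bb yE]] : sumset (A s) (B s) y by rewrite ABs.
have Mb : M s b.
  have -> : b = y - a by rewrite -yE [RHS]addrC addKr.
  by apply: linB => //; exact: AMs.
exists b => //; rewrite rdistC.
have := component_dist lA0 lB0 K0 h A1 B1 (lin0 lA0) Bx Aa Bb.
have := hs _ _ Aa Bb; rewrite add0r yE subr0; have := rnorm_ge0 a.
have := rnorm_le_dist y x; rewrite (rdistC y x); have := rnorm_ge0 x; move: hy.
move: (rnorm (x - y)) (rnorm (b - x)) (rnorm x) (rnorm y) => p q t u.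
move: (rnorm a) (rnorm b) => r z h1 h2 h3 h4 h5 h6.
have pt : p <= t by apply: (le_trans h1); rewrite ler_piMl.
have h7 : r + z <= 4 * K * t.
  apply: (le_trans h5); have : 2 * K * u <= 2 * K * (2 * t) by rewrite ler_wpM2l//; lra.
  lra.
have h8 : e' * (r + z) <= e' * (4 * K * t) by rewrite ler_wpM2l// ltW.
have h9 : K * (p + e' * (r + z)) <= K * (e' * t + e' * (4 * K * t)).
  by rewrite ler_wpM2l//; lra.
have h10 : e' * (4 * K * K + 5 * K) * t <= e * t.
  rewrite ler_wpM2r//; apply: le_trans e'1; rewrite ler_wpM2l// /C; nra.
lra.
Unshelve. all: end_near. Qed.

End Filters.

Lemma path_on_gcv (D : set R) (M : R -> set X) s0 : path_on D M -> D s0 ->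
  lincl (within D (nbhs s0)) M /\ gcv (within D (nbhs s0)) M (M s0).
Proof.
move=> [lM cM] Ds0; split; first by near=> s; apply: lM; near: s; exact: withinT.
move=> e e0; have /cvgrPdist_lt/(_ e e0) h := cM _ Ds0.
have w : \forall s \near within D (nbhs s0), D s by exact: withinT.
apply: filterS2 h w => s; rewrite sub0r normrN => h Ds.
have [l0 _] := lM _ Ds0; have [ls _] := lM _ Ds.
have {h} : gap (M s) (M s0) < e by exact: le_lt_trans (ler_norm _) h.
by rewrite gt_max => /andP[h1 h2]; split; exact: semigap_lt.
Unshelve. all: end_near. Qed.

Lemma gcv_path_on (D : set R) (M : R -> set X) :
  (forall s, D s -> subspace_of_space (M s)) -> (forall s, D s -> closed (M s)) ->
  (forall s0, D s0 -> gcv (within D (nbhs s0)) M (M s0)) -> path_on D M.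
Proof.
move=> lM cM h; split=> [s Ds|s0 Ds0]; first by split; [exact: lM|exact: cM].
apply/cvgrPdist_le => e e0.
have w : \forall s \near within D (nbhs s0), D s by exact: withinT.
apply: filterS2 (h _ Ds0 _ e0) w => s [h1 h2] Ds.
rewrite sub0r normrN ger0_norm.
  by rewrite ge_max !semigap_le// ltW.
by rewrite le_max semigap_ge0//; exact: lM.
Qed.

End GapConvergence.

(** * Skew-Hermitian forms *)

Section SkewForms.
Variables (R : realType) (X : completeNormedModType R[i]).
Implicit Types (a : R[i]) (x y z : X) (A B M N P V : set X).

(** A predicate on plain functions, so that a form can be negated freely: passing to [- w] exchanges
    positive and negative Morse indices. *)
Definition skew (w : X -> X -> R[i]) :=
  (forall a x y z, w (a *: x + y) z = a * w x z + w y z) /\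
  (forall x y, w x y = - Num.conj (w y x)).

Definition orth (w : X -> X -> R[i]) A : set X :=
  [set x | forall y, A y -> w x y = 0].

Lemma skew_opp w : skew w -> skew (fun x y => - w x y).
Proof.
move=> [wl ws]; split=> [a x y z|x y]; first by rewrite wl opprD mulrN.
by rewrite {1}ws rmorphN.
Qed.

Section Algebra.
Variables (w : X -> X -> R[i]) (ws : skew w).

Lemma skewC x y : w x y = - Num.conj (w y x).
Proof. by case: ws. Qed.

Lemma skewP a x y z : w (a *: x + y) z = a * w x z + w y z.
Proof. by case: ws. Qed.

Lemma skew0l z : w 0 z = 0.
Proof.
have := skewP 1 0 0 z; rewrite scaler0 add0r mul1r => /eqP.
by rewrite -{1}[w 0 z]addr0 (inj_eq (addrI _)) => /eqP.
Qed.

Lemma skewZl a x z : w (a *: x) z = a * w x z.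
Proof. by rewrite -[a *: x]addr0 skewP skew0l addr0. Qed.

Lemma skewDl x y z : w (x + y) z = w x z + w y z.
Proof. by rewrite -[x]scale1r skewP mul1r scale1r. Qed.

Lemma skewNl x z : w (- x) z = - w x z.
Proof. by rewrite -scaleN1r skewZl mulN1r. Qed.

Lemma skewBl x y z : w (x - y) z = w x z - w y z.
Proof. by rewrite skewDl skewNl. Qed.

Lemma skewDr x y z : w z (x + y) = w z x + w z y.
Proof. by rewrite skewC skewDl rmorphD opprD -!skewC. Qed.

Lemma skewZr a x z : w z (a *: x) = Num.conj a * w z x.
Proof. by rewrite skewC skewZl rmorphM -mulrN -skewC. Qed.

Lemma skewNr x z : w z (- x) = - w z x.
Proof. by rewrite skewC skewNl rmorphN -skewC. Qed.

Lemma skewBr x y z : w z (x - y) = w z x - w z y.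
Proof. by rewrite skewDr skewNr. Qed.

Lemma skew0r z : w z 0 = 0.
Proof. by rewrite skewC skew0l rmorph0 oppr0. Qed.

Lemma skew_eq0C x y : w x y = 0 -> w y x = 0.
Proof. by move=> h; rewrite skewC h rmorph0 oppr0. Qed.

Lemma skew_suml n (x : 'I_n -> X) z : w (\sum_i x i) z = \sum_i w (x i) z.
Proof.
by elim/big_ind2: _ => [|x1 x2 y1 y2 <- <-|//]; rewrite ?skew0l// skewDl.
Qed.

Lemma skew_sumr n (x : 'I_n -> X) z : w z (\sum_i x i) = \sum_i w z (x i).
Proof.
by elim/big_ind2: _ => [|x1 x2 y1 y2 <- <-|//]; rewrite ?skew0r// skewDr.
Qed.

Lemma skew_combl n (e : 'I_n -> X) c z : w (comb e c) z = \sum_i c 0 i * w (e i) z.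
Proof. by rewrite skew_suml; apply: eq_bigr => i _; rewrite skewZl. Qed.

Lemma skew_combr n (e : 'I_n -> X) c z :
  w z (comb e c) = \sum_i Num.conj (c 0 i) * w z (e i).
Proof. by rewrite skew_sumr; apply: eq_bigr => i _; rewrite skewZr. Qed.

Lemma orth_lin A : subspace_of_space (orth w A).
Proof.
apply: lin_intro => [y _|a x y hx hy z Az]; first exact: skew0l.
by rewrite skewP hx// hy// mulr0 addr0.
Qed.

Lemma orth_sumset A B x : orth w A x -> orth w B x -> orth w (sumset A B) x.
Proof. by move=> ha hb _ [a Aa [b Bb <-]]; rewrite skewDr ha// hb// addr0. Qed.

Lemma orth_span n (e : 'I_n -> X) x : (forall i, w x (e i) = 0) -> orth w (span e) x.
Proof. by move=> h _ [c _ <-]; rewrite skew_combr big1// => i _; rewrite h mulr0. Qed.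

Lemma orth_closed A K : (forall x y, cabs (w x y) <= K * rnorm x * rnorm y) ->
  closed (orth w A).
Proof.
move=> wb; apply/closed_rnormP => x hx y Ay; apply/cabs0_eq0/le_anti.
rewrite cabs_ge0 andbT; apply/ler_addgt0Pr => e e0; rewrite add0r.
pose D := `|K| * rnorm y + 1.
have D0 : 0 < D by rewrite ltr_wpDl// mulr_ge0// rnorm_ge0.
have [|z hz xz] := hx (e / D); first by rewrite divr_gt0.
have -> : w x y = w (x - z) y by rewrite skewBl hz// subr0.
apply: (le_trans (wb _ _)); rewrite mulrAC.
apply: (@le_trans _ _ (D * rnorm (x - z))).
  rewrite ler_wpM2r ?rnorm_ge0//; apply: (@le_trans _ _ (`|K| * rnorm y)).
    by rewrite ler_wpM2r ?rnorm_ge0 ?ler_norm.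
  by rewrite lerDl.
by rewrite mulrC -ler_pdivlMr.
Qed.

Definition lagr A := subspace_of_space A /\ A = orth w A.

Lemma lagr_iso A x y : lagr A -> A x -> A y -> w x y = 0.
Proof. by move=> [_ e]; rewrite {1}e => h; exact: h. Qed.

Lemma lagr_max A x : lagr A -> (forall y, A y -> w x y = 0) -> A x.
Proof. by move=> [_ e] h; rewrite e => y; exact: h. Qed.

(** Since [A] is its own annihilator, no nonzero vector of X / A pairs to zero with all of [A];
    vectors independent modulo [A] can therefore be biorthogonalised by vectors of [A], one at a
    time. *)
Lemma dual_family A n (v : 'I_n -> X) : lagr A ->
  (forall c, A (comb v c) -> c = 0) ->
  exists u : 'I_n -> X,
    (forall i, A (u i)) /\ (forall i j, w (u i) (v j) = (i == j)%:R).
Proof.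
move=> lA; elim: n v => [|n IH] v h; first by exists (fun=> 0); split=> -[].
pose f i := v (lift ord0 i).
have combS c : comb v c = comb f (\row_i c 0 (lift ord0 i)) + c 0 ord0 *: v ord0.
  rewrite /comb big_ord_recl addrC; congr (_ + _).
  by apply: eq_bigr => i _; rewrite mxE.
have [c Ac|u [Au uf]] := IH f.
  pose c' : 'rV_n.+1 := \row_i (if unlift ord0 i is Some j then c 0 j else 0).
  have /h/rowP c'0 : A (comb v c').
    rewrite combS mxE unlift_none scale0r addr0 (_ : \row__ _ = c)//.
    by apply/rowP => i; rewrite !mxE liftK.
  by apply/rowP => i; have := c'0 (lift ord0 i); rewrite !mxE liftK.
(* This choice makes w (y', v 0) equal to w (y, v 0 - comb f d) for the projection [y'] below, so
   the pivot can be tested on [y]. If it vanished for all [y] in [A], then v 0 - comb f d would lie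
   in [A], against independence. *)
pose d : 'rV_n := \row_i Num.conj (w (u i) (v ord0)).
have [y Ay y0] : exists2 y, A y & w y (v ord0 - comb f d) != 0.
  apply: contrapT => hn.
  have : A (v ord0 - comb f d).
    apply: (lagr_max lA) => y Ay; apply: skew_eq0C; apply: contrapT => hy.
    by apply: hn; exists y => //; exact/eqP.
  pose c' : 'rV_n.+1 := \row_i (if unlift ord0 i is Some j then - d 0 j else 1).
  have -> : v ord0 - comb f d = comb v c'.
    rewrite combS mxE unlift_none scale1r (_ : \row__ _ = - d).
      by rewrite linearN addrC.
    by apply/rowP => i; rewrite !mxE liftK !mxE.
  by move=> /h/rowP/(_ ord0); rewrite !mxE unlift_none => /eqP; rewrite oner_eq0.
pose y' := y - comb u (\row_i w y (f i)).
have y'f j : w y' (f j) = 0.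
  rewrite skewBl skew_combl (bigD1 j)//= uf eqxx mulr1 mxE big1 ?addr0 ?subrr//.
  by move=> i ij; rewrite uf (negbTE ij) mulr0.
have y'0 : w y' (v ord0) != 0.
  suff -> : w y' (v ord0) = w y (v ord0 - comb f d) by [].
  rewrite skewBl skewBr skew_combl skew_combr; congr (_ - _).
  by apply: eq_bigr => i _; rewrite !mxE conjCK mulrC.
pose u0 := (w y' (v ord0))^-1 *: y'.
have Au0 : A u0.
  by apply: linZ; [case: lA|apply: linB => //; [case: lA|apply: lin_comb => //; case: lA]].
have u00 : w u0 (v ord0) = 1 by rewrite skewZl mulVf.
have u0f j : w u0 (f j) = 0 by rewrite skewZl y'f mulr0.
exists (fun i => if unlift ord0 i is Some j then u j - w (u j) (v ord0) *: u0 else u0).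
split=> i.
  case: unliftP => [j _|_] //; apply: linB => //; first by case: lA.
  by apply: linZ => //; case: lA.
move=> j; case: unliftP => [i' ->|->].
  case: (unliftP ord0 j) => [j' ->|->].
    by rewrite skewBl skewZl -/(f j') u0f mulr0 subr0 uf (inj_eq lift_inj).
  by rewrite skewBl skewZl u00 mulr1 subrr eq_sym (negbTE (neq_lift _ _)).
case: (unliftP ord0 j) => [j' ->|->]; last by rewrite eqxx.
by rewrite -/(f j') u0f (negbTE (neq_lift _ _)).
Qed.

Lemma sum_delta_l n (c : 'I_n -> R[i]) (j : 'I_n) : \sum_i c i * (i == j)%:R = c j.
Proof.
rewrite (bigD1 j)//= eqxx mulr1 big1 ?addr0// => i ij.
by rewrite (negbTE ij) mulr0.
Qed.

Lemma dual_project n (u v : 'I_n -> X) y j :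
  (forall i j, w (u i) (v j) = (i == j)%:R) ->
  w (y - comb u (\row_i w y (v i))) (v j) = 0.
Proof.
move=> uv; rewrite skewBl skew_combl; under eq_bigr do rewrite uv.
by rewrite sum_delta_l mxE subrr.
Qed.

Lemma dual_basis_mod A V n (u v : 'I_n -> X) : subspace_of_space A ->
  subspace_of_space V -> V = span v ->
  (forall i, A (u i)) -> (forall i j, w (u i) (v j) = (i == j)%:R) ->
  basis_mod A (orth w V `&` A) u.
Proof.
move=> lA lV Vv Au uv; split=> //.
  move=> c [/= h _]; apply/rowP => j; have := h (v j).
  rewrite Vv => /(_ (span_mem _ _)); rewrite skew_combl.
  by under eq_bigr do rewrite uv; rewrite sum_delta_l mxE.
move=> x Ax; exists (\row_i w x (v i)); split.
  by rewrite Vv; apply: orth_span => j; exact: dual_project.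
by apply: linB => //; exact: lin_comb.
Qed.

(** Double annihilators may be too large for a weak symplectic form, but not here, where [M] is a
    finite dimensional extension of a Lagrangian. With [u] in [A] dual to a basis [v] of M cap V,
    every y in [A] minus its [u]-part annihilates [M], hence pairs to zero with [x]; so subtracting
    a combination of the [v i] from [x] leaves a vector that annihilates [A]. *)
Lemma orth_orth_sub A V M : lagr A -> subspace_of_space V ->
  (exists n, has_dim V n) -> V `&` A = [set 0] -> subspace_of_space M ->
  A `<=` M -> M `<=` sumset V A -> orth w (orth w M) `<=` M.
Proof.
move=> lA lV [n dV] VA lM AM MVA x hx; have [lA' _] := lA.
have lMV := linI lM lV.
have [k] : exists k, has_dim (M `&` V) k.
  by apply: (@qdim_sub _ _ V _ [set 0] n) => //; exact: lin_set0.
move/(qdimP _ _ lMV) => [v vb]; have [vM v0 _] := vb.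
have [c Ac|u [Au uv]] := @dual_family A k v lA.
  by apply: v0; apply: (capset0_eq VA) => //; apply: lin_comb => // i; case: (vM i).
pose c : 'rV_k := \row_i Num.conj (w (u i) x).
suff Axc : A (x - comb v c).
  by rewrite -[x](subrK (comb v c)); apply: linD => //; [exact: AM|
    apply: lin_comb => // i; case: (vM i)].
apply: (lagr_max lA) => y Ay; apply: skew_eq0C.
have : w (y - comb u (\row_i w y (v i))) x = 0.
  apply: skew_eq0C; apply: hx => z Mz.
  have [v' Vv' Azv'] : exists2 v', V v' & A (z - v') by apply/sumsetP; exact: MVA.
  have Mv' : (M `&` V) v'.
    split=> //; rewrite -[v'](subrK z) -opprB addrC.
    by apply: linB => //; exact: AM.
  rewrite -[z](subrK v') skewDr.
  have -> : w (y - comb u (\row_i w y (v i))) v' = 0.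
    have [_ _ /(_ _ Mv')[d /= /subr0_eq ->]] := vb.
    rewrite skew_combr big1// => i _; rewrite dual_project ?mulr0//.
  by rewrite addr0; apply: (lagr_iso lA) => //; apply: linB => //; exact: lin_comb.
rewrite skewBl skewBr skew_combl skew_combr => e; rewrite -[RHS]e.
congr (_ - _); apply: eq_bigr => i _; rewrite !mxE conjCK mulrC //.
Qed.

End Algebra.
End SkewForms.

(** * The decomposition at one parameter *)

Section Decomposition.
Variables (R : realType) (X : completeNormedModType R[i]).
Implicit Types (x y z : X) (A B M N P : set X).

Lemma complement_dim P A N n : subspace_of_space P -> subspace_of_space A ->
  subspace_of_space N -> P = sumset A N -> A `&` N = [set 0] ->
  qdim P N n -> has_dim A n.
Proof.
move=> lP lA lN PE AN /(qdimP _ _ lP)[e [eP e0 es]].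
have /choice[f hf] : forall i, exists f, A f /\ N (e i - f).
  by move=> i; have := eP i; rewrite PE => /sumsetP[f Af Nf]; exists f.
have NE c : N (comb e c - comb f c).
  by rewrite -comb_funB; apply: lin_comb => // i; case: (hf i).
apply/(qdimP _ _ lA); exists f; apply/basis_modP; split.
- by move=> i; case: (hf i).
- by move=> c fc0; apply: e0; have := NE c; rewrite fc0 subr0.
- move=> x Ax; have Px : P x by rewrite PE; apply: sumset_l.
  have [c Nc] := es _ Px; exists c => //.
  apply/esym/eqP; rewrite -subr_eq0; apply/eqP; apply: (capset0_eq AN).
    by apply: linB => //; apply: lin_comb => // i; case: (hf i).
  by rewrite -[x](subrK (comb e c)) -addrA; exact: linD.
Qed.

Lemma dim_complement P A N n : subspace_of_space P -> subspace_of_space A ->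
  subspace_of_space N -> P = sumset A N -> A `&` N = [set 0] ->
  has_dim A n -> qdim P N n.
Proof.
move=> lP lA lN PE AN /(qdimP _ _ lA)[e /basis_modP[eA e0 es]].
apply/(qdimP _ _ lP); exists e; split.
- by move=> i; rewrite PE; exact: sumset_l.
- by move=> c Nc; apply: e0; apply: (capset0_eq AN) => //; exact: lin_comb.
- by move=> x; rewrite PE => /sumsetP[_ /es[c _ <-] Nx]; exists c.
Qed.

(** A family in [A] dual to a basis of [V] is a basis of [A] modulo the annihilator of [V]. *)
Lemma dual_qdim w A V n : skew w -> lagr w A -> subspace_of_space V ->
  has_dim V n -> V `&` A = [set 0] -> qdim A (orth w V `&` A) n.
Proof.
move=> ws lA lV /(qdimP _ _ lV)[v vb] VA; have [vV v0 vs] := vb.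
have [c|u [Au uv]] := dual_family ws (v := v) lA.
  by move=> Ac; apply: v0; apply: (capset0_eq VA) => //; exact: lin_comb.
apply/(qdimP _ _ lA.1); exists u.
by apply: (@dual_basis_mod _ _ _ ws A V n u v) => //; [exact: lA.1|exact: spanE].
Qed.

(* The last three fields say that [X = V (+) la1 (+) mu], a condition that is
   stable under small perturbations, unlike [X = V (+) (la + mu)]. *)
Record complemented (w : X -> X -> R[i]) (la mu V : set X) (n : nat) : Prop :=
  Complemented {
    tr_skew : skew w;
    tr_nondeg : forall x, (forall y, w x y = 0) -> x = 0;
    tr_la : lagr w la;
    tr_mu : lagr w mu;
    tr_lin : subspace_of_space V;
    tr_dim : has_dim V n;
    tr_cap : V `&` la = [set 0];
    tr_top : sumset (sumset V (orth w V `&` la)) mu = setT;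
    tr_dir : sumset V (orth w V `&` la) `&` mu = [set 0] }.

Section Point.
Variables (w : X -> X -> R[i]) (la mu V : set X) (n : nat).
Hypothesis tr : complemented w la mu V n.

Local Notation la0 := (la `&` sumset V mu).
Local Notation la1 := (orth w V `&` la).
Local Notation mu0 := (mu `&` sumset V la).
Local Notation mu1 := (orth w V `&` mu).
Local Notation X0 := (sumset V la `&` sumset V mu).
Local Notation X1 := (sumset la1 mu1).

Local Lemma pt_skew : skew w. Proof. by case: tr. Qed.
Local Lemma pt_nondeg x : (forall y, w x y = 0) -> x = 0.
Proof. exact: (tr_nondeg tr). Qed.
Local Lemma pt_lagr_la : lagr w la. Proof. by case: tr. Qed.
Local Lemma pt_lagr_mu : lagr w mu. Proof. by case: tr. Qed.
Local Lemma pt_V : subspace_of_space V. Proof. by case: tr. Qed.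
Local Lemma pt_dim : has_dim V n. Proof. by case: tr. Qed.
Local Lemma pt_cap : V `&` la = [set 0]. Proof. by case: tr. Qed.
Local Lemma pt_top : sumset (sumset V la1) mu = setT. Proof. by case: tr. Qed.
Local Lemma pt_dir : sumset V la1 `&` mu = [set 0]. Proof. by case: tr. Qed.
Local Hint Resolve pt_skew pt_lagr_la pt_lagr_mu pt_V pt_dim pt_cap : core.

Local Lemma pt_la : subspace_of_space la. Proof. exact: pt_lagr_la.1. Qed.
Local Lemma pt_mu : subspace_of_space mu. Proof. exact: pt_lagr_mu.1. Qed.
Local Lemma pt_Vla_lin : subspace_of_space (sumset V la).
Proof. exact: sumset_lin pt_V pt_la. Qed.
Local Lemma pt_Vmu_lin : subspace_of_space (sumset V mu).
Proof. exact: sumset_lin pt_V pt_mu. Qed.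
Local Lemma pt_la0 : subspace_of_space la0. Proof. exact: linI pt_la pt_Vmu_lin. Qed.
Local Lemma pt_mu0 : subspace_of_space mu0. Proof. exact: linI pt_mu pt_Vla_lin. Qed.
Local Lemma pt_la1 : subspace_of_space la1.
Proof. exact: linI (orth_lin pt_skew V) pt_la. Qed.
Local Lemma pt_mu1 : subspace_of_space mu1.
Proof. exact: linI (orth_lin pt_skew V) pt_mu. Qed.
Local Lemma pt_X0 : subspace_of_space X0. Proof. exact: linI pt_Vla_lin pt_Vmu_lin. Qed.
Local Lemma pt_X1 : subspace_of_space X1.
Proof. exact: sumset_lin pt_la1 pt_mu1. Qed.
Local Hint Resolve pt_la pt_mu pt_Vla_lin pt_Vmu_lin pt_la0 pt_mu0 pt_la1 pt_mu1 pt_X0 pt_X1 : core.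

Lemma orth_all x : orth w V x -> orth w la x -> orth w mu x -> x = 0.
Proof.
move=> hV hla hmu; apply: pt_nondeg => y.
have : sumset (sumset V la1) mu y by rewrite pt_top.
apply: orth_sumset => //; apply: orth_sumset => // z [_]; exact: hla.
Qed.

(** For x = v + l + m along V (+) la1 (+) mu, the vector v + m = x - l is the la0-component of x. *)
Lemma la_split : is_dsum la la0 la1.
Proof.
split.
  apply/seteqP; split; last by apply: sumset_sub => // x [].
  move=> x lax; have : sumset (sumset V la1) mu x by rewrite pt_top.
  move=> [_ [v Vv [l lal <-]] [m mum xE]].
  exists (v + m); last by exists l => //; rewrite -xE addrAC.
  split; last by exists v => //; exists m.
  have -> : v + m = x - l by rewrite -xE addrAC addrK.
  by apply: linB => //; case: lal.
apply: capset0 => // x [lax [v Vv [m mum xE]]] lal.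
have e : m = - v + x by rewrite -xE addrA addNr add0r.
have m0 : m = 0.
  apply: (capset0_eq pt_dir) => //; rewrite e; exists (- v); first exact: linN.
  by exists x.
apply: (capset0_eq pt_cap) => //; by rewrite -xE m0 addr0.
Qed.

Lemma Vmu_cap : V `&` mu = [set 0].
Proof.
apply: capset0 => // x Vx mux; apply: (capset0_eq pt_dir) => //.
exact: sumset_l.
Qed.

Lemma X0_split_la : is_dsum X0 V la0.
Proof.
split; last first.
  by apply: capset0 => // x Vx [lax _]; apply: (capset0_eq pt_cap).
apply/seteqP; split=> [x [[v Vv [l lal xE]] Vmux]|].
  exists v => //; exists l => //; split=> //.
  have -> : l = x - v by rewrite -xE addrC addKr.
  by apply: linB => //; exact: sumset_l.
apply: sumset_sub => // x; first by move=> Vx; split; exact: sumset_l.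
by move=> [lax Vmux]; split=> //; exact: sumset_r.
Qed.

Lemma X0_split_mu : is_dsum X0 V mu0.
Proof.
split; last first.
  by apply: capset0 => // x Vx [mux _]; apply: (capset0_eq Vmu_cap).
apply/seteqP; split=> [x [Vlax [v Vv [m mum xE]]]|].
  exists v => //; exists m => //; split=> //.
  have -> : m = x - v by rewrite -xE addrC addKr.
  by apply: linB => //; exact: sumset_l.
apply: sumset_sub => // x; first by move=> Vx; split; exact: sumset_l.
by move=> [mux Vlax]; split=> //; exact: sumset_r.
Qed.

(** By X0 = V + la0 only la0 against mu1 needs an argument: la0 lies in V + mu, and mu1 annihilates
    both summands. *)
Lemma X0_orth_X1 x y : X0 x -> X1 y -> w x y = 0.
Proof.
rewrite (X0_split_la.1) => -[v Vv [l [lal Vmul] <-]].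
move=> [p [pV lap] [q [qV muq] <-]].
rewrite (skewDl pt_skew) !(skewDr pt_skew).
rewrite (skew_eq0C pt_skew (pV _ Vv)) (skew_eq0C pt_skew (qV _ Vv)) (lagr_iso pt_lagr_la lal lap).
rewrite !add0r; case: Vmul => v' Vv' [m mum <-].
by rewrite (skewDl pt_skew) (skew_eq0C pt_skew (qV _ Vv')) (lagr_iso pt_lagr_mu mum muq) addr0.
Qed.

Lemma qdim_la1 : qdim la la1 n.
Proof. exact: dual_qdim. Qed.

Lemma qdim_mu1 : qdim mu mu1 n.
Proof. by apply: dual_qdim => //; exact: Vmu_cap. Qed.

Lemma la0_dim : has_dim la0 n.
Proof.
by have [e1 e2] := la_split; apply: (complement_dim pt_la pt_la0 pt_la1 e1 e2 qdim_la1).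
Qed.

Lemma X0_dim : has_dim X0 n.*2.
Proof.
have [e1 e2] := X0_split_la; rewrite -addnn.
have q : qdim X0 V n.
  have [e3 e4] := X0_split_la.
  by apply: (@dim_complement X0 la0 V); rewrite ?[sumset la0 _]sumsetC ?[la0 `&` _]setIC//; exact: la0_dim.
apply: (@qdimD _ _ X0 V [set 0] n n) => //.
- by move=> _ ->; exact: lin0.
- by rewrite e1; apply: sumset_l.
- exact: lin_set0.
- exact: pt_dim.
Qed.

Lemma mu0_dim : has_dim mu0 n.
Proof.
have [e1 e2] := X0_split_la; have [e3 e4] := X0_split_mu.
have q : qdim X0 V n.
  by apply: (@dim_complement X0 la0 V); rewrite ?[sumset la0 _]sumsetC ?[la0 `&` _]setIC//; exact: la0_dim.
by apply: (@complement_dim X0 mu0 V); rewrite ?[sumset mu0 _]sumsetC ?[mu0 `&` _]setIC.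
Qed.

(** A common vector annihilates [V] and [mu] by definition, and la = la0 + la1 because it lies in
    both X1 and X0. *)
Lemma mu0_mu1_cap : mu0 `&` mu1 = [set 0].
Proof.
apply: capset0 => // x [mux Vlax] mu1x; apply: orth_all.
- by case: mu1x.
- move=> y lay; have : la y by []. rewrite (la_split.1) => -[p la0p [q la1q <-]].
  rewrite (skewDr pt_skew) (skew_eq0C pt_skew (X0_orth_X1 _ (sumset_r pt_la1 mu1x))); last first.
    by rewrite (X0_split_la.1); apply: sumset_r.
  rewrite add0r; apply: X0_orth_X1; last exact: sumset_l.
  by split=> //; apply: sumset_r.
- by move=> y muy; exact: (lagr_iso pt_lagr_mu).
Qed.

(** The hypothesis is not symmetric in [la] and [mu], so the argument for [la] does not carry over.
    Instead dimensions are counted: mu0 and la0 are both complements of [V] in X0, hence mu0 has the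
    dimension n of mu / mu1. *)
Lemma mu_split : is_dsum mu mu0 mu1.
Proof.
split; last exact: mu0_mu1_cap.
have /(qdimP _ _ pt_mu0)[e /basis_modP[emu e0 es]] := mu0_dim.
have [||_ _ sp] := @basis_mod_of_dim _ _ mu mu1 n e pt_mu pt_mu1 qdim_mu1.
- by move=> i; case: (emu i).
- by move=> c mu1c; apply: e0; apply: (capset0_eq mu0_mu1_cap) => //; exact: lin_comb.
apply/seteqP; split=> [x /sp[c Nc]|]; last by apply: sumset_sub => // x [].
by apply/sumsetP; exists (comb e c) => //; exact: lin_comb.
Qed.

(** X0 and X1 are orthogonal and span the space, so a common vector pairs to zero with
    everything. *)
Lemma X_split : is_dsum setT X0 X1.
Proof.
have lS := sumset_lin pt_X0 pt_X1.
have full : sumset X0 X1 = setT.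
  apply/seteqP; split=> // x _.
  have : sumset (sumset V la1) mu x by rewrite pt_top.
  apply: sumset_sub => //.
    apply: sumset_sub => // y.
      by move=> Vy; apply: sumset_l => //; rewrite (X0_split_la.1); exact: sumset_l.
    by move=> la1y; apply: sumset_r => //; exact: sumset_l.
  move=> y muy; have {muy} : sumset mu0 mu1 y by rewrite -(mu_split.1).
  apply: sumsetS => z; last exact: sumset_r.
  by move=> mu0z; rewrite (X0_split_mu.1); exact: sumset_r.
split=> //; apply: capset0 => // x X0x X1x; apply: pt_nondeg => y.
have : sumset X0 X1 y by rewrite full.
move=> [p X0p [q X1q <-]]; rewrite (skewDr pt_skew) (X0_orth_X1 X0x X1q) addr0.
by apply: (skew_eq0C pt_skew); exact: X0_orth_X1.
Qed.

Lemma decomp x : exists p q, [/\ X0 p, X1 q & x = p + q].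
Proof.
have : sumset X0 X1 x by rewrite -(X_split.1).
by move=> [p X0p [q X1q <-]]; exists p, q.
Qed.

Lemma X0_nondeg : forall x, X0 x -> (forall y, X0 y -> w x y = 0) -> x = 0.
Proof.
move=> x X0x h; apply: pt_nondeg => y; have [p [q [X0p X1q ->]]] := decomp y.
by rewrite (skewDr pt_skew) h// X0_orth_X1// addr0.
Qed.

Lemma X1_nondeg : forall x, X1 x -> (forall y, X1 y -> w x y = 0) -> x = 0.
Proof.
move=> x X1x h; apply: pt_nondeg => y; have [p [q [X0p X1q ->]]] := decomp y.
by rewrite (skewDr pt_skew) (h q)// (skew_eq0C pt_skew (X0_orth_X1 X0p X1x)) addr0.
Qed.

Lemma X0_orthE : X0 = orth w X1.
Proof.
apply/seteqP; split=> [x X0x y X1y|x hx]; first exact: X0_orth_X1.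
have [p [q [X0p X1q xE]]] := decomp x.
rewrite xE (_ : q = 0) ?addr0//; apply: X1_nondeg => // y X1y.
by have := hx y X1y; rewrite xE (skewDl pt_skew) (X0_orth_X1 X0p X1y) add0r.
Qed.

Lemma X1_orthE : X1 = orth w X0.
Proof.
apply/seteqP; split=> [x X1x y X0y|x hx].
  by apply: (skew_eq0C pt_skew); exact: X0_orth_X1.
have [p [q [X0p X1q xE]]] := decomp x.
rewrite xE (_ : p = 0) ?add0r//; apply: X0_nondeg => // y X0y.
have := hx y X0y; rewrite xE (skewDl pt_skew).
by rewrite (skew_eq0C pt_skew (X0_orth_X1 X0y X1q)) addr0.
Qed.

Lemma X1_split : is_dsum X1 la1 mu1.
Proof.
split=> //; apply: capset0 => // x [xV xla] [_ xmu]; apply: orth_all => //.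
  by move=> y lay; exact: (lagr_iso pt_lagr_la).
by move=> y muy; exact: (lagr_iso pt_lagr_mu).
Qed.

Lemma la0_sub : la0 `<=` X0.
Proof. by rewrite (X0_split_la.1); exact: sumset_r. Qed.

Lemma mu0_sub : mu0 `<=` X0.
Proof. by rewrite (X0_split_mu.1); exact: sumset_r. Qed.

Lemma la1_sub : la1 `<=` X1.
Proof. exact: sumset_l. Qed.

Lemma mu1_sub : mu1 `<=` X1.
Proof. exact: sumset_r. Qed.

(** A vector of X0 already annihilates la1; if it also annihilates la0, it annihilates [la] and so
    belongs to it. *)
Lemma la0_lagr : la0 = X0 `&` orth w la0.
Proof.
apply/seteqP; split=> [x la0x|x [X0x h]].
  by split; [exact: la0_sub|move=> y [lay _]; apply: (lagr_iso pt_lagr_la); case: la0x].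
have [_ Vmux] := X0x; split=> //.
apply: (lagr_max pt_lagr_la) => y; rewrite (la_split.1) => -[p la0p [q la1q <-]].
by rewrite (skewDr pt_skew) h// (X0_orth_X1 X0x (la1_sub la1q)) addr0.
Qed.

Lemma mu0_lagr : mu0 = X0 `&` orth w mu0.
Proof.
apply/seteqP; split=> [x mu0x|x [X0x h]].
  by split; [exact: mu0_sub|move=> y [muy _]; apply: (lagr_iso pt_lagr_mu); case: mu0x].
have [Vlax _] := X0x; split=> //.
apply: (lagr_max pt_lagr_mu) => y; rewrite (mu_split.1) => -[p mu0p [q mu1q <-]].
by rewrite (skewDr pt_skew) h// (X0_orth_X1 X0x (mu1_sub mu1q)) addr0.
Qed.

Lemma la_cap_mu1 : la `&` mu1 = [set 0].
Proof.
apply: capset0 => // x lax [xV xmu]; apply: (capset0_eq (X1_split.2)); by split.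
Qed.

Lemma la1_cap_mu : la1 `&` mu = [set 0].
Proof.
apply: capset0 => // x la1x mux; apply: (capset0_eq (X1_split.2)) => //.
by case: la1x.
Qed.

Lemma la1_lagr : la1 = X1 `&` orth w la1.
Proof.
apply/seteqP; split=> [x la1x|x [X1x h]].
  by split; [exact: la1_sub|move=> y [_ lay]; apply: (lagr_iso pt_lagr_la); case: la1x].
have lax : la x.
  apply: (lagr_max pt_lagr_la) => y; rewrite (la_split.1) => -[p la0p [q la1q <-]].
  by rewrite (skewDr pt_skew) (skew_eq0C pt_skew (X0_orth_X1 (la0_sub la0p) X1x)) h// addr0.
case: X1x => p la1p [q mu1q xE]; rewrite -xE (_ : q = 0) ?addr0//.
apply: (capset0_eq la_cap_mu1) => //.
have -> : q = x - p by rewrite -xE addrC addKr.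
by apply: linB => //; case: la1p.
Qed.

Lemma mu1_lagr : mu1 = X1 `&` orth w mu1.
Proof.
apply/seteqP; split=> [x mu1x|x [X1x h]].
  by split; [exact: mu1_sub|move=> y [_ muy]; apply: (lagr_iso pt_lagr_mu); case: mu1x].
have mux : mu x.
  apply: (lagr_max pt_lagr_mu) => y; rewrite (mu_split.1) => -[p mu0p [q mu1q <-]].
  by rewrite (skewDr pt_skew) (skew_eq0C pt_skew (X0_orth_X1 (mu0_sub mu0p) X1x)) h// addr0.
case: X1x => p la1p [q mu1q xE]; rewrite -xE (_ : p = 0) ?add0r//.
apply: (capset0_eq la1_cap_mu) => //.
have -> : p = x - q by rewrite -xE addrK.
by apply: linB => //; case: mu1q.
Qed.

Lemma cap_in_mu0 : la `&` mu `<=` la0 `&` mu0.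
Proof.
by move=> x [lax mux]; split; split=> //; exact: sumset_r.
Qed.

End Point.
End Decomposition.

(** * Inertia of Hermitian forms *)

Section Inertia.
Variables (R : realType) (X : completeNormedModType R[i]).
Implicit Types (x y z : X) (A B M N P : set X) (q : X -> X -> R[i]).

Lemma definite_dimP B q n : subspace_of_space B -> q 0 0 = 0 ->
  definite_dim B q n <-> exists e : 'I_n -> X, (forall i, B (e i)) /\
    forall c, c != 0 -> 0 < q (comb e c) (comb e c).
Proof.
move=> lB q0; split=> [[Z [lZ ZB /(qdimP _ _ lZ)[e /basis_modP[eZ e0 _]] pos]]|[e [eB pos]]].
  exists e; split=> [i|c c0]; first exact: ZB.
  apply: pos; first exact: lin_comb.
  by apply: contraNneq c0 => /e0 ->.
exists (span e); split.
- exact: span_lin.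
- exact: span_sub.
- apply/(qdimP _ _ (span_lin e)); exists e; apply/basis_modP; split=> //.
    exact: span_mem.
  move=> c ec; apply/eqP; apply: contraPT (pos c) => c0 /(_ c0).
  by rewrite ec q0 ltxx.
- move=> _ [c _ <-] ec0; apply: pos; apply: contraNneq ec0 => ->.
  by rewrite linear0.
Qed.

(** A linear relation is used because vectors of the two spaces correspond only modulo null vectors,
    and no map between them is singled out. *)
Lemma definite_dim_transfer B B' q q' (Rel : X -> X -> Prop) n :
  subspace_of_space B -> subspace_of_space B' -> q 0 0 = 0 -> q' 0 0 = 0 ->
  (forall x, B x -> exists2 a, B' a & Rel x a) ->
  Rel 0 0 ->
  (forall c x y a b, Rel x a -> Rel y b -> Rel (c *: x + y) (c *: a + b)) ->
  (forall x a, Rel x a -> q x x = q' a a) ->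
  definite_dim B q n -> definite_dim B' q' n.
Proof.
move=> lB lB' q0 q'0 ex R0 RZ Rq /(definite_dimP _ lB q0)[e [eB pos]].
have /choice[f hf] : forall i, exists a, B' a /\ Rel (e i) a.
  by move=> i; have [a B'a ra] := ex _ (eB i); exists a.
apply/(definite_dimP _ lB' q'0); exists f; split=> [i|c c0]; first by case: (hf i).
rewrite -(Rq (comb e c)); first exact: pos.
apply: (big_rec2 (fun x a => Rel x a)) => // i x a _ r.
by apply: RZ => //; case: (hf i).
Qed.

Section Diagonal.
Variables (B N : set X) (q : X -> X -> R[i]) (d : nat).
Hypotheses (lB : subspace_of_space B) (lN : subspace_of_space N).
Hypothesis ql : forall a x y z, q (a *: x + y) z = a * q x z + q y z.
Hypothesis qh : forall x y, B x -> B y -> q x y = Num.conj (q y x).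
Hypothesis qN : forall x y, N x -> B y -> q x y = 0.

Lemma sesq0l z : q 0 z = 0.
Proof.
have := ql 1 0 0 z; rewrite scaler0 add0r mul1r => /eqP.
by rewrite -{1}[q 0 z]addr0 (inj_eq (addrI _)) => /eqP.
Qed.

Lemma form_combl n (e : 'I_n -> X) c z : q (comb e c) z = \sum_i c 0 i * q (e i) z.
Proof.
rewrite /comb; apply: (big_rec2 (fun x a => q x z = a)) => [|i x a _ <-].
  exact: sesq0l.
by rewrite ql.
Qed.

Lemma form_combr n (e : 'I_n -> X) c z : (forall i, B (e i)) -> B z ->
  q z (comb e c) = \sum_i Num.conj (c 0 i) * q z (e i).
Proof.
move=> eB Bz; rewrite qh//; last exact: lin_comb.
rewrite form_combl rmorph_sum; apply: eq_bigr => i _.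
by rewrite rmorphM /= -qh.
Qed.

(** Spectral theorem for the Gram matrix of a basis modulo [N]: the diagonalising matrix is unitary,
    so its similarity is also the congruence by which Gram matrices change. *)
Lemma sylvester_basis : qdim B N d -> exists (e : 'I_d -> X) (D : 'I_d -> R),
  basis_mod B N e /\ forall i j, q (e i) (e j) = (D i)%:C * (i == j)%:R.
Proof.
move=> /(qdimP _ _ lB)[f fb]; have [fB f0 fs] := fb.
pose G := \matrix_(i, j) q (f i) (f j).
have Gh : G \is hermsymmx.
  apply/is_hermitianmxP; rewrite expr0 scale1r; apply/matrixP => i j.
  by rewrite !mxE qh.
pose P := spectral.spectralmx G.
have Pu : P \is spectral.unitarymx := spectral.spectral_unitarymx G.
have PU : P \in unitmx := spectral.unitarymx_unit Pu.
have GE : P *m G *m (map_mx Num.conj P^T) = diag_mx (spectral.spectral_diag G).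
  have /spectral.orthomx_spectralP {1}-> := spectral.hermitian_normalmx Gh.
  rewrite -/P !mulmxA mulmxV// mul1mx -mulmxA.
  by move/spectral.unitarymxP: Pu => ->; rewrite mulmx1.
have Dr := spectral.hermitian_spectral_diag_real Gh.
exists (fun i => comb f (row i P)), (fun i => complex.Re (spectral.spectral_diag G 0 i)).
have EB i : B (comb f (row i P)) by exact: lin_comb.
split.
  apply: basis_mod_of_dim => //; first by apply/(qdimP _ _ lB); exists f.
  move=> c; rewrite comb_mul => /f0 => /(congr1 (mulmx^~ (invmx P))).
  by rewrite mulmxK// mul0mx.
move=> i j; rewrite form_combl.
have -> : (complex.Re (spectral.spectral_diag G 0 i))%:C = spectral.spectral_diag G 0 i.
  by rewrite RRe_real//; apply: (mxOverP Dr).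
have /matrixP/(_ i j) := GE; rewrite [X in _ = X -> _]mxE.
rewrite mulr_natr => <-; rewrite -mulmxA mxE; apply: eq_bigr => k _.
rewrite mxE form_combr//; congr (_ * _); rewrite mxE; apply: eq_bigr => l _.
by rewrite !mxE mulrC.
Qed.

Section WithBasis.
Variables (e : 'I_d -> X) (D : 'I_d -> R).
Hypothesis eb : basis_mod B N e.
Hypothesis eD : forall i j, q (e i) (e j) = (D i)%:C * (i == j)%:R.

Lemma form_diag x c : B x -> N (x - comb e c) ->
  q x x = \sum_i (cabs (c 0 i) ^+ 2 * D i)%:C.
Proof.
have [eB e0 es] := eb => Bx Nx.
have lin u v : q (u + v) x = q u x + q v x by rewrite -[u]scale1r ql mul1r scale1r.
have Be : B (comb e c) by exact: lin_comb.
have -> : q x x = q (comb e c) (comb e c).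
  rewrite -{1}[x](subrK (comb e c)) lin qN// add0r qh// -{1}[x](subrK (comb e c)).
  rewrite -[x - _]scale1r ql mul1r qN// add0r -qh//.
rewrite form_combl; apply: eq_bigr => i _.
rewrite form_combr// (bigD1 i)//= big1 ?addr0; last first.
  by move=> j ji; rewrite eD eq_sym (negbTE ji) !mulr0.
by rewrite eD eqxx mulr1 mulrA conjM_cabs -(rmorphM (real_complex R)).
Qed.

End WithBasis.

Lemma form_orthogonal n (f : 'I_n -> X) (D : 'I_n -> R) c : (forall i, B (f i)) ->
  (forall i j, q (f i) (f j) = (D i)%:C * (i == j)%:R) ->
  q (comb f c) (comb f c) = (\sum_i cabs (c 0 i) ^+ 2 * D i)%:C.
Proof.
move=> fB fD; rewrite form_combl rmorph_sum; apply: eq_bigr => i _.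
rewrite form_combr//.
rewrite (bigD1 i)//= big1 ?addr0; last first.
  by move=> j ji; rewrite fD eq_sym (negbTE ji) !mulr0.
by rewrite fD eqxx mulr1 mulrA conjM_cabs -(rmorphM (real_complex R)).
Qed.

Lemma positive_orthogonal n (f : 'I_n -> X) (D : 'I_n -> R) :
  (forall i, B (f i)) -> (forall i, 0 < D i) ->
  (forall i j, q (f i) (f j) = (D i)%:C * (i == j)%:R) -> definite_dim B q n.
Proof.
move=> fB D0 fD; apply/(definite_dimP _ lB (sesq0l 0)); exists f.
split=> // c /matrix0Pn[i [j]]; rewrite ord1 => cj.
rewrite (form_orthogonal _ fB fD) ltcR (bigD1 j)//=.
apply: ltr_pwDl; last by apply: sumr_ge0 => k _; rewrite mulr_ge0 ?sqr_ge0// ltW.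
rewrite mulr_gt0// exprn_gt0// lt_neqAle cabs_ge0 andbT eq_sym.
by apply: contra_neq cj => /cabs0_eq0 ->.
Qed.

Section WithBasis2.
Variables (e : 'I_d -> X) (D : 'I_d -> R).
Hypothesis eb : basis_mod B N e.
Hypothesis eD : forall i j, q (e i) (e j) = (D i)%:C * (i == j)%:R.

Lemma subfamily_orthogonal (P : pred 'I_d) (i j : 'I_#|P|) :
  q (e (enum_val i)) (e (enum_val j)) = (D (enum_val i))%:C * (i == j)%:R.
Proof. by rewrite eD (inj_eq enum_val_inj). Qed.

(** With more vectors than positive values, some nontrivial combination has no coordinate in a
    positive direction, and the form is nonpositive on it. *)
Lemma positive_dim_le n : definite_dim B q n -> (n <= #|[pred i | (0 < D i)%R]|)%N.
Proof.
move=> /(definite_dimP _ lB (sesq0l 0))[f [fB pos]]; rewrite leqNgt; apply/negP => lt.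
have [eB e0 es] := eb.
have /choice[h hh] : forall i, exists c, N (f i - comb e c) by move=> i; exact: es.
pose H := \matrix_i h i.
have [c c0 cH] := kernel_row (\matrix_(i, j) H i (enum_val (A := [pred i | (0 < D i)%R]) j)) lt.
have Nc : N (comb f c - comb e (c *m H)).
  rewrite -comb_mul; have -> : (fun i => comb e (row i H)) = (fun i => comb e (h i)).
    by apply/funext => i; rewrite rowK.
  by rewrite -comb_funB; exact: lin_comb.
have := pos _ c0; rewrite (form_diag eb eD (lin_comb _ lB fB) Nc).
rewrite -rmorph_sum ltcR; apply/negP; rewrite -leNgt; apply: sumr_le0 => i _.
have [Di|Di] := ltP 0 (D i); last by rewrite mulr_ge0_le0// sqr_ge0.
suff -> : (c *m H) 0 i = 0 by rewrite cabs0 expr0n mul0r.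
have iP : i \in [pred i | (0 < D i)%R] by [].
have /rowP/(_ (enum_rank_in iP i)) := cH; rewrite !mxE => cHi.
rewrite -[RHS]cHi; apply: eq_bigr => k _; congr (_ * _).
by rewrite [in RHS]mxE enum_rankK_in.
Qed.

Lemma morse_posE : morse_pos B q = #|[pred i | (0 < D i)%R]|.
Proof.
have [eB e0 es] := eb.
rewrite /morse_pos; case: xgetP => [n _ [dn nmax]|/(_ #|[pred i | (0 < D i)%R]|) []]; last first.
  split; last exact: positive_dim_le.
  apply: (@positive_orthogonal _ (fun i => e (enum_val i)) (fun i => D (enum_val i))) => //.
    by move=> i; have := enum_valP i; rewrite inE.
  exact: subfamily_orthogonal.
apply/anti_leq/andP; split; first exact: positive_dim_le.
apply: nmax.
apply: (@positive_orthogonal _ (fun i => e (enum_val i)) (fun i => D (enum_val i))) => //.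
  by move=> i; have := enum_valP i; rewrite inE.
exact: subfamily_orthogonal.
Qed.

Lemma radical_dim : qdim [set x | B x /\ forall y, B y -> q x y = 0] N
  #|[pred i | D i == 0]|.
Proof.
have [eB e0 es] := eb.
have lrad : subspace_of_space [set x | B x /\ forall y, B y -> q x y = 0].
  apply: lin_intro => [|a x y [Bx hx] [By hy]].
    by split=> [|y _]; [exact: lin0|exact: sesq0l].
  split=> [|z Bz]; first exact: linP.
  by rewrite ql hx// hy// mulr0 addr0.
pose P := [pred i | D i == 0]; pose s (j : 'I_#|P|) := enum_val (A := P) j.
apply/(qdimP _ _ lrad); exists (fun j => e (s j)); split.
- move=> j; split=> // y By; have [c Nc] := es _ By.
  rewrite -[y](subrK (comb e c)).
  have Be : B (comb e c) by exact: lin_comb.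
  rewrite qh//; last by rewrite subrK.
  rewrite -[y - _]scale1r ql qN// mulr0 add0r -qh// form_combr//.
  have := enum_valP j; rewrite inE => /eqP Dj.
  by rewrite big1// => i _; rewrite eD /s Dj mul0r mulr0.
- move=> c; pose S := \matrix_(j < #|P|) (delta_mx 0 (s j) : 'rV[R[i]]_d).
  have -> : (fun j => e (s j)) = (fun j => comb e (row j S)).
    by apply/funext => j; rewrite rowK comb_delta.
  rewrite comb_mul => /e0 /rowP h; apply/rowP => j; have := h (s j).
  rewrite !mxE (bigD1 j)//= !mxE !eqxx mulr1 big1 ?addr0// => i ij.
  by rewrite !mxE eqxx (inj_eq enum_val_inj) eq_sym (negbTE ij) mulr0.
- move=> x [Bx hx]; have [c Nc] := es _ Bx.
  have cD i : D i != 0 -> c 0 i = 0.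
    move=> Di; have := hx _ (eB i); rewrite -{1}[x](subrK (comb e c)).
    rewrite -[x - _]scale1r ql qN// mulr0 add0r form_combl (bigD1 i)//= big1 ?addr0; last first.
      by move=> j ji; rewrite eD (negbTE ji) !mulr0.
    rewrite eD eqxx mulr1 => /eqP; rewrite mulf_eq0 => /orP[/eqP //|/eqP h].
    by move: Di; rewrite (complexI h) eqxx.
  exists (\row_j c 0 (s j)); suff <- : comb e c = comb (fun j => e (s j)) (\row_j c 0 (s j)) by [].
  rewrite /comb (bigID (mem P))/= [X in _ + X]big1 ?addr0; last first.
    by move=> i /cD ->; rewrite scale0r.
  rewrite big_enum_val; apply: eq_bigr => j _; by rewrite mxE.
Qed.

End WithBasis2.
End Diagonal.

(** In a diagonalising basis modulo [N] the three numbers count the positive, negative and zero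
    entries. *)
Lemma inertia B N q (d z : nat) : subspace_of_space B -> subspace_of_space N ->
  (forall a x y z, q (a *: x + y) z = a * q x z + q y z) ->
  (forall x y, B x -> B y -> q x y = Num.conj (q y x)) ->
  (forall x y, N x -> B y -> q x y = 0) ->
  qdim B N d -> qdim [set x | B x /\ forall y, B y -> q x y = 0] N z ->
  (morse_pos B q + morse_neg B q + z)%N = d.
Proof.
move=> lB lN ql qh qN dB dz.
have [e [D [eb eD]]] := sylvester_basis lB lN ql qh dB.
pose q' x y := - q x y.
have eD' i j : q' (e i) (e j) = (- D i)%:C * (i == j)%:R.
  by rewrite /q' eD rmorphN mulNr.
have ql' a x y z0 : q' (a *: x + y) z0 = a * q' x z0 + q' y z0.
  by rewrite /q' ql opprD mulrN.
have qh' x y : B x -> B y -> q' x y = Num.conj (q' y x).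
  by move=> Bx By; rewrite /q' rmorphN qh.
have qN' x y : N x -> B y -> q' x y = 0 by move=> Nx By; rewrite /q' qN// oppr0.
rewrite (morse_posE lB lN ql qh qN eb eD) /morse_neg.
rewrite (morse_posE lB lN ql' qh' qN' eb eD').
have lrad : subspace_of_space [set x | B x /\ forall y, B y -> q x y = 0].
  apply: lin_intro => [|a x y [Bx hx] [By hy]].
    by split=> [|y _]; [exact: lin0|exact: (sesq0l ql)].
  split=> [|t Bt]; first exact: linP.
  by rewrite ql hx// hy// mulr0 addr0.
rewrite (qdim_uniq lrad lN dz (radical_dim lB ql qh qN eb eD)).
rewrite -[RHS]card_ord -(cardC [pred i | 0 < D i]) -addnA; congr (_ + _)%N.
rewrite -[RHS](cardID [pred i | 0 < - D i] [predC [pred i | 0 < D i]]); congr (_ + _)%N.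
  by apply: eq_card => i; rewrite !inE oppr_gt0; case: ltrgt0P.
by apply: eq_card => i; rewrite !inE oppr_gt0; case: ltrgt0P.
Qed.

Lemma morse_pos_family B N q (d : nat) : subspace_of_space B -> subspace_of_space N ->
  (forall a x y z, q (a *: x + y) z = a * q x z + q y z) ->
  (forall x y, B x -> B y -> q x y = Num.conj (q y x)) ->
  (forall x y, N x -> B y -> q x y = 0) -> qdim B N d ->
  exists (f : 'I_(morse_pos B q) -> X) (D : 'I_(morse_pos B q) -> R),
    [/\ forall i, B (f i), forall i, 0 < D i &
        forall i j, q (f i) (f j) = (D i)%:C * (i == j)%:R].
Proof.
move=> lB lN ql qh qN dB.
have [e [D [eb eD]]] := sylvester_basis lB lN ql qh dB.
rewrite (morse_posE lB lN ql qh qN eb eD).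
exists (fun i => e (enum_val i)), (fun i => D (enum_val i)); split.
- by move=> i; case: eb.
- by move=> i; have := enum_valP i; rewrite inE.
- by move=> i j; rewrite eD (inj_eq enum_val_inj).
Qed.

Lemma morse_pos_ge B N q (d k : nat) : subspace_of_space B -> subspace_of_space N ->
  (forall a x y z, q (a *: x + y) z = a * q x z + q y z) ->
  (forall x y, B x -> B y -> q x y = Num.conj (q y x)) ->
  (forall x y, N x -> B y -> q x y = 0) -> qdim B N d ->
  definite_dim B q k -> (k <= morse_pos B q)%N.
Proof.
move=> lB lN ql qh qN dB.
have [e [D [eb eD]]] := sylvester_basis lB lN ql qh dB.
rewrite (morse_posE lB lN ql qh qN eb eD); exact: (positive_dim_le lB lN ql qh qN eb eD).
Qed.

Lemma morse_pos_congr B B' q q' :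
  (forall n, definite_dim B q n <-> definite_dim B' q' n) ->
  morse_pos B q = morse_pos B' q'.
Proof.
move=> h; rewrite /morse_pos; congr (xget _ _); rewrite predeqE => n /=.
by split=> -[/h dn nmax]; split=> // m /h; exact: nmax.
Qed.

End Inertia.

(** * Charts *)

Section Charts.
Variables (R : realType) (X : completeNormedModType R[i]).
Implicit Types (x y z : X) (A B M N P : set X).

(** The projection onto [mu] along [L], made total by the value 0 where no decomposition exists. *)
Definition mpart (L mu : set X) x : X := xget 0 [set m | mu m /\ L (x - m)].

(* Every chart used to compute a Maslov index, reduced or not, amounts to such
   an [L]; its form is read on [la] rather than on [mu], so that the forms of
   all charts live on the same space and can be compared. *)
Definition gchart (w : X -> X -> R[i]) (la mu L : set X) (d : nat) :=
  [/\ lagr w L, L `&` mu = [set 0], sumset L mu = setT & qdim la (la `&` L) d].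

Definition cform (w : X -> X -> R[i]) (mu L : set X) a b := w (mpart L mu a) b.

Section Parts.
Variables (L mu : set X).
Hypotheses (lL : subspace_of_space L) (lmu : subspace_of_space mu).
Hypotheses (cap : L `&` mu = [set 0]) (tot : sumset L mu = setT).

Lemma mpartP x : mu (mpart L mu x) /\ L (x - mpart L mu x).
Proof.
have : sumset mu L x by rewrite sumsetC tot.
by move=> /sumsetP[m mum Lm]; rewrite /mpart; case: xgetP => [y _ //|/(_ m)[]].
Qed.

Lemma mpart_uniq x m : mu m -> L (x - m) -> mpart L mu x = m.
Proof.
move=> mum Lm; have [mum' Lm'] := mpartP x.
apply/eqP; rewrite -subr_eq0; apply/eqP; apply: (capset0_eq cap); last exact: linB.
have -> : mpart L mu x - m = (x - m) - (x - mpart L mu x).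
  by rewrite opprB [RHS]addrC [RHS]addrA subrK.
exact: linB.
Qed.

Lemma mpart_linear a x y : mpart L mu (a *: x + y) = a *: mpart L mu x + mpart L mu y.
Proof.
have [m1 l1] := mpartP x; have [m2 l2] := mpartP y.
apply: mpart_uniq; first exact: linP.
by rewrite opprD addrACA -scalerBr; exact: linP.
Qed.

Lemma mpart_mu x : mu x -> mpart L mu x = x.
Proof. by move=> mux; apply: mpart_uniq => //; rewrite subrr; exact: lin0. Qed.

Lemma mpart_L x : L x -> mpart L mu x = 0.
Proof. by move=> Lx; apply: mpart_uniq; [exact: lin0|rewrite subr0]. Qed.

End Parts.

Section ChartForm.
Variables (w : X -> X -> R[i]) (ws : skew w) (la mu L : set X) (d : nat).
Hypotheses (lla : lagr w la) (lmu : lagr w mu) (ch : gchart w la mu L d).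

Local Notation q := (cform w mu L).
Local Notation N := (la `&` L).

Lemma chart_lagr : lagr w L. Proof. by case: ch. Qed.
Lemma chart_cap : L `&` mu = [set 0]. Proof. by case: ch. Qed.
Lemma chart_tot : sumset L mu = setT. Proof. by case: ch. Qed.
Local Hint Resolve chart_cap chart_tot : core.

Local Lemma ch_la : subspace_of_space la. Proof. exact: lla.1. Qed.
Local Lemma ch_mu : subspace_of_space mu. Proof. exact: lmu.1. Qed.
Local Lemma ch_L : subspace_of_space L. Proof. exact: chart_lagr.1. Qed.
Local Lemma ch_N : subspace_of_space N. Proof. exact: linI ch_la ch_L. Qed.
Local Hint Resolve ch_la ch_mu ch_L ch_N : core.

Lemma cform_linear a x y z : q (a *: x + y) z = a * q x z + q y z.
Proof. by rewrite /cform mpart_linear// (skewP ws). Qed.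

(** With x = l + m and y = l' + m', the isotropy of [la], [L] and [mu] reduces w (x, y) = 0 to w (m,
    l') + w (l, m') = 0. *)
Lemma cform_hermitian x y : la x -> la y -> q x y = Num.conj (q y x).
Proof.
move=> lax lay; rewrite /cform.
have [mx lx] := mpartP chart_tot x; have [my ly] := mpartP chart_tot y.
move: (mpart L mu x) (mpart L mu y) mx lx my ly => m m' mm lm mm' lm'.
have := lagr_iso lla lax lay.
move: (x - m) (y - m') (subrK m x) (subrK m' y) lm lm' => l l' <- <- lm lm'.
rewrite !(skewDl ws) !(skewDr ws) (lagr_iso chart_lagr lm lm').
rewrite (lagr_iso lmu mm mm') (lagr_iso lmu mm' mm) add0r !addr0 => /eqP.
by rewrite addrC addr_eq0 => /eqP ->; rewrite [w l m'](skewC ws) opprK.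
Qed.

Lemma cform_null x y : N x -> la y -> q x y = 0.
Proof. by move=> [_ Lx] _; rewrite /cform mpart_L// (skew0l ws). Qed.

(** If [x] is in the radical, its [mu]-part annihilates [la] and hence lies in la cap mu, and the
    remaining part lies in la cap L. *)
Lemma cform_radical (z : nat) : has_dim (la `&` mu) z ->
  qdim [set x | la x /\ forall y, la y -> q x y = 0] N z.
Proof.
move=> dz.
have lrad : subspace_of_space [set x | la x /\ forall y, la y -> q x y = 0].
  apply: lin_intro => [|a x y [lax hx] [lay hy]].
    split=> [|y _]; first exact: lin0.
    by rewrite /cform mpart_L ?(skew0l ws)//; exact: lin0.
  split=> [|t lat]; first exact: linP.
  by rewrite cform_linear hx// hy// mulr0 addr0.
have lI := linI ch_la ch_mu.
apply: (dim_complement lrad lI ch_N) => //.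
  apply/seteqP; split=> [x [lax hx]|].
    have lam : la (mpart L mu x) by apply: (lagr_max lla) => y lay; exact: hx.
    have [mum Lx] := mpartP chart_tot x.
    by apply/sumsetP; exists (mpart L mu x) => //; split=> //; exact: linB.
  apply: sumset_sub => // x [lax h]; split=> // y lay.
    by rewrite /cform mpart_mu//; exact: (lagr_iso lla).
  by apply: cform_null.
by apply: capset0 => // x [_ mux] [_ Lx]; exact: (capset0_eq chart_cap).
Qed.

Lemma chart_count (z : nat) : has_dim (la `&` mu) z ->
  (morse_pos la q + morse_neg la q + z)%N = d.
Proof.
move=> /cform_radical; apply: inertia => //.
- exact: cform_linear.
- exact: cform_hermitian.
- exact: cform_null.
- by case: ch.
Qed.

Section Transfer.
Variables (be : set X) (T : X -> X).
Hypothesis lbe : subspace_of_space be.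
Hypothesis beE : forall y, be y -> exists m n, [/\ mu m, N n & y = m + n].
Hypothesis TL : forall y, be y -> L (T y) /\ la (y + T y).
Hypothesis labe : forall a, la a -> be (mpart L mu a).

(** Two vectors are related when they have the same [mu]-component, that of [y] being taken modulo
    la cap L. This covers reduced spaces, whose vectors carry such an ambiguity, and X0, where [n]
    can be 0. *)
Let Rel y a := exists m n, [/\ y = m + n, be y, mu m, N n & la a /\ L (a - m)].

Lemma Rel0 : Rel 0 0.
Proof.
exists 0, 0; rewrite addr0 subr0; split=> //; try exact: lin0.
by split; exact: lin0.
Qed.

Lemma RelP c x y a b : Rel x a -> Rel y b -> Rel (c *: x + y) (c *: a + b).
Proof.
move=> [m [n [-> bx mm Nn [laa La]]]] [m' [n' [-> by' mm' Nn' [lab Lb]]]].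
exists (c *: m + m'), (c *: n + n'); split.
- by rewrite scalerDr addrACA.
- exact: linP.
- exact: linP.
- exact: linP.
- split; first exact: linP.
  by rewrite opprD addrACA -scalerBr; exact: linP.
Qed.

(** The vectors a - m and T x of [L] differ by an element of la cap L. It annihilates [la] and [L],
    hence also m = (x + T x) - (n + T x). *)
Lemma Rel_form x a : Rel x a -> w x (T x) = q a a.
Proof.
move=> [m [n [xE bx mm [lan Ln] [laa La]]]].
have [LT lT] := TL bx.
rewrite /cform (mpart_uniq ch_L ch_mu chart_cap chart_tot mm La).
rewrite xE (skewDl ws) -xE (lagr_iso chart_lagr Ln LT) addr0.
have laz : la (a - m - T x).
  have -> : a - m - T x = a - (x + T x) + n.
    move: (T x) => t; rewrite xE !opprD -!addrA; congr (_ + (_ + _)); by rewrite addrCA addNr addr0.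
  by apply: linD => //; exact: linB.
have Lz : L (a - m - T x) by exact: linB.
have mla : la (m + (n + T x)) by rewrite addrA -xE.
apply/esym/eqP; rewrite -subr_eq0 -(skewBr ws).
have -> : w m (a - T x) = w m (a - m - T x).
  by rewrite addrAC (skewBr ws _ m m) (lagr_iso lmu mm mm) subr0.
rewrite -{1}[m](addrK (n + T x)) (skewBl ws) (lagr_iso lla mla laz) sub0r.
by rewrite oppr_eq0 (lagr_iso chart_lagr)//; apply: linD.
Qed.

Lemma Rel_left x : be x -> exists2 a, la a & Rel x a.
Proof.
move=> bx; have [LT lT] := TL bx; have [m [n [mm Nn xE]]] := beE bx.
exists (x + T x) => //; exists m, n; split=> //; split=> //.
by rewrite {1}xE addrAC [m + n]addrC addrK; apply: linD => //; case: Nn.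
Qed.

Lemma Rel_right a : la a -> exists2 x, be x & Rel x a.
Proof.
move=> laa; have [mm Lm] := mpartP chart_tot a.
exists (mpart L mu a); first exact: labe.
exists (mpart L mu a), 0; rewrite addr0; split=> //; first exact: labe.
exact: lin0.
Qed.

Lemma chart_morse_pos : morse_pos be (fun x y => w x (T y)) = morse_pos la q.
Proof.
have q00 : q 0 0 = 0 by rewrite /cform (skew0r ws).
apply: morse_pos_congr => n; split.
  apply: (@definite_dim_transfer _ _ _ _ _ _ Rel) => //; rewrite ?(skew0l ws)//.
  - exact: Rel_left.
  - exact: Rel0.
  - exact: RelP.
  - exact: Rel_form.
apply: (@definite_dim_transfer _ _ _ _ _ _ (fun a x => Rel x a)) => //; rewrite ?(skew0l ws)//.
- exact: Rel_right.
- exact: Rel0.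
- by move=> c x y a b; exact: RelP.
- by move=> x a /Rel_form ->.
Qed.

Lemma chart_morse_neg : morse_neg be (fun x y => w x (T y)) = morse_neg la q.
Proof.
have q00 : - q 0 0 = 0 by rewrite /cform (skew0r ws) oppr0.
have w00 : - w 0 (T 0) = 0 by rewrite (skew0l ws) oppr0.
apply: morse_pos_congr => n; split.
  apply: (@definite_dim_transfer _ _ _ _ _ _ Rel) => //.
  - exact: Rel_left.
  - exact: Rel0.
  - exact: RelP.
  - by move=> x a /Rel_form ->.
apply: (@definite_dim_transfer _ _ _ _ _ _ (fun a x => Rel x a)) => //.
- exact: Rel_right.
- exact: Rel0.
- by move=> c x y a b; exact: RelP.
- by move=> x a /Rel_form ->.
Qed.

End Transfer.
End ChartForm.

(** * Charts from Lagrangian subspaces of X0 *)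

Section Inner.
Variables (w : X -> X -> R[i]) (la mu V : set X) (n : nat).
Hypothesis tr : complemented w la mu V n.

Local Notation la0 := (la `&` sumset V mu).
Local Notation la1 := (orth w V `&` la).
Local Notation mu0 := (mu `&` sumset V la).
Local Notation mu1 := (orth w V `&` mu).
Local Notation X0 := (sumset V la `&` sumset V mu).
Local Notation X1 := (sumset la1 mu1).

Variable L0 : set X.
Hypotheses (lL0 : subspace_of_space L0) (L0E : L0 = X0 `&` orth w L0).
Hypotheses (L0la : L0 `&` la0 = [set 0]) (L0mu : L0 `&` mu0 = [set 0]).

Let ws := tr_skew tr.
Let lla := tr_la tr.
Let lmu := tr_mu tr.
Let lV := tr_lin tr.
Let iA := lla.1.
Let iM := lmu.1.
Let l1 := linI (orth_lin ws V) iA.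
Let m1 := linI (orth_lin ws V) iM.
Local Hint Resolve ws lla lmu lV iA iM l1 m1 : core.

Lemma inner_sub : L0 `<=` X0.
Proof. by rewrite L0E => x []. Qed.

(** L0 and la1 are Lagrangian in the summands of the orthogonal decomposition X = X0 (+) X1. *)
Lemma inner_lagr : lagr w (sumset L0 la1).
Proof.
split; first exact: sumset_lin.
apply/seteqP; split=> [_ [p Lp [q la1q <-]]|x hx].
  apply: orth_sumset => // y hy.
    have [_ hp] : (X0 `&` orth w L0) p by rewrite -L0E.
    rewrite (skewDl ws) hp// add0r; apply: (skew_eq0C ws).
    apply: (X0_orth_X1 tr) => //; first exact: inner_sub.
    by apply: sumset_l => //; exact: m1.
  rewrite (skewDl ws) (X0_orth_X1 tr (inner_sub Lp)).
    by rewrite add0r; apply: (lagr_iso lla); [case: la1q|case: hy].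
  by apply: sumset_l => //; exact: m1.
have [p [q [X0p X1q xE]]] := decomp tr x.
have L0p : L0 p.
  rewrite L0E; split=> // y L0y.
  have : w x y = 0 by apply: hx; exact: sumset_l.
  rewrite xE (skewDl ws) (skew_eq0C ws (X0_orth_X1 tr (inner_sub L0y) X1q)).
  by rewrite addr0.
have la1q : la1 q.
  rewrite (la1_lagr tr); split=> // y la1y.
  have : w x y = 0 by apply: hx; apply: sumset_r.
  rewrite xE (skewDl ws) (X0_orth_X1 tr X0p) ?add0r//.
  by apply: sumset_l => //; exact: m1.
by rewrite xE; exists p => //; exists q.
Qed.

Lemma inner_cap : la `&` sumset L0 la1 = la1.
Proof.
apply/seteqP; split=> [x [lax [p Lp [q la1q xE]]]|x la1x]; last first.
  by split; [case: la1x|exact: sumset_r].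
have p0 : p = 0.
  apply: (capset0_eq L0la) => //; split; last by case: (inner_sub Lp).
  have -> : p = x - q by rewrite -xE addrK.
  by apply: linB => //; case: la1q.
by rewrite -xE p0 add0r.
Qed.

(** By the double annihilator it suffices that a vector y annihilating L0 + mu annihilates [V]. Such
    a y lies in [mu]; its mu0-component annihilates L0, so lies in L0 cap mu0 = 0, and y is in
    mu1. *)
Lemma inner_mu_tot : V `<=` sumset L0 mu.
Proof.
have Vmu := Vmu_cap tr.
move=> v Vv; apply: (@orth_orth_sub _ _ w ws mu V (sumset L0 mu)) => //.
- by exists n; exact: (tr_dim tr).
- exact: sumset_lin.
- exact: sumset_r.
- apply: sumset_sub; first exact: sumset_lin.
    by move=> x /inner_sub[].
  exact: sumset_r.
move=> y hy.
have muy : mu y by apply: (lagr_max lmu) => z muz; apply: hy; exact: sumset_r.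
have : sumset mu0 mu1 y by rewrite -(mu_split tr).1.
move=> [p mu0p [q mu1q yE]].
have p0 : p = 0.
  apply: (capset0_eq L0mu) => //; rewrite L0E; split.
    by split; [case: mu0p|apply: sumset_r => //; case: mu0p].
  move=> z L0z; have : w y z = 0 by apply: hy; exact: sumset_l.
  have X1q : X1 q by apply: sumset_r.
  by rewrite -yE (skewDl ws) (skew_eq0C ws (X0_orth_X1 tr (inner_sub L0z) X1q)) addr0.
by rewrite -yE p0 add0r; apply: (skew_eq0C ws); case: mu1q => + _; apply.
Qed.

Lemma inner_chart : gchart w la mu (sumset L0 la1) n.
Proof.
have lS := sumset_lin lL0 l1.
split; first exact: inner_lagr.
- apply: capset0 => // x [p Lp [q la1q xE]] mux.
  have : sumset mu0 mu1 x by rewrite -(mu_split tr).1.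
  move=> [p' mu0p' [q' mu1q' xE']].
  have [d1 d2] := X_split tr.
  have [||||||e1 e2] := dsum_uniq _ _ d2 _ _ _ _ (etrans xE (esym xE')).
  + by apply: linI; exact: sumset_lin.
  + by apply: sumset_lin => //; exact: m1.
  + exact: inner_sub.
  + by apply: sumset_l => //; exact: m1.
  + by split; [case: mu0p'|apply: sumset_r => //; case: mu0p'].
  + exact: sumset_r.
  have p0 : p = 0 by apply: (capset0_eq L0mu) => //; rewrite e1.
  rewrite -xE p0 add0r; apply: (capset0_eq (la1_cap_mu tr)) => //.
  by rewrite e2; case: mu1q'.
- apply/seteqP; split=> // x _.
  have lT := sumset_lin lS iM.
  have : sumset (sumset V la1) mu x by rewrite (tr_top tr).
  apply: sumset_sub => //; last exact: sumset_r.
  apply: sumset_sub => //.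
    move=> y /inner_mu_tot; apply: sumsetS => // z.
    exact: sumset_l.
  move=> y la1y; apply: sumset_l => //; exact: sumset_r.
- by rewrite inner_cap; apply: (qdim_la1 tr).
Qed.

Lemma inner_mpart (T : X -> X) a : (forall y, mu0 y -> L0 (T y)) ->
  la0 = [set y + T y | y in mu0] -> la a -> mu0 (mpart (sumset L0 la1) mu a).
Proof.
move=> TL gr laa; have [[lL _] c t _] := inner_chart.
have : sumset la0 la1 a by rewrite -(la_split tr).1.
move=> [p + [q la1q aE]]; rewrite gr => -[y mu0y pE].
rewrite (@mpart_uniq _ _ lL iM c t a y)//; first by case: mu0y.
by rewrite -aE -pE addrAC [y + _]addrC addrK; exists (T y); [exact: TL|exists q].
Qed.

End Inner.

(** * Charts from reduced symplectic spaces *)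

Section Reduced.
Variables (w : X -> X -> R[i]) (ws : skew w) (la mu V : set X) (n : nat).
Hypothesis nondeg : forall x, (forall y, w x y = 0) -> x = 0.
Hypotheses (lla : lagr w la) (lmu : lagr w mu).
Hypotheses (lV : subspace_of_space V) (dV : has_dim V n).
Hypothesis Vla : V `&` la = [set 0].
Hypothesis top : sumset (sumset V (orth w V `&` la)) mu = setT.

Local Notation W := (sumset V la).
Local Notation N := (orth w W).
Local Notation al := (reduction W N la).
Local Notation be := (reduction W N mu).

Let lA : subspace_of_space la := lla.1.
Let lM : subspace_of_space mu := lmu.1.

Lemma reducedN : N = orth w V `&` la.
Proof.
apply/seteqP; split=> [x h|x [hV lax]].
  split; first by move=> v Vv; apply: h; exact: sumset_l.
  by apply: (lagr_max lla) => y lay; apply: h; exact: sumset_r.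
by apply: orth_sumset => // y lay; exact: (lagr_iso lla).
Qed.

Lemma reduced_al : al = la.
Proof.
apply/seteqP; split.
  by apply: sumset_sub => [//|x []|x]//; rewrite reducedN => -[].
move=> x lax; apply: sumset_l; first exact: orth_lin.
by split=> //; exact: sumset_r.
Qed.

Lemma reduced_be_lin : subspace_of_space be.
Proof.
by apply: sumset_lin; [apply: linI => //; exact: sumset_lin|exact: orth_lin].
Qed.

Variables (L : set X) (T : X -> X).
Hypotheses (lL : subspace_of_space L) (LE : L = W `&` orth w L).
Hypotheses (Lal : L `&` al = N) (Lbe : L `&` be = N).
Hypothesis qT : quotient_operator be L N T.
Hypothesis alE : al = graph_over be N T.

Lemma reduced_NL : N `<=` L.
Proof. by rewrite -Lal => x []. Qed.

Lemma reduced_cap : la `&` L = N.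
Proof. by rewrite -Lal reduced_al setIC. Qed.

Lemma reduced_bidual A : subspace_of_space A -> la `<=` A -> A `<=` W ->
  orth w (orth w A) `<=` A.
Proof. by move=> *; apply: (@orth_orth_sub _ _ w ws la V A) => //; exists n. Qed.

(** As [L] contains N = W^omega, whatever annihilates [L] lies in the double annihilator of [W],
    which is contained in [W]; inside [W] the subspace [L] is Lagrangian by hypothesis. *)
Lemma reduced_lagr : lagr w L.
Proof.
split=> //; apply/seteqP; split=> [x|x hx].
  by move=> Lx; move: (Lx); rewrite {1}LE => -[].
rewrite LE; split=> //; apply: reduced_bidual => //.
- exact: sumset_lin.
- exact: sumset_r.
- by move=> y Ny; apply: hx; exact: reduced_NL.
Qed.

(** The annihilator of L + la is L cap la = N, which annihilates [W]; the double annihilator does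
    the rest. *)
Lemma reduced_W : W `<=` sumset L la.
Proof.
move=> x Wx; apply: reduced_bidual => //.
- exact: sumset_lin.
- exact: sumset_r.
- apply: sumset_sub; first exact: sumset_lin.
    by rewrite LE => y [].
  exact: sumset_r.
move=> y hy; apply: (skew_eq0C ws).
suff : N y by apply.
rewrite -reduced_cap; split.
  by apply: (lagr_max lla) => z laz; apply: hy; exact: sumset_r.
by apply: (lagr_max reduced_lagr) => z Lz; apply: hy; exact: sumset_l.
Qed.

Lemma reduced_graph a : la a -> exists m n' y,
  [/\ mu m, N n', be y & y = m + n'] /\ L (a - m).
Proof.
rewrite -{1}reduced_al alE => -[_ [y bey <-] [n1 Nn1 <-]].
have [m [mum Wm] [n2 Nn2 yE]] := bey.
exists m, n2, y; split; first by split.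
have -> : y + T y + n1 - m = n2 + (T y + n1).
  by move: (T y) => t; rewrite -yE -(addrA _ t) -(addrA m) addrAC subrr add0r.
apply: linD => //; first exact: reduced_NL.
by apply: linD => //; [case: qT => + _ _; apply|exact: reduced_NL].
Qed.

(** A vector of L cap mu lies in [N], so it annihilates V + la1 + mu, the whole space. The graph
    condition puts [la] in L + mu, and with [W] in L + la this gives everything. *)
Lemma reduced_chart : gchart w la mu L n.
Proof.
have laL : la `<=` sumset L mu.
  move=> a /reduced_graph[m [n' [y [[mum _ _ _] Lam]]]].
  by exists (a - m) => //; exists m => //; rewrite subrK.
split; first exact: reduced_lagr.
- apply: capset0 => // x Lx mux.
  have Nx : N x.
    rewrite -Lbe; split=> //; apply: sumset_l; first exact: orth_lin.
    by split=> //; move: Lx; rewrite LE => -[].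
  apply: nondeg => z; have : sumset (sumset V (orth w V `&` la)) mu z by rewrite top.
  apply: orth_sumset => //; last by move=> t mut; exact: (lagr_iso lmu).
  move: Nx; rewrite reducedN => -[hV lax]; apply: orth_sumset => // t [_ lat].
  exact: (lagr_iso lla).
- apply/seteqP; split=> // x _; have lS := sumset_lin lL lM.
  have : sumset (sumset V (orth w V `&` la)) mu x by rewrite top.
  apply: sumset_sub => //; last exact: sumset_r.
  have WS : W `<=` sumset L mu.
    by move=> y /reduced_W; apply: sumset_sub => //; exact: sumset_l.
  apply: sumset_sub => // y; first by move=> Vy; apply: WS; exact: sumset_l.
  by move=> [_ lay]; exact: laL.
- by rewrite reduced_cap reducedN; apply: (dual_qdim ws lla lV dV Vla).
Qed.

Lemma reduced_beE y : be y -> exists m n', [/\ mu m, (la `&` L) n' & y = m + n'].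
Proof. by move=> [m [mum _] [n' Nn' <-]]; exists m, n'; rewrite reduced_cap. Qed.

Lemma reduced_T y : be y -> L (T y) /\ la (y + T y).
Proof.
move=> bey; split; first by case: qT => + _ _; apply.
rewrite -reduced_al alE; apply: sumset_l; first exact: orth_lin.
by exists y.
Qed.

Lemma reduced_mpart a : la a -> be (mpart L mu a).
Proof.
move=> /reduced_graph[m [n' [y [[mum Nn' bey yE] Lam]]]].
have [_ c t _] := reduced_chart.
rewrite (@mpart_uniq _ _ lL lM c t a m)//.
have -> : m = y - n' by rewrite yE addrK.
apply: linB => //; first exact: reduced_be_lin.
by apply: sumset_r => //; apply: linI => //; exact: sumset_lin.
Qed.

End Reduced.
End Charts.

(** * The local change of the Morse index *)

Section LocalEstimate.
Variables (R : realType) (X : completeNormedModType R[i]).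
Implicit Types (x y : X) (e : R).

Lemma sum_sqr_le n (a : 'I_n -> R) : (\sum_i a i) ^+ 2 <= n%:R * \sum_i a i ^+ 2.
Proof.
have h : \sum_i \sum_j (a i * a j) <= \sum_(i < n) \sum_(j < n) ((a i ^+ 2 + a j ^+ 2) / 2).
  apply: ler_sum => i _; apply: ler_sum => j _.
  by have := sqr_ge0 (a i - a j); rewrite sqrrB; lra.
have -> : (\sum_i a i) ^+ 2 = \sum_i \sum_j (a i * a j).
  by rewrite expr2 mulr_suml; apply: eq_bigr => i _; rewrite mulr_sumr.
apply: (le_trans h).
have e1 : \sum_(i < n) \sum_(j < n) a i ^+ 2 = n%:R * \sum_i a i ^+ 2.
  by under eq_bigr do rewrite sumr_const card_ord -mulr_natl; rewrite -mulr_sumr.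
have e2 : \sum_(i < n) \sum_(j < n) a j ^+ 2 = n%:R * \sum_i a i ^+ 2.
  by rewrite sumr_const card_ord mulr_natl.
under eq_bigr do rewrite -mulr_suml big_split /=.
by rewrite -mulr_suml big_split /= e1 e2; move: (n%:R * _) => u; lra.
Qed.

Lemma min_positive n (D : 'I_n -> R) : (forall i, 0 < D i) ->
  exists2 k : R, 0 < k & forall i, k <= D i.
Proof.
elim: n D => [|n IH] D D0; first by exists 1 => // -[].
have [k k0 hk] := IH (fun i => D (lift ord0 i)) (fun i => D0 _).
exists (Num.min k (D ord0)); first by rewrite lt_min k0 D0.
move=> i; case: (unliftP ord0 i) => [j ->|->]; rewrite ge_min ?hk//.
by rewrite lexx orbT.
Qed.

Lemma Re_ge_cabs (a : R[i]) : - cabs a <= complex.Re a.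
Proof. by have := Re_cabs (- a); rewrite cabsN raddfN /= lerNl. Qed.

Lemma hermitian_real (a : R[i]) : a = Num.conj a -> a = (complex.Re a)%:C.
Proof. by move=> h; rewrite RRe_real//; apply/CrealP; rewrite -h. Qed.

Lemma linear_comb_fun n (f : X -> X) (e : 'I_n -> X) c :
  (forall a x y, f (a *: x + y) = a *: f x + f y) ->
  f (comb e c) = comb (f \o e) c.
Proof.
move=> fl; have f0 : f 0 = 0.
  have := fl 1 0 0; rewrite scaler0 add0r scale1r => /eqP.
  by rewrite -{1}[f 0]addr0 (inj_eq (addrI _)) => /eqP.
rewrite /comb; apply: (big_rec2 (fun x y => f x = y)) => // i x y _ <-.
exact: fl.
Qed.

(** All data belong to one parameter s near s0. The [z i] approximate vectors at s0 that diagonalise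
    the form of [L] with positive values [D i]; the [f i] are positive and orthogonal for the form
    of [Lr] at s itself. The [j i] span [la] modulo [Lr] and are dual to the [x i], and [e] bounds
    what tends to 0. *)
Variables (w : X -> X -> R[i]) (ws : skew w) (la mu L Lr : set X) (d dr : nat).
Hypotheses (lla : lagr w la) (lmu : lagr w mu).
Hypotheses (ch : gchart w la mu L d) (chr : gchart w la mu Lr dr).
Variables (p m k : nat) (K KL U Z kap e : R).
Hypotheses (K0 : 0 <= K) (KL0 : 0 <= KL) (U0 : 0 <= U) (Z0 : 0 <= Z).
Hypotheses (kap0 : 0 < kap) (e0 : 0 <= e).
Hypothesis wK : forall x y, cabs (w x y) <= K * rnorm x * rnorm y.
Hypothesis LK : bsum KL L mu.
Variables (x j : 'I_m -> X) (z : 'I_p -> X) (f : 'I_k -> X).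
Variables (D : 'I_p -> R) (E : 'I_k -> R).

Let lp (y : X) := y - mpart Lr mu y.

Hypotheses (xU : forall i, rnorm (x i) <= U) (jU : forall i, rnorm (j i) <= U).
Hypotheses (jla : forall i, la (j i)) (jx : forall i l, w (j i) (x l) = (i == l)%:R).
Hypothesis span_j : forall c, la c -> exists g, (la `&` Lr) (c - comb j g).
Hypothesis lp_j : forall i, span x (lp (j i)).
Hypothesis lp_e : forall i, rnorm (lp (j i)) <= e.
Hypotheses (zla : forall i, la (z i)) (zZ : forall i, rnorm (z i) <= Z).
Hypothesis D_kap : forall i, kap <= D i.
Hypothesis zD : forall i l,
  cabs (cform w mu L (z i) (z l) - (D i)%:C * (i == l)%:R) <= e.
Hypotheses (fla : forall i, la (f i)) (E0 : forall i, 0 < E i).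
Hypothesis fE : forall i l, cform w mu Lr (f i) (f l) = (E i)%:C * (i == l)%:R.

(** [C1] bounds the cross term by [C1] |y|_1 |xi|_1. In [t], the first summand is the weight left on
    |xi|^2 when AM-GM charges kap / 4 to |y|^2, the second bounds the difference of the two forms,
    and [m] passes from the 1-norm to the 2-norm of xi. [p.+1] avoids a division by 0. *)
Let C1 := 2 * K * Z * KL * U.
Let t := m%:R * (4 * p.+1%:R * C1 ^+ 2 / kap + 4 * K * KL * U ^+ 2).
(** [et] lets the shift at most double the bound on the [Lr]-component, [ep] costs a quarter of
    [kap] in the Gram matrix of [z]; the next one, [eK], keeps the term quadratic in [t] below half
    of the gain 2 t |xi|^2. *)
Hypotheses (et : e * t <= U) (ep : e * p%:R <= kap / 4).
Hypothesis eK : t * (K * U * m%:R * e) <= 1.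

Local Notation q := (cform w mu L).
Local Notation q0 := (cform w mu Lr).

Let lL := (chart_lagr ch).1.
Let lLr := (chart_lagr chr).1.

Let t0 : 0 <= t.
Proof.
rewrite mulr_ge0// addr_ge0//.
  by rewrite mulr_ge0 ?invr_ge0 ?(ltW kap0)// mulr_ge0 ?sqr_ge0// mulr_ge0.
by rewrite !mulr_ge0// sqr_ge0.
Qed.

Let lpP y : Lr (lp y) /\ mu (mpart Lr mu y).
Proof. by have [] := mpartP (chart_tot chr) y. Qed.

Let lp_linear a y y' : lp (a *: y + y') = a *: lp y + lp y'.
Proof.
rewrite /lp (mpart_linear lLr lmu.1 (chart_cap chr) (chart_tot chr)).
by rewrite scalerBr opprD addrACA.
Qed.

(** Isotropy of [mu] and of [L'] moves the projection to the second argument. In this shape two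
    charts with the same [mu] can be subtracted. *)
Lemma cform_lpart (L' : set X) d' a b : gchart w la mu L' d' ->
  cform w mu L' a b = w a (b - mpart L' mu b).
Proof.
move=> ch'; have [ma la'] := mpartP (chart_tot ch') a.
have [mb lb] := mpartP (chart_tot ch') b.
rewrite /cform; move: (mpart L' mu a) (mpart L' mu b) ma la' mb lb => m1 m2 h1.
move: (a - m1) (b - m2) (subrK m1 a) (subrK m2 b) => l1 l2 <- <- g1 h2 g2.
rewrite (skewDr ws) (skewDl ws) (lagr_iso lmu h1 h2) addr0.
by rewrite (lagr_iso (chart_lagr ch') g1 g2) add0r.
Qed.

(** Coordinates of the [Lr]-component of [c] with respect to [x]; conjugation compensates for the
    second variable of [w], so that [xi] is linear. *)
Let xi (c : X) : 'rV[R[i]]_m := \row_l Num.conj (w (j l) (lp c)).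

Let xi_linear a c c' : xi (a *: c + c') = a *: xi c + xi c'.
Proof.
by apply/rowP => i; rewrite !mxE lp_linear (skewDr ws) (skewZr ws) rmorphD rmorphM /= conjCK.
Qed.

Let lp_comb g : lp (comb j g) = comb x (xi (comb j g)).
Proof.
have [h hE] : span x (lp (comb j g)).
  rewrite (linear_comb_fun _ _ lp_linear); apply: lin_comb => //.
  exact: span_lin.
move=> hh; rewrite -hh; congr (comb x _); apply/rowP => l.
rewrite mxE -hh (skew_combr ws); under eq_bigr do rewrite jx.
rewrite (bigD1 l)//= eqxx mulr1 big1 ?addr0 ?conjCK// => i il.
by rewrite eq_sym (negbTE il) mulr0.
Qed.

Let n1 n (c : 'rV[R[i]]_n) := \sum_i cabs (c 0 i).
Let n2 n (c : 'rV[R[i]]_n) := \sum_i cabs (c 0 i) ^+ 2.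

Let n1_ge0 n (c : 'rV[R[i]]_n) : 0 <= n1 c.
Proof. by apply: sumr_ge0 => i _; exact: cabs_ge0. Qed.

Let n2_ge0 n (c : 'rV[R[i]]_n) : 0 <= n2 c.
Proof. by apply: sumr_ge0 => i _; exact: sqr_ge0. Qed.

Let n12 n (c : 'rV[R[i]]_n) : n1 c ^+ 2 <= n%:R * n2 c.
Proof. exact: sum_sqr_le. Qed.

Let uu (c : X) := c + t%:C *: comb j (xi c).

Let uu_linear a c c' : uu (a *: c + c') = a *: uu c + uu c'.
Proof.
by rewrite /uu xi_linear linearP !scalerDr !scalerA (mulrC _ a) -addrACA.
Qed.

Let uu_la c : la c -> la (uu c).
Proof.
move=> lac; apply: linD => //; first exact: lla.1.
by apply: linZ; [exact: lla.1|apply: lin_comb => //; exact: lla.1].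
Qed.

Let q0r a b b' (r : R[i]) : q0 a (r *: b + b') = Num.conj r * q0 a b + q0 a b'.
Proof. by rewrite /cform (skewDr ws) (skewZr ws). Qed.

Let q0_lin (r : R[i]) b b' a : q0 (r *: b + b') a = r * q0 b a + q0 b' a.
Proof. exact: (cform_linear ws lmu chr). Qed.

Let q0_j l c : q0 (j l) c = Num.conj (xi c 0 l).
Proof. by rewrite (cform_lpart _ _ chr) mxE conjCK. Qed.

Let lp_J g : rnorm (lp (comb j g)) <= e * n1 g.
Proof.
rewrite (linear_comb_fun _ _ lp_linear) mulrC; exact: rnorm_comb.
Qed.

Let q0_J g : cabs (q0 (comb j g) (comb j g)) <= K * U * e * (m%:R * n2 g).
Proof.
rewrite (cform_lpart _ _ chr); apply: (le_trans (wK _ _)).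
have h1 : rnorm (comb j g) <= n1 g * U by exact: rnorm_comb.
apply: (@le_trans _ _ (K * (n1 g * U) * (e * n1 g))).
  apply: ler_pM => //; rewrite ?mulr_ge0 ?rnorm_ge0//; last exact: lp_J.
  by rewrite ler_wpM2l.
have -> : K * (n1 g * U) * (e * n1 g) = K * U * e * n1 g ^+ 2 by ring.
by rewrite ler_wpM2l// !mulr_ge0.
Qed.

(** The coordinates satisfy q0 (J (xi c), c) = |xi c|^2, so the shift adds 2 t |xi c|^2 and a term
    t^2 q0 (J, J), which [eK] bounds by t |xi c|^2. *)
Let q0_uu c : la c -> complex.Re (q0 c c) + t * n2 (xi c) <= complex.Re (q0 (uu c) (uu c)).
Proof.
move=> lac; set g := xi c.
have e1 : q0 (comb j g) c = (n2 g)%:C.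
  rewrite (form_combl q0_lin) /n2 rmorph_sum; apply: eq_bigr => i _.
  by rewrite q0_j -/g conjM_cabs.
have laJ : la (comb j g) by apply: lin_comb => //; exact: lla.1.
have e2 : q0 c (comb j g) = (n2 g)%:C.
  rewrite (cform_hermitian ws lla lmu chr lac laJ) e1.
  by apply/CrealP; rewrite complex_real.
have -> : q0 (uu c) (uu c) = q0 c c + (2 * t * n2 g)%:C + (t ^+ 2)%:C * q0 (comb j g) (comb j g).
  rewrite /uu -/g addrC q0_lin !q0r e1 e2.
  have -> : Num.conj t%:C = t%:C :> R[i] by apply/CrealP; rewrite complex_real.
  have -> : (t ^+ 2)%:C = t%:C * t%:C by rewrite expr2 (rmorphM (real_complex R)).
  have -> : (2 * t * n2 g)%:C = t%:C * (n2 g)%:C + t%:C * (n2 g)%:C.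
    by rewrite -!(rmorphM (real_complex R)) -(rmorphD (real_complex R)) /=; congr (_%:C); ring.
  by ring.
have h := q0_J g; have h' := Re_ge_cabs ((t ^+ 2)%:C * q0 (comb j g) (comb j g)).
move: h'; rewrite cabsM cabs_real ger0_norm ?sqr_ge0// => h'.
rewrite !raddfD /=.
have : t ^+ 2 * cabs (q0 (comb j g) (comb j g)) <= t * n2 g.
  apply: (@le_trans _ _ (t ^+ 2 * (K * U * e * (m%:R * n2 g)))).
    by rewrite ler_wpM2l ?sqr_ge0.
  have -> : t ^+ 2 * (K * U * e * (m%:R * n2 g)) = t * (t * (K * U * m%:R * e)) * n2 g by ring.
  by rewrite ler_wpM2r ?n2_ge0// ler_piMr.
by lra.
Qed.

Let lp_uu c g : c = comb j g -> rnorm (lp (uu c)) <= 2 * U * n1 (xi c).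
Proof.
move=> cE; rewrite /uu addrC lp_linear.
apply: (le_trans (rnormD _ _)); rewrite rnormZ cabs_real ger0_norm//.
have h1 : rnorm (lp c) <= n1 (xi c) * U by rewrite {1}cE lp_comb -cE; exact: rnorm_comb.
have h2 : t * rnorm (lp (comb j (xi c))) <= t * (e * n1 (xi c)).
  by rewrite ler_wpM2l// lp_J.
have h3 : e * t * n1 (xi c) <= U * n1 (xi c) by rewrite ler_wpM2r// n1_ge0.
by lra.
Qed.

Let mpartK y : rnorm (mpart L mu y) <= KL * rnorm y /\
  rnorm (y - mpart L mu y) <= KL * rnorm y.
Proof.
have [my ly] := mpartP (chart_tot ch) y.
have := LK ly my; rewrite subrK.
by have := rnorm_ge0 (mpart L mu y); have := rnorm_ge0 (y - mpart L mu y); split; lra.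
Qed.

(** [y] and [lp y] differ by an element of [mu], which has no [L]-component. *)
Let lpart_lp y : y - mpart L mu y = lp y - mpart L mu (lp y).
Proof.
have [mlp llp] := mpartP (chart_tot ch) (lp y); have [_ my] := lpP y.
have -> : mpart L mu y = mpart L mu (lp y) + mpart Lr mu y.
  apply: (mpart_uniq lL lmu.1 (chart_cap ch) (chart_tot ch)).
    by apply: linD => //; exact: lmu.1.
  by rewrite opprD addrA addrAC.
by rewrite opprD addrA addrAC.
Qed.

Let q_uu u : complex.Re (q0 u u) - K * KL * rnorm (lp u) ^+ 2 <= complex.Re (q u u).
Proof.
have -> : q u u = q0 u u - w (lp u) (mpart L mu (lp u)).
  rewrite (cform_lpart _ _ ch) (cform_lpart _ _ chr) lpart_lp (skewBr ws); congr (_ - _).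
  have [_ mu'] := lpP u; have [ml _] := mpartP (chart_tot ch) (lp u).
  rewrite -{1}[u](subrK (mpart Lr mu u)) (skewDl ws) (lagr_iso lmu mu' ml) addr0 //.
rewrite raddfB /= lerD2l lerN2; apply: (le_trans (Re_cabs _)).
apply: (le_trans (wK _ _)).
have -> : K * KL * rnorm (lp u) ^+ 2 = K * rnorm (lp u) * (KL * rnorm (lp u)) by ring.
by rewrite ler_wpM2l ?mulr_ge0 ?rnorm_ge0//; case: (mpartK (lp u)).
Qed.

Let q_zu (y : 'rV[R[i]]_p) (u : X) : cabs (q (comb z y) u) <= K * (n1 y * Z) * (KL * rnorm (lp u)).
Proof.
rewrite (cform_lpart _ _ ch) lpart_lp; apply: (le_trans (wK _ _)).
apply: ler_pM => //; rewrite ?mulr_ge0 ?rnorm_ge0//.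
  by rewrite ler_wpM2l//; exact: rnorm_comb.
by case: (mpartK (lp u)).
Qed.

Let q_zz (y : 'rV[R[i]]_p) : 3 / 4 * kap * n2 y <= complex.Re (q (comb z y) (comb z y)).
Proof.
pose F i l := q (z i) (z l) - (D i)%:C * (i == l)%:R.
have -> : q (comb z y) (comb z y) = (\sum_i cabs (y 0 i) ^+ 2 * D i)%:C +
    \sum_i \sum_l y 0 i * Num.conj (y 0 l) * F i l.
  rewrite rmorph_sum -big_split /= (form_combl (cform_linear ws lmu ch)).
  apply: eq_bigr => i _.
  rewrite /cform (skew_combr ws) mulr_sumr.
  have -> : (cabs (y 0 i) ^+ 2 * D i)%:C =
      \sum_l y 0 i * Num.conj (y 0 l) * ((D i)%:C * (i == l)%:R).
    rewrite (bigD1 i)//= eqxx mulr1 big1 ?addr0; last first.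
      by move=> l li; rewrite eq_sym (negbTE li) !mulr0.
    by rewrite conjM_cabs -(rmorphM (real_complex R)).
  rewrite -big_split /=; apply: eq_bigr => l _.
  by rewrite -mulrDr /F addrC subrK mulrA.
rewrite raddfD /=.
set H := (X in complex.Re X).
have h1 : cabs H <= e * n1 y ^+ 2.
  rewrite /H; apply: (le_trans (cabs_sum _)).
  have -> : e * n1 y ^+ 2 = \sum_i \sum_l cabs (y 0 i) * cabs (y 0 l) * e.
    rewrite expr2 mulrC {1}/n1 mulr_suml mulr_suml; apply: eq_bigr => i _.
    by rewrite /n1 mulr_sumr mulr_suml.
  apply: ler_sum => i _; apply: (le_trans (cabs_sum _)); apply: ler_sum => l _.
  by rewrite !cabsM cabs_conj; apply: ler_wpM2l; [rewrite mulr_ge0 ?cabs_ge0|exact: zD].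
have h2 : kap * n2 y <= \sum_i cabs (y 0 i) ^+ 2 * D i.
  rewrite /n2 mulr_sumr; apply: ler_sum => i _.
  by rewrite mulrC ler_wpM2l// sqr_ge0.
have h3 : e * n1 y ^+ 2 <= kap / 4 * n2 y.
  apply: (@le_trans _ _ (e * (p%:R * n2 y))); first by rewrite ler_wpM2l.
  by rewrite mulrA ler_wpM2r ?n2_ge0.
have := Re_ge_cabs H; lra.
Qed.

(* [z + uu c] with [uu c = c + t J (xi c)]: the shift by [J (xi c)] gains
   [t |xi c|^2], which absorbs both the cross term [2 Re q (z, uu c)] and the
   difference [q - q0], of second order in the [Lr]-component of [uu c]. *)
Lemma local_definite_dim : definite_dim la q (p + k).
Proof.
have q00 : q 0 0 = 0 by rewrite /cform (skew0r ws).
apply/(definite_dimP _ lla.1 q00).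
(* Vectors of la cap Lr are null for [q0], so [f] may be moved into the span of [j], where [lp] is
   controlled by its coordinates. *)
have /choice[c hc] : forall i, exists c, (exists g, c = comb j g) /\ (la `&` Lr) (f i - c).
  by move=> i; have [g hg] := span_j (fla i); exists (comb j g); split=> //; exists g.
have cla i : la (c i).
  have [[g ->] _] := hc i; apply: lin_comb => //; exact: lla.1.
have cE i l : q0 (c i) (c l) = (E i)%:C * (i == l)%:R.
  rewrite -fE; have [_ Ni] := hc i; have [_ Nl] := hc l.
  have -> : c i = (- 1) *: (f i - c i) + f i by rewrite scaleN1r opprB subrK.
  rewrite q0_lin (cform_null ws lmu chr Ni (cla l)) mulr0 add0r.
  have -> : c l = (- 1) *: (f l - c l) + f l by rewrite scaleN1r opprB subrK.
  rewrite q0r (cform_hermitian ws lla lmu chr (fla i) _); last by case: Nl.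
  by rewrite (cform_null ws lmu chr Nl (fla i)) rmorph0 mulr0 add0r.
exists (join z (fun i => uu (c i))); split.
  by apply: join_in => i //; exact: uu_la.
move=> h h0; rewrite comb_join; set y := lsubmx h; set g := rsubmx h.
have -> : comb (fun i => uu (c i)) g = uu (comb c g).
  by rewrite (linear_comb_fun _ _ uu_linear).
set cc := comb c g.
have laz : la (comb z y) by apply: lin_comb => //; exact: lla.1.
have lacc : la cc by apply: lin_comb => //; exact: lla.1.
have lau := uu_la lacc.
have lav : la (comb z y + uu cc) by apply: linD => //; exact: lla.1.
rewrite (hermitian_real (cform_hermitian ws lla lmu ch lav lav)) ltcR.
have qD : complex.Re (q (comb z y + uu cc) (comb z y + uu cc)) =
    complex.Re (q (comb z y) (comb z y)) + 2 * complex.Re (q (comb z y) (uu cc))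
    + complex.Re (q (uu cc) (uu cc)).
  rewrite -[comb z y in LHS]scale1r (cform_linear ws lmu ch) mul1r scale1r.
  have -> a : q a (comb z y + uu cc) = q a (comb z y) + q a (uu cc).
    by rewrite /cform (skewDr ws).
  have -> : q (uu cc) (comb z y + uu cc) = q (uu cc) (comb z y) + q (uu cc) (uu cc).
    by rewrite /cform (skewDr ws).
  rewrite (cform_hermitian ws lla lmu ch lau laz) !raddfD /=.
  have -> : complex.Re (Num.conj (q (comb z y) (uu cc))) = complex.Re (q (comb z y) (uu cc)).
    by case: (q _ _).
  lra.
have [gg ccE] : exists gg, cc = comb j gg.
  have /choice[G hG] : forall i, exists g, c i = comb j g by move=> i; case: (hc i).
  exists (g *m \matrix_i G i); rewrite -comb_mul /cc; congr (comb _ g).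
  by apply/funext => i; rewrite rowK.
have A := q_zz y; have B := q_zu y (uu cc); have C := q_uu (uu cc).
have F := q0_uu lacc; have G := lp_uu ccE.
have qcc : complex.Re (q0 cc cc) = \sum_i cabs (g 0 i) ^+ 2 * E i.
  by rewrite /cc (@form_orthogonal _ _ la _ lla.1 _ _ _ c E g) //;
    exact: (cform_hermitian ws lla lmu chr).
have B' := Re_ge_cabs (q (comb z y) (uu cc)).
rewrite qD; set a := n1 y in B; set b := n1 (xi cc) in G.
have a0 : 0 <= a by exact: n1_ge0.
have b0 : 0 <= b by exact: n1_ge0.
have an : a ^+ 2 <= p%:R * n2 y := n12 y.
have bn : b ^+ 2 <= m%:R * n2 (xi cc) := n12 (xi cc).
have l0 := rnorm_ge0 (lp (uu cc)); set l := rnorm (lp (uu cc)) in B C G l0.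
have B2 : cabs (q (comb z y) (uu cc)) <= C1 * a * b.
  apply: (le_trans B); have -> : C1 * a * b = K * (a * Z) * (KL * (2 * U * b)).
    by rewrite /C1; ring.
  by rewrite ler_wpM2l ?mulr_ge0// ler_wpM2l.
have C2 : K * KL * l ^+ 2 <= 4 * K * KL * U ^+ 2 * b ^+ 2.
  have -> : 4 * K * KL * U ^+ 2 * b ^+ 2 = K * KL * (2 * U * b) ^+ 2 by ring.
  by rewrite ler_wpM2l ?mulr_ge0// lerXn2r// nnegrE// !mulr_ge0.
have P0 : (0 : R) < p.+1%:R by rewrite ltr0n.
(* weighted AM-GM *)
have am : 2 * (C1 * a * b) <= kap / (4 * p.+1%:R) * a ^+ 2 + 4 * p.+1%:R * C1 ^+ 2 / kap * b ^+ 2.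
  pose r := kap / (4 * p.+1%:R).
  have r0 : 0 < r by rewrite divr_gt0// mulr_gt0.
  have -> : 4 * p.+1%:R * C1 ^+ 2 / kap = C1 ^+ 2 / r.
    by rewrite /r; move: (C1 ^+ 2) => C1s; field; rewrite ?gt_eqF.
  have : 0 <= (r * a - C1 * b) ^+ 2 / r by rewrite divr_ge0 ?sqr_ge0// ltW.
  have -> : (r * a - C1 * b) ^+ 2 / r = r * a ^+ 2 - 2 * (C1 * a * b) + C1 ^+ 2 / r * b ^+ 2.
    by field; rewrite gt_eqF.
  by rewrite -/r; lra.
have am1 : kap / (4 * p.+1%:R) * a ^+ 2 <= kap / 4 * n2 y.
  have -> : kap / 4 * n2 y = kap / (4 * p.+1%:R) * (p.+1%:R * n2 y).
    by field; rewrite ?gt_eqF.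
  rewrite ler_wpM2l ?divr_ge0 ?mulr_ge0 ?(ltW kap0)//.
  by apply: (le_trans an); rewrite ler_wpM2r ?n2_ge0// ler_nat.
have am2 : (4 * p.+1%:R * C1 ^+ 2 / kap + 4 * K * KL * U ^+ 2) * b ^+ 2 <= t * n2 (xi cc).
  rewrite /t [_ * (_ + _)]mulrC -[X in _ <= X]mulrA; apply: ler_wpM2l => //; rewrite addr_ge0//.
    by rewrite mulr_ge0 ?invr_ge0 ?(ltW kap0)// mulr_ge0 ?sqr_ge0// mulr_ge0.
  by rewrite !mulr_ge0// sqr_ge0.
move: am2; rewrite mulrDl => am2.
have fin : kap / 2 * n2 y + complex.Re (q0 cc cc) <=
    complex.Re (q (comb z y) (comb z y)) + 2 * complex.Re (q (comb z y) (uu cc)) +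
    complex.Re (q (uu cc) (uu cc)).
  move: am2 am1 am C2 B2 B' F C A.
  move: (4 * p.+1%:R * C1 ^+ 2 / kap * b ^+ 2) (kap / (4 * p.+1%:R) * a ^+ 2).
  move: (4 * K * KL * U ^+ 2 * b ^+ 2) (C1 * a * b) (K * KL * l ^+ 2) (t * n2 (xi cc)).
  move: (cabs (q (comb z y) (uu cc))) (complex.Re (q (comb z y) (uu cc))).
  move: (complex.Re (q (uu cc) (uu cc))) (complex.Re (q (comb z y) (comb z y))).
  move: (complex.Re (q0 (uu cc) (uu cc))) (complex.Re (q0 cc cc)) (n2 y) => *.
  by lra.
apply: lt_le_trans fin; rewrite qcc.
have pos n (v : 'rV[R[i]]_n) (S : 'I_n -> R) : v != 0 -> (forall i, 0 < S i) ->
    0 < \sum_i cabs (v 0 i) ^+ 2 * S i.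
  move=> /matrix0Pn[i0 [l1]]; rewrite ord1 => vi S0; rewrite (bigD1 l1)//=.
  apply: ltr_pwDl; last by apply: sumr_ge0 => l' _; rewrite mulr_ge0 ?sqr_ge0// ltW.
  rewrite mulr_gt0// exprn_gt0// lt_neqAle cabs_ge0 andbT eq_sym.
  by apply: contra_neq vi => /cabs0_eq0 ->.
have [g0|g0] := eqVneq g 0.
  have y0 : y != 0.
    by apply: contraNneq h0 => y0; rewrite -[h]hsubmxK -/y -/g g0 y0 row_mx0.
  rewrite g0 big1 ?addr0; last by move=> i _; rewrite mxE cabs0 expr0n mul0r.
  rewrite mulr_gt0 ?divr_gt0//.
  have := pos _ _ (fun=> 1) y0 (fun=> ltr01).
  by rewrite /n2; under eq_bigr do rewrite mulr1.
by apply: ltr_wpDl; [rewrite mulr_ge0 ?n2_ge0// divr_ge0// ltW|exact: pos].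
Qed.

End LocalEstimate.

(** * Convergent forms, bases and annihilators *)

Section FormConvergence.
Variables (R : realType) (X : completeNormedModType R[i]).
Implicit Types (x y : X) (A B : set X) (e : R).

Definition wbd (K : R) (w : X -> X -> R[i]) :=
  forall x y, cabs (w x y) <= K * rnorm x * rnorm y.

Section Gram.
Variables (n : nat) (G : 'M[R[i]]_n) (h : R).
Hypothesis (hG : forall i l, cabs (G i l - (i == l)%:R) <= h).
Hypothesis hn : h * n%:R <= 1 / 2.

(** In the 1-norm of row vectors, [G] differs from the identity by an operator of norm at most h n
    <= 1 / 2. *)
Lemma gram_bound (c : 'rV_n) :
  \sum_i cabs (c 0 i) <= 2 * \sum_i cabs ((c *m G) 0 i).
Proof.
have key : \sum_i cabs ((c *m G) 0 i - c 0 i) <= h * n%:R * \sum_i cabs (c 0 i).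
  have -> : h * n%:R * \sum_i cabs (c 0 i) = \sum_(l < n) \sum_i cabs (c 0 i) * h.
    by rewrite sumr_const card_ord -mulr_suml -mulr_natl; ring.
  apply: ler_sum => l _.
  have -> : (c *m G) 0 l - c 0 l = \sum_i c 0 i * (G i l - (i == l)%:R).
    rewrite mxE -[in X in _ - X](sum_delta_l (c 0) l) -sumrB.
    by apply: eq_bigr => i _; rewrite mulrBr.
  apply: (le_trans (cabs_sum _)); apply: ler_sum => i _.
  by rewrite cabsM ler_wpM2l// cabs_ge0.
have : \sum_i cabs (c 0 i) <= \sum_i cabs ((c *m G) 0 i) + \sum_i cabs ((c *m G) 0 i - c 0 i).
  rewrite -big_split /=; apply: ler_sum => i _.
  rewrite -{1}[c 0 i](subKr ((c *m G) 0 i)); apply: (le_trans (cabsD _ _)).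
  by rewrite cabsN.
have c0 : 0 <= \sum_i cabs (c 0 i) by apply: sumr_ge0 => i _; exact: cabs_ge0.
have : h * n%:R * \sum_i cabs (c 0 i) <= 1 / 2 * \sum_i cabs (c 0 i).
  by rewrite ler_wpM2r.
by lra.
Qed.

Lemma gram_inj (c : 'rV_n) : c *m G = 0 -> c = 0.
Proof.
move=> cG; have := gram_bound c; rewrite cG.
rewrite [X in _ <= _ * X -> _]big1 ?mulr0; last by move=> i _; rewrite mxE cabs0.
move=> h1; apply/rowP => i; rewrite mxE; apply/cabs0_eq0/le_anti.
rewrite cabs_ge0 andbT; apply: le_trans h1.
by rewrite (bigD1 i)//= lerDl; apply: sumr_ge0 => l _; exact: cabs_ge0.
Qed.

Lemma gram_solve (b : 'rV_n) : exists2 c : 'rV_n, c *m G = b &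
  \sum_i cabs (c 0 i) <= 2 * \sum_i cabs (b 0 i).
Proof.
have Gu : G \in unitmx.
  rewrite -row_free_unit -kermx_eq0; apply/rowV0P => v /sub_kermxP; exact: gram_inj.
exists (b *m invmx G); first by rewrite mulmxKV.
by have := gram_bound (b *m invmx G); rewrite mulmxKV.
Qed.

End Gram.

Section Filters.
Variables (T : Type) (F : set_system T) (FF : Filter F).

Definition fcv (w : T -> X -> X -> R[i]) (w0 : X -> X -> R[i]) :=
  forall e, 0 < e -> \forall s \near F, forall x y,
    cabs (w s x y - w0 x y) <= e * rnorm x * rnorm y.

Lemma near_ord n (P : 'I_n -> T -> Prop) :
  (forall i, \forall s \near F, P i s) -> \forall s \near F, forall i, P i s.
Proof. by move=> h; apply: filter_forall. Qed.

Lemma fcv_wbd w w0 K : wbd K w0 -> fcv w w0 -> \forall s \near F, wbd (K + 1) (w s).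
Proof.
move=> wb wc; apply: filterS (wc 1 ltr01) => s h x y.
rewrite -[w s x y](subrK (w0 x y)); apply: (le_trans (cabsD _ _)).
by have := h x y; have := wb x y; lra.
Qed.

Lemma vcv_le (x : T -> X) x0 : vcv F x x0 -> \forall s \near F, rnorm (x s) <= rnorm x0 + 1.
Proof.
move=> h; apply: filterS (h 1 ltr01) => s; have := rnorm_le_dist (x s) x0.
by lra.
Qed.

Lemma form_dist w w0 x y x0 y0 K e : skew w0 -> wbd K w0 ->
  (forall x y, cabs (w x y - w0 x y) <= e * rnorm x * rnorm y) ->
  cabs (w x y - w0 x0 y0) <= e * rnorm x * rnorm y +
    K * rnorm (x - x0) * rnorm y + K * rnorm x0 * rnorm (y - y0).
Proof.
move=> ws wb h.
have -> : w x y - w0 x0 y0 = (w x y - w0 x y) + (w0 (x - x0) y + w0 x0 (y - y0)).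
  by rewrite (skewBl ws) (skewBr ws); ring.
apply: (le_trans (cabsD _ _)); rewrite -addrA; apply: lerD => //.
by apply: (le_trans (cabsD _ _)); apply: lerD; exact: wb.
Qed.

Lemma scv_form w w0 (x y : T -> X) x0 y0 K : skew w0 -> 0 <= K -> wbd K w0 -> fcv w w0 ->
  vcv F x x0 -> vcv F y y0 -> forall e, 0 < e ->
  \forall s \near F, cabs (w s (x s) (y s) - w0 x0 y0) <= e.
Proof.
move=> ws K0 wb wc xc yc e e0.
pose C := (rnorm x0 + 1) * (rnorm y0 + 1) + K * (rnorm y0 + 1) + K * rnorm x0 + 1.
have x1 := rnorm_ge0 x0; have y1 := rnorm_ge0 y0.
have C0 : 0 < C.
  rewrite /C ltr_wpDl//; rewrite !addr_ge0//; try exact: mulr_ge0.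
  - by rewrite mulr_ge0// addr_ge0.
  - by rewrite mulr_ge0// addr_ge0.
pose h := e / C; have h0 : 0 < h by rewrite divr_gt0.
have hC : h * C = e by rewrite mulfVK// gt_eqF.
near=> s.
have wcs : forall x y, cabs (w s x y - w0 x y) <= h * rnorm x * rnorm y.
  by near: s; exact: wc.
have bx : rnorm (x s) <= rnorm x0 + 1 by near: s; exact: vcv_le.
have by' : rnorm (y s) <= rnorm y0 + 1 by near: s; exact: vcv_le.
have dx : rnorm (x s - x0) <= h by near: s; exact: xc.
have dy : rnorm (y s - y0) <= h by near: s; exact: yc.
apply: (le_trans (form_dist (x s) (y s) x0 y0 ws wb wcs)).
have nx := rnorm_ge0 (x s); have ny := rnorm_ge0 (y s).
have h1 : h * rnorm (x s) * rnorm (y s) <= h * ((rnorm x0 + 1) * (rnorm y0 + 1)).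
  by rewrite -mulrA ler_wpM2l ?(ltW h0)// ler_pM.
have h2 : K * rnorm (x s - x0) * rnorm (y s) <= K * h * (rnorm y0 + 1).
  apply: ler_pM => //; rewrite ?mulr_ge0 ?rnorm_ge0//.
  by rewrite ler_wpM2l.
have h3 : K * rnorm x0 * rnorm (y s - y0) <= K * rnorm x0 * h.
  by rewrite ler_wpM2l// mulr_ge0.
have : 0 <= h by exact: ltW.
by rewrite -hC /C; lra.
Unshelve. all: end_near. Qed.

Lemma vcv_add (x y : T -> X) x0 y0 : vcv F x x0 -> vcv F y y0 ->
  vcv F (fun s => x s + y s) (x0 + y0).
Proof.
move=> xc yc e e0; have e2 : 0 < e / 2 by lra.
apply: filterS2 (xc _ e2) (yc _ e2) => s h1 h2.
by rewrite opprD addrACA; have := rnormD (x s - x0) (y s - y0); lra.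
Qed.

Lemma vcv_scale (a : T -> R[i]) a0 (x : T -> X) x0 :
  (forall e, 0 < e -> \forall s \near F, cabs (a s - a0) <= e) -> vcv F x x0 ->
  vcv F (fun s => a s *: x s) (a0 *: x0).
Proof.
move=> ac xc e e0; pose C := rnorm x0 + 1 + cabs a0 + 1.
have x1 := rnorm_ge0 x0; have a1 := cabs_ge0 a0.
have C0 : 0 < C by rewrite /C; lra.
pose h := e / C; have h0 : 0 < h by rewrite divr_gt0.
have hC : h * C = e by rewrite mulfVK// gt_eqF.
apply: filterS3 (ac _ h0) (xc _ h0) (vcv_le xc) => s d1 d2 b.
have -> : a s *: x s - a0 *: x0 = (a s - a0) *: x s + a0 *: (x s - x0).
  by rewrite scalerBl scalerBr addrA subrK.
apply: (le_trans (rnormD _ _)); rewrite !rnormZ.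
have h1 : cabs (a s - a0) * rnorm (x s) <= h * (rnorm x0 + 1).
  by rewrite ler_pM// ?cabs_ge0 ?rnorm_ge0.
have h2 : cabs a0 * rnorm (x s - x0) <= cabs a0 * h by rewrite ler_wpM2l.
by rewrite -hC /C; lra.
Qed.

Lemma vcv_sum n (x : T -> 'I_n -> X) (x0 : 'I_n -> X) : (forall i, vcv F (x ^~ i) (x0 i)) ->
  vcv F (fun s => \sum_i x s i) (\sum_i x0 i).
Proof.
elim: n x x0 => [|n IH] x x0 h.
  by move=> e e0; apply: nearW => s; rewrite !big_ord0 subrr rnorm0 ltW.
have := vcv_add (h ord0) (IH _ _ (fun i => h (lift ord0 i))).
by move=> hh e e0; apply: filterS (hh _ e0) => s; rewrite !big_ord_recl.
Qed.

(** [component_dist] has an error proportional to the components themselves; the uniform [bsum]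
    nearby bounds these first, by [M]. *)
Lemma vcv_component (A B : T -> set X) (A0 B0 : set X) K (a b x : T -> X) a0 b0 :
  0 <= K -> bsum K A0 B0 -> subspace_of_space A0 -> subspace_of_space B0 ->
  gcv F A A0 -> gcv F B B0 ->
  (\forall s \near F, [/\ A s (a s), B s (b s) & x s = a s + b s]) ->
  A0 a0 -> B0 b0 -> vcv F x (a0 + b0) -> vcv F a a0 /\ vcv F b b0.
Proof.
move=> K0 h lA lB cA cB dec Aa Bb xc.
suff key e : 0 < e -> \forall s \near F, rnorm (a s - a0) + rnorm (b s - b0) <= e.
  split=> e /key; apply: filterS => s.
    by have := rnorm_ge0 (b s - b0); lra.
  by have := rnorm_ge0 (a s - a0); lra.
move=> e0; pose M := 2 * K * (rnorm (a0 + b0) + 1).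
have x1 := rnorm_ge0 (a0 + b0).
have M0 : 0 <= M by rewrite !mulr_ge0//; lra.
pose C := K * (1 + M) + M + 1.
have C0 : 0 < C by rewrite /C ltr_wpDl// addr_ge0// mulr_ge0// addr_ge0.
pose d := e / C; have d0 : 0 < d by rewrite divr_gt0.
have dC : d * C = e by rewrite mulfVK// gt_eqF.
have hsF := gcv_bsum FF K0 cA cB h.
near=> s.
have [//|A1 A2] := near (cA _ d0) s; have [//|B1 B2] := near (cB _ d0) s.
have [//|As Bs xs] := near dec s.
have dx : rnorm (x s - (a0 + b0)) <= d by near: s; exact: xc.
have bx : rnorm (x s) <= rnorm (a0 + b0) + 1 by near: s; exact: vcv_le.
have hs : bsum (2 * K) (A s) (B s) by near: s; exact: hsF.
have := component_dist lA lB K0 h A1 B1 Aa Bb As Bs.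
rewrite -xs; have := hs _ _ As Bs; rewrite -xs => hsum.
have hM : rnorm (a s) + rnorm (b s) <= M.
  by apply: (le_trans hsum); rewrite /M ler_wpM2l// mulr_ge0.
move/le_trans; apply.
have h1 : d * (rnorm (a s) + rnorm (b s)) <= d * M by rewrite ler_wpM2l// ltW.
have h2 : K * (rnorm (x s - (a0 + b0)) + d * (rnorm (a s) + rnorm (b s))) <=
   K * (d + d * M) by rewrite ler_wpM2l//; lra.
by rewrite -dC /C; lra.
Unshelve. all: end_near. Qed.

(** The fixed dual vectors [u] test both properties: the Gram matrix of [u] with the selected
    vectors is nearly the identity, which gives independence. A vector of [V s] killed by all [u i]
    is close to a vector of [V0] with small coordinates; [e] is chosen so that its norm is at most
    half of itself. *)
Lemma gcv_basis w (V : T -> set X) (V0 : set X) n (v u : 'I_n -> X) K :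
  skew w -> 0 <= K -> wbd K w -> lincl F V -> gcv F V V0 ->
  (forall i l, w (u i) (v l) = (i == l)%:R) -> V0 = span v ->
  exists2 v' : T -> 'I_n -> X, forall i, vcv F (v' ^~ i) (v i) &
    \forall s \near F, basis_mod (V s) [set 0] (v' s).
Proof.
move=> ws K0 wb Vl Vc uv V0E.
have /choice[g hg] : forall i, exists x : T -> X,
    (\forall s \near F, V s (x s)) /\ vcv F x (v i).
  move=> i; have [|x xV xc] := gcv_select FF Vl Vc (x := v i); last by exists x.
  by rewrite V0E; exact: span_mem.
pose v' s i := g i s; exists v' => [i|]; first by case: (hg i).
pose U := \sum_i rnorm (u i); pose W := \sum_i rnorm (v i).
have U0 : 0 <= U by apply: sumr_ge0 => i _; exact: rnorm_ge0.
have W0 : 0 <= W by apply: sumr_ge0 => i _; exact: rnorm_ge0.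
have uU i : rnorm (u i) <= U.
  by rewrite /U (bigD1 i)//= lerDl sumr_ge0// => l _; exact: rnorm_ge0.
have vW i : rnorm (v i) <= W.
  by rewrite /W (bigD1 i)//= lerDl sumr_ge0// => l _; exact: rnorm_ge0.
have n0 : (0 : R) <= n%:R by exact: ler0n.
pose e := 1 / (2 * (K * U * n%:R * W + 1)).
have D0 : 0 < 2 * (K * U * n%:R * W + 1).
  by rewrite mulr_gt0// ltr_wpDl// !mulr_ge0.
have e0 : 0 < e by rewrite divr_gt0.
have eD : e * (2 * (K * U * n%:R * W + 1)) = 1 by rewrite mulfVK// gt_eqF.
pose h : R := 1 / (2 * n.+1%:R).
have h0 : 0 < h by rewrite divr_gt0// mulr_gt0.
have hn : h * n%:R <= 1 / 2.
  have hn1 : h * n.+1%:R = 1 / 2 by rewrite /h; field; rewrite gt_eqF.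
  by rewrite -hn1 ler_wpM2l ?ltW// ltr_nat.
have wcst : fcv (fun=> w) w.
  by move=> d d0; apply: nearW => _ x y; rewrite subrr cabs0 !mulr_ge0 ?rnorm_ge0// ltW.
near=> s.
have [//|lV cV] := near Vl s; have [//|V1 V2] := near (Vc _ e0) s.
have Vv i : V s (v' s i).
  have hV : forall i, V s (v' s i) by near: s; apply: near_ord => i'; case: (hg i').
  exact: hV.
have hG i l : cabs (w (u i) (v' s l) - (i == l)%:R) <= h.
  have hG : forall i l, cabs (w (u i) (v' s l) - (i == l)%:R) <= h.
    near: s; apply: near_ord => i'; apply: near_ord => l'; rewrite -uv.
    exact: (@scv_form (fun=> w) w (fun=> u i') (v' ^~ l') _ _ K ws K0 wb wcst
      (vcv_cst FF _) (hg l').2 h h0).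
  exact: hG.
pose G := \matrix_(l, i) Num.conj (w (u i) (v' s l)).
have hG' l i : cabs (G l i - (l == i)%:R) <= h.
  by rewrite mxE -[(l == i)%:R]conjC_nat -rmorphB cabs_conj eq_sym.
apply/basis_modP; split=> //.
  move=> c hc; apply: (gram_inj hG' hn); apply/rowP => i.
  have := congr1 (w (u i)) hc; rewrite (skew_combr ws) (skew0r ws).
  move=> /(congr1 Num.conj); rewrite rmorph_sum rmorph0 !mxE => hc'.
  by rewrite -[RHS]hc'; apply: eq_bigr => l _; rewrite !mxE rmorphM /= conjCK.
move=> x Vx.
have [c cG _] := gram_solve hG' hn (\row_i Num.conj (w (u i) x)).
exists c => //; apply/esym/eqP; rewrite -subr_eq0; set y := x - _; apply/eqP.
have Vy : V s y by apply: linB => //; exact: lin_comb.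
have uy i : w (u i) y = 0.
  rewrite (skewBr ws) (skew_combr ws); apply/eqP; rewrite subr_eq0; apply/eqP.
  have /rowP/(_ i) := cG; rewrite !mxE => /(congr1 Num.conj); rewrite conjCK => <-.
  by rewrite rmorph_sum; apply: eq_bigr => l _; rewrite !mxE rmorphM /= conjCK.
have [z0 V0z0 hz] := V1 _ Vy; move: V0z0; rewrite V0E => -[d _ dz].
have dE i : cabs (d 0 i) <= K * U * (e * rnorm y).
  have -> : cabs (d 0 i) = cabs (w (u i) (z0 - y)).
    rewrite (skewBr ws) uy subr0 -dz (skew_combr ws); under eq_bigr do rewrite uv.
    rewrite (bigD1 i)//= eqxx mulr1 big1 ?addr0 ?cabs_conj// => l li.
    by rewrite eq_sym (negbTE li) mulr0.
  apply: (le_trans (wb _ _)); rewrite rdistC; apply: ler_pM => //.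
  - by rewrite mulr_ge0// rnorm_ge0.
  - exact: rnorm_ge0.
  - by rewrite ler_wpM2l.
have zb : rnorm z0 <= n%:R * (K * U * (e * rnorm y)) * W.
  rewrite -dz; apply: (le_trans (rnorm_comb _ vW)); rewrite ler_wpM2r//.
  apply: (@le_trans _ _ (\sum_(i < n) (K * U * (e * rnorm y)))).
    by apply: ler_sum => i _; exact: dE.
  by rewrite sumr_const card_ord mulr_natl.
apply: rnorm0_eq0; apply/le_anti; rewrite rnorm_ge0 andbT.
have := rnorm_le_dist y z0; have ny := rnorm_ge0 y.
have : n%:R * (K * U * (e * rnorm y)) * W + e * rnorm y = 1 / 2 * rnorm y.
  have -> : n%:R * (K * U * (e * rnorm y)) * W + e * rnorm y =
    e * (2 * (K * U * n%:R * W + 1)) / 2 * rnorm y by field.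
  by rewrite eD.
by lra.
Unshelve. all: end_near. Qed.

(** A vector close to one of the two annihilators pairs almost to zero with the other basis, and is
    corrected by a small combination of dual vectors in [A0] or [A s]; at s the coefficients solve a
    system with nearly identical Gram matrix. *)
Lemma gcv_orth_cap w w0 (V A : T -> set X) (V0 A0 : set X) n (v u : 'I_n -> X)
    (v' : T -> 'I_n -> X) K :
  skew w0 -> 0 <= K -> wbd K w0 -> fcv w w0 -> (\forall s \near F, skew (w s)) ->
  lincl F A -> gcv F A A0 -> subspace_of_space A0 ->
  (forall i, A0 (u i)) -> (forall i l, w0 (u i) (v l) = (i == l)%:R) ->
  V0 = span v -> (forall i, vcv F (v' ^~ i) (v i)) ->
  (\forall s \near F, V s = span (v' s)) ->
  gcv F (fun s => orth (w s) (V s) `&` A s) (orth w0 V0 `&` A0).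
Proof.
move=> ws K0 wb wc wsk Al Ac lA0 Au uv V0E vc VE.
have /choice[g hg] : forall i, exists x : T -> X,
    (\forall s \near F, A s (x s)) /\ vcv F x (u i).
  by move=> i; have [|x xV xc] := gcv_select FF Al Ac (x := u i); last by exists x.
pose u' s i := g i s.
have uc i : vcv F (u' ^~ i) (u i) by case: (hg i).
pose U := \sum_i rnorm (u i) + 1; pose W := \sum_i rnorm (v i) + 1.
have uU i : rnorm (u i) + 1 <= U.
  by rewrite /U lerD2r (bigD1 i)//= lerDl sumr_ge0// => l _; exact: rnorm_ge0.
have vW i : rnorm (v i) + 1 <= W.
  by rewrite /W lerD2r (bigD1 i)//= lerDl sumr_ge0// => l _; exact: rnorm_ge0.
have U1 : 1 <= U by rewrite /U lerDr sumr_ge0// => i _; exact: rnorm_ge0.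
have W1 : 1 <= W by rewrite /W lerDr sumr_ge0// => i _; exact: rnorm_ge0.
have n0 : (0 : R) <= n%:R by exact: ler0n.
move=> e e0.
(* C is such that |w_s(y, v'_i) - w_0(x, v_i)| <= d C |x| if |x - y| <= d |x| *)
pose C := 2 * W + K * W + K * 2 + K.
have C0 : 0 <= C by rewrite /C !addr_ge0 ?mulr_ge0//; lra.
pose M := 1 + 2 * n%:R * C * U.
have M0 : 0 < M by rewrite /M ltr_wpDr// !mulr_ge0//; lra.
pose d := Num.min 1 (e / M).
have d0 : 0 < d by rewrite lt_min ltr01 divr_gt0.
have d1 : d <= 1 by rewrite ge_min lexx.
have dM : d * M <= e by rewrite -ler_pdivlMr// ge_min lexx orbT.
pose h : R := 1 / (2 * n.+1%:R).
have h0 : 0 < h by rewrite divr_gt0// mulr_gt0.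
have hn : h * n%:R <= 1 / 2.
  have hn1 : h * n.+1%:R = 1 / 2 by rewrite /h; field; rewrite gt_eqF.
  by rewrite -hn1 ler_wpM2l ?ltW// ltr_nat.
near=> s.
have wss : skew (w s) by near: s.
have [//|lA cA] := near Al s; have [//|A1 A2] := near (Ac _ d0) s.
have VEs : V s = span (v' s) by near: s.
have wcs : forall x y, cabs (w s x y - w0 x y) <= d * rnorm x * rnorm y.
  by near: s; exact: wc.
have Aus : forall i, A s (u' s i) by near: s; apply: near_ord => i; case: (hg i).
have vb : forall i, rnorm (v' s i) <= W.
  near: s; apply: near_ord => i; apply: filterS (vcv_le (vc i)) => s'.
  by move/le_trans; apply.
have ub : forall i, rnorm (u' s i) <= U.
  near: s; apply: near_ord => i; apply: filterS (vcv_le (uc i)) => s'.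
  by move/le_trans; apply.
have vd : forall i, rnorm (v' s i - v i) <= d.
  by near: s; apply: near_ord => i; exact: vc.
have hG : forall i l, cabs (w s (u' s i) (v' s l) - (i == l)%:R) <= h.
  near: s; apply: near_ord => i; apply: near_ord => l; rewrite -uv.
  exact: (scv_form (K := K) ws).
have est x y i : rnorm (x - y) <= d * rnorm x ->
    cabs (w s y (v' s i) - w0 x (v i)) <= d * C * rnorm x /\
    cabs (w s x (v' s i) - w0 y (v i)) <= d * C * rnorm x.
  move=> xy; have nx := rnorm_ge0 x.
  have yx : rnorm y <= 2 * rnorm x.
    have := rnorm_le_dist y x; rewrite (rdistC y).
    have : d * rnorm x <= rnorm x by rewrite ler_piMl.
    lra.
  have vi0 := rnorm_ge0 (v' s i); have yi0 := rnorm_ge0 y.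
  have h1 := form_dist y (v' s i) x (v i) ws wb wcs.
  have h2 := form_dist x (v' s i) y (v i) ws wb wcs.
  have k1 : d * rnorm y * rnorm (v' s i) <= d * (2 * rnorm x) * W.
    by rewrite ler_pM// ?mulr_ge0 ?(ltW d0)// ler_wpM2l// ltW.
  have k1' : d * rnorm x * rnorm (v' s i) <= d * (2 * rnorm x) * W.
    apply: ler_pM => //; first by rewrite mulr_ge0// ltW.
    by rewrite ler_wpM2l ?(ltW d0)//; lra.
  have k2 : K * rnorm (y - x) * rnorm (v' s i) <= K * (d * rnorm x) * W.
    by rewrite ler_pM// ?mulr_ge0 ?rnorm_ge0// ler_wpM2l// rdistC.
  have k2' : K * rnorm (x - y) * rnorm (v' s i) <= K * (d * rnorm x) * W.
    by rewrite ler_pM// ?mulr_ge0 ?rnorm_ge0// ler_wpM2l.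
  have k3 : K * rnorm x * rnorm (v' s i - v i) <= K * rnorm x * d.
    by rewrite ler_wpM2l// mulr_ge0.
  have k3' : K * rnorm y * rnorm (v' s i - v i) <= K * (2 * rnorm x) * d.
    by rewrite ler_pM// ?mulr_ge0 ?rnorm_ge0// ler_wpM2l.
  have p1 : 0 <= K * rnorm x * d by rewrite !mulr_ge0// ltW.
  by rewrite /C; split; lra.
have sumle (b : 'rV[R[i]]_n) k : (forall i, cabs (b 0 i) <= k) ->
    \sum_i cabs (b 0 i) <= n%:R * k.
  move=> bk; apply: (@le_trans _ _ (\sum_(i < n) k)); first by apply: ler_sum.
  by rewrite sumr_const card_ord mulr_natl.
split=> x [xV Ax].
  have [y A0y xy] := A1 _ Ax.
  pose b := \row_i w0 y (v i).
  have bb i : cabs (b 0 i) <= d * C * rnorm x.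
    have [_] := est x y i xy; rewrite mxE xV ?sub0r ?cabsN//.
    by rewrite VEs; exact: span_mem.
  exists (y - comb u b).
    split; last by apply: linB => //; exact: lin_comb.
    by rewrite V0E; apply: (orth_span ws) => i; exact: dual_project.
  have -> : x - (y - comb u b) = (x - y) + comb u b by rewrite opprB addrA addrAC.
  apply: (le_trans (rnormD _ _)).
  have uU' i : rnorm (u i) <= U by have := uU i; lra.
  have := rnorm_comb b uU'; have := sumle _ _ bb.
  have nx := rnorm_ge0 x => t1 t2.
  have t3 : (\sum_i cabs (b 0 i)) * U <= n%:R * (d * C * rnorm x) * U.
    by rewrite ler_wpM2r//; lra.
  have t4 : d * M * rnorm x <= e * rnorm x by rewrite ler_wpM2r.
  have t5 : 0 <= n%:R * (d * C * rnorm x) * U.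
    by rewrite !mulr_ge0 ?(ltW d0)//; lra.
  by move: t4; rewrite /M; lra.
have [y Ay xy] := A2 _ Ax.
have hG' i l : cabs ((\matrix_(i, l) w s (u' s i) (v' s l)) i l - (i == l)%:R) <= h.
  by rewrite mxE.
have [c cG cb] := gram_solve hG' hn (\row_i w s y (v' s i)).
have bb i : cabs ((\row_i w s y (v' s i)) 0 i) <= d * C * rnorm x.
  have [+ _] := est x y i xy; rewrite mxE (xV (v i)) ?subr0//.
  by rewrite V0E; exact: span_mem.
exists (y - comb (u' s) c).
  split; last by apply: linB => //; exact: lin_comb.
  rewrite VEs; apply: (orth_span wss) => l.
  rewrite (skewBl wss) (skew_combl wss); have /rowP/(_ l) := cG.
  rewrite !mxE => <-; apply/eqP; rewrite subr_eq0; apply/eqP.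
  by apply: eq_bigr => i _; rewrite mxE.
have -> : x - (y - comb (u' s) c) = (x - y) + comb (u' s) c by rewrite opprB addrA addrAC.
apply: (le_trans (rnormD _ _)).
have := rnorm_comb c ub; have := sumle _ _ bb.
have nx := rnorm_ge0 x => t1 t2.
have t3 : (\sum_i cabs (c 0 i)) * U <= 2 * (n%:R * (d * C * rnorm x)) * U.
  by rewrite ler_wpM2r//; lra.
have t4 : d * M * rnorm x <= e * rnorm x by rewrite ler_wpM2r.
by move: t4; rewrite /M; lra.
Unshelve. all: end_near. Qed.

End Filters.
End FormConvergence.

(** * Paths of Lagrangian subspaces *)

Section Families.
Variables (R : realType) (X : completeNormedModType R[i]).
Implicit Types (x y : X) (A B : set X) (e : R) (D : set R).

Record lagr_family D (w : R -> X -> X -> R[i]) (la mu : R -> set X) : Prop :=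
  LagrFamily {
    lf_skew : forall s, D s -> skew (w s);
    lf_nondeg : forall s, D s -> forall x, (forall y, w s x y = 0) -> x = 0;
    lf_bdd : forall s, D s -> exists2 K, 0 <= K & wbd K (w s);
    lf_fcv : forall s, D s -> fcv (within D (nbhs s)) w (w s);
    lf_la : path_on D la;
    lf_mu : path_on D mu;
    lf_lla : forall s, D s -> lagr (w s) (la s);
    lf_lmu : forall s, D s -> lagr (w s) (mu s);
    lf_cap : forall s, D s -> exists z, has_dim (la s `&` mu s) z }.

Lemma withinD D (s0 : R) : \forall s \near within D (nbhs s0), D s.
Proof. exact: withinT. Qed.

Lemma within_finer D D' (s0 : R) : D' `<=` D -> within D' (nbhs s0) `=>` within D (nbhs s0).
Proof. by move=> DD P; rewrite /within /=; apply: filterS => s h /DD; exact: h. Qed.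

Lemma gcv_finer (F G : set_system R) (M : R -> set X) M0 : F `=>` G -> gcv G M M0 -> gcv F M M0.
Proof. by move=> FG h e /h; exact: FG. Qed.

Lemma path_on_sub D D' (M : R -> set X) : D' `<=` D -> path_on D M -> path_on D' M.
Proof.
move=> DD h; apply: gcv_path_on => [s /DD Ds|s /DD Ds|s D's].
- by case: h => + _ => /(_ _ Ds)[].
- by case: h => + _ => /(_ _ Ds)[].
- have [_ c] := path_on_gcv h (DD _ D's).
  exact: gcv_finer (within_finer DD) c.
Qed.

Lemma path_lin D (M : R -> set X) s : path_on D M -> D s -> subspace_of_space (M s).
Proof. by case=> + _ => h /h[]. Qed.

Lemma path_closed D (M : R -> set X) s : path_on D M -> D s -> closed (M s).
Proof. by case=> + _ => h /h[]. Qed.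

Lemma lagr_family_sub D D' w la mu : D' `<=` D ->
  lagr_family D w la mu -> lagr_family D' w la mu.
Proof.
move=> DD [h1 h2 h3 h4 h5 h6 h7 h8 h9]; split.
- by move=> s /DD; exact: h1.
- by move=> s /DD; exact: h2.
- by move=> s /DD; exact: h3.
- move=> s /DD Ds e /(h4 _ Ds); exact: within_finer.
- exact: path_on_sub h5.
- exact: path_on_sub h6.
- by move=> s /DD; exact: h7.
- by move=> s /DD; exact: h8.
- by move=> s /DD; exact: h9.
Qed.

Section Fam.
Variables (D : set R) (w : R -> X -> X -> R[i]) (la mu : R -> set X).
Hypothesis fam : lagr_family D w la mu.

Lemma orth_cap_gcv (V A : R -> set X) s0 n : D s0 -> path_on D V -> path_on D A ->
  lagr (w s0) (A s0) -> V s0 `&` A s0 = [set 0] -> has_dim (V s0) n ->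
  gcv (within D (nbhs s0)) (fun s => orth (w s) (V s) `&` A s)
    (orth (w s0) (V s0) `&` A s0) /\
  \forall s \near within D (nbhs s0), has_dim (V s) n.
Proof.
move=> Ds0 pV pA lA VA dV; have [Vl Vc] := path_on_gcv pV Ds0.
have [Al Ac] := path_on_gcv pA Ds0; have lV := path_lin pV Ds0.
have ws := lf_skew fam Ds0; have [K K0 wb] := lf_bdd fam Ds0.
have /(qdimP _ _ lV)[v vb] := dV; have [vV v0 vs] := vb.
have [c|u [Au uv]] := dual_family ws (v := v) lA.
  by move=> Ac'; apply: v0; apply: (capset0_eq VA) => //; exact: lin_comb.
have VE : V s0 = span v by exact: spanE.
have [v' v'c v'b] := gcv_basis (within_filter D (nbhs_filter s0)) ws K0 wb Vl Vc uv VE.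
split; last first.
  apply: filterS2 v'b Vl => s b [lVs _]; apply/(qdimP _ _ lVs).
  by exists (v' s).
apply: (gcv_orth_cap _ ws K0 wb (lf_fcv fam Ds0) _ Al Ac (path_lin pA Ds0) Au uv VE v'c).
  by apply: filterS (withinD D s0) => s Ds; exact: (lf_skew fam Ds).
by apply: filterS2 v'b Vl => s b [lVs _]; exact: spanE.
Qed.

Section Compl.
Variables (V : R -> set X) (n : nat).
Hypothesis pV : path_on D V.

Local Notation la0 := (fun s => la s `&` sumset (V s) (mu s)).
Local Notation la1 := (fun s => orth (w s) (V s) `&` la s).
Local Notation mu0 := (fun s => mu s `&` sumset (V s) (la s)).
Local Notation mu1 := (fun s => orth (w s) (V s) `&` mu s).
Local Notation X0 := (fun s => sumset (V s) (la s) `&` sumset (V s) (mu s)).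
Local Notation X1 := (fun s => sumset (la1 s) (mu1 s)).

Lemma finite_dim_bsum A B k : subspace_of_space A -> has_dim A k ->
  subspace_of_space B -> closed B -> A `&` B = [set 0] ->
  exists K, [/\ 0 <= K, bsum K A B & closed (sumset A B)].
Proof.
move=> lA /(qdimP _ _ lA)[v vb] lB cB AB; have [vA v0 _] := vb.
rewrite (spanE lA vb); apply: finite_dim_sum => // c Bc.
by apply: v0; apply: (capset0_eq AB) => //; exact: lin_comb.
Qed.

Section At.
Variable s0 : R.
Hypotheses (Ds0 : D s0) (tr : complemented (w s0) (la s0) (mu s0) (V s0) n).

Local Notation F := (within D (nbhs s0)).
Let FF : Filter F := within_filter D (nbhs_filter s0).

Lemma at_orth_closed A : closed (orth (w s0) A).
Proof.
have [K K0 wb] := lf_bdd fam Ds0.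
exact: (orth_closed (lf_skew fam Ds0) (K := K)).
Qed.

Lemma at_la1_closed : closed (la1 s0).
Proof. by apply: closedI; [exact: at_orth_closed|exact: path_closed (lf_la fam) Ds0]. Qed.

Lemma at_mu1_closed : closed (mu1 s0).
Proof. by apply: closedI; [exact: at_orth_closed|exact: path_closed (lf_mu fam) Ds0]. Qed.

Lemma at_la1_lin : subspace_of_space (la1 s0).
Proof. by apply: linI; [exact: orth_lin (lf_skew fam Ds0) _|exact: path_lin (lf_la fam) Ds0]. Qed.

Lemma at_mu1_lin : subspace_of_space (mu1 s0).
Proof. by apply: linI; [exact: orth_lin (lf_skew fam Ds0) _|exact: path_lin (lf_mu fam) Ds0]. Qed.

Lemma la1_gcv : gcv F la1 (la1 s0).
Proof.
by have [] := orth_cap_gcv Ds0 pV (lf_la fam) (tr_la tr) (tr_cap tr) (tr_dim tr).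
Qed.

Lemma mu1_gcv : gcv F mu1 (mu1 s0).
Proof.
by have [] := orth_cap_gcv Ds0 pV (lf_mu fam) (tr_mu tr) (Vmu_cap tr) (tr_dim tr).
Qed.

Lemma orth_cap_lincl (A : R -> set X) : path_on D A -> lincl F (fun s => orth (w s) (V s) `&` A s).
Proof.
move=> pA; apply: filterS (withinD D s0) => s Ds; have [K K0 wb] := lf_bdd fam Ds.
split; first by apply: linI; [exact: orth_lin (lf_skew fam Ds) _|exact: path_lin pA Ds].
apply: closedI; last exact: path_closed pA Ds.
exact: (orth_closed (lf_skew fam Ds) (K := K)).
Qed.

Lemma sumset_V_gcv (A : R -> set X) : path_on D A -> V s0 `&` A s0 = [set 0] ->
  exists K, [/\ 0 <= K, bsum K (V s0) (A s0), closed (sumset (V s0) (A s0)),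
    gcv F (fun s => sumset (V s) (A s)) (sumset (V s0) (A s0)) &
    lincl F (fun s => sumset (V s) (A s))].
Proof.
move=> pA VA; have [Vl Vc] := path_on_gcv pV Ds0; have [Al Ac] := path_on_gcv pA Ds0.
have [K [K0 bK cK]] := finite_dim_bsum (tr_lin tr) (tr_dim tr) (path_lin pA Ds0)
  (path_closed pA Ds0) VA.
exists K; split=> //; first exact: (gcv_sumset FF K0 bK Vc Ac).
apply: filterS3 Vl Al (gcv_bsum FF K0 Vc Ac bK) => s [lV cV] [lA cA] b.
split; first exact: sumset_lin.
by apply: (sumset_closed lV lA cV cA _ b); rewrite mulr_ge0.
Qed.

Lemma V_la_cap_near : \forall s \near F, V s `&` la s = [set 0].
Proof.
have [Vl Vc] := path_on_gcv pV Ds0; have [Al Ac] := path_on_gcv (lf_la fam) Ds0.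
have [K [K0 bK _ _ _]] := sumset_V_gcv (lf_la fam) (tr_cap tr).
apply: filterS3 Vl Al (gcv_bsum FF K0 Vc Ac bK) => s [lV _] [lA _].
exact: bsum_cap0.
Qed.

Lemma at_V_la1_cap : V s0 `&` la1 s0 = [set 0].
Proof.
apply: capset0; [exact: tr_lin tr|exact: at_la1_lin|].
by move=> x Vx [_ lax]; exact: (capset0_eq (tr_cap tr)).
Qed.

Lemma complemented_near : \forall s \near F, complemented (w s) (la s) (mu s) (V s) n.
Proof.
have [Vl Vc] := path_on_gcv pV Ds0; have [Ml Mc] := path_on_gcv (lf_mu fam) Ds0.
have [_ dim] := orth_cap_gcv Ds0 pV (lf_la fam) (tr_la tr) (tr_cap tr) (tr_dim tr).
have [K [K0 bK cK]] := finite_dim_bsum (tr_lin tr) (tr_dim tr) at_la1_lin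
  at_la1_closed at_V_la1_cap.
have l1 := orth_cap_lincl (lf_la fam).
have Wc := gcv_sumset FF K0 bK Vc la1_gcv.
have Wl : lincl F (fun s => sumset (V s) (la1 s)).
  apply: filterS3 Vl l1 (gcv_bsum FF K0 Vc la1_gcv bK) => s [lV cV] [lA cA] b.
  split; first exact: sumset_lin.
  by apply: (sumset_closed lV lA cV cA _ b); rewrite mulr_ge0.
have lW0 : subspace_of_space (sumset (V s0) (la1 s0)).
  by apply: sumset_lin; [exact: tr_lin tr|exact: at_la1_lin].
have lM0 := path_lin (lf_mu fam) Ds0.
have [K' K'0 bK'] := open_mapping lW0 lM0 cK (path_closed (lf_mu fam) Ds0) (tr_top tr) (tr_dir tr).
have dirn := gcv_direct FF K'0 Wl Ml Wc Mc bK' (tr_top tr).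
have capn := V_la_cap_near.
have Dn := withinD D s0.
near=> s.
have Ds : D s by near: s.
have [//|bs ts] := near dirn s; have [//|lV _] := near Vl s.
have [//|lW _] := near Wl s; have [//|lM _] := near Ml s.
split=> //; [exact: (lf_skew fam Ds)|exact: (lf_nondeg fam Ds)|exact: (lf_lla fam Ds)|exact: (lf_lmu fam Ds)|..].
- by near: s.
- by near: s.
- exact: (bsum_cap0 lW lM bs).
Unshelve. all: end_near. Qed.

Lemma X_la1_split : sumset (la1 s0) (sumset (V s0) (mu s0)) = setT /\
  la1 s0 `&` sumset (V s0) (mu s0) = [set 0].
Proof.
split; first by rewrite sumsetA [sumset (la1 s0) _]sumsetC (tr_top tr).
have lVm := sumset_lin (tr_lin tr) (tr_mu tr).1.
apply: capset0 => //; first exact: at_la1_lin.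
move=> x la1x Vmx; apply: (capset0_eq (la_split tr).2) => //.
by split=> //; case: la1x.
Qed.

Lemma X_mu1_split : sumset (mu1 s0) (sumset (V s0) (la s0)) = setT /\
  mu1 s0 `&` sumset (V s0) (la s0) = [set 0].
Proof.
have lVl := sumset_lin (tr_lin tr) (tr_la tr).1.
split; last first.
  apply: capset0 => //; first exact: at_mu1_lin.
  move=> x mu1x Vlx; apply: (capset0_eq (mu_split tr).2) => //.
  by split=> //; case: mu1x.
have lT := sumset_lin at_mu1_lin lVl.
apply/seteqP; split=> // x _.
have : sumset (sumset (V s0) (la1 s0)) (mu s0) x by rewrite (tr_top tr).
apply: sumset_sub => //.
  by apply: subset_trans (sumset_r at_mu1_lin); apply: sumsetS.
move=> y; rewrite {1}(mu_split tr).1; apply: sumset_sub => //.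
  by move=> z [_ ?]; exact: (sumset_r at_mu1_lin).
exact: sumset_l.
Qed.

(** An instance of [gcv_cap]: la1 lies in [la] and is complementary to V + mu. *)
Lemma la0_gcv : gcv F la0 (la0 s0) /\ closed (la0 s0).
Proof.
have [K [K0 bK cK gK lK]] := sumset_V_gcv (lf_mu fam) (Vmu_cap tr).
have [Al Ac] := path_on_gcv (lf_la fam) Ds0.
have lVm := sumset_lin (tr_lin tr) (tr_mu tr).1.
have [t c] := X_la1_split.
have [K' K'0 bK'] := open_mapping at_la1_lin lVm at_la1_closed cK t c.
split; last by apply: closedI => //; exact: path_closed (lf_la fam) Ds0.
apply: (gcv_cap FF K'0 (orth_cap_lincl (lf_la fam)) lK Al at_la1_lin lVm (tr_la tr).1
  la1_gcv gK Ac bK' t); last by move=> x [].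
by apply: nearW => s x [].
Qed.

Lemma mu0_gcv : gcv F mu0 (mu0 s0) /\ closed (mu0 s0).
Proof.
have [K [K0 bK cK gK lK]] := sumset_V_gcv (lf_la fam) (tr_cap tr).
have [Al Ac] := path_on_gcv (lf_mu fam) Ds0.
have lVm := sumset_lin (tr_lin tr) (tr_la tr).1.
have [t c] := X_mu1_split.
have [K' K'0 bK'] := open_mapping at_mu1_lin lVm at_mu1_closed cK t c.
split; last by apply: closedI => //; exact: path_closed (lf_mu fam) Ds0.
apply: (gcv_cap FF K'0 (orth_cap_lincl (lf_mu fam)) lK Al at_mu1_lin lVm (tr_mu tr).1
  mu1_gcv gK Ac bK' t); last by move=> x [].
by apply: nearW => s x [].
Qed.

Lemma X1_closed_bsum : exists K, [/\ 0 <= K, bsum K (la1 s0) (mu1 s0) & closed (X1 s0)].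
Proof.
have [K [K0 bK cK gK lK]] := sumset_V_gcv (lf_mu fam) (Vmu_cap tr).
have lVm := sumset_lin (tr_lin tr) (tr_mu tr).1.
have [t c] := X_la1_split.
have [K' K'0 bK'] := open_mapping at_la1_lin lVm at_la1_closed cK t c.
have b : bsum K' (la1 s0) (mu1 s0).
  apply: bsumS bK' => // x [_ mux]; apply: sumset_r => //; exact: tr_lin tr.
exists K'; split=> //.
exact: (sumset_closed at_la1_lin at_mu1_lin at_la1_closed at_mu1_closed K'0 b).
Qed.

Lemma X1_gcv : gcv F X1 (X1 s0).
Proof.
have [K [K0 bK _]] := X1_closed_bsum.
exact: (gcv_sumset FF K0 bK la1_gcv mu1_gcv).
Qed.

Lemma X0_closed : closed (X0 s0).
Proof.
have [K [_ _ c1 _ _]] := sumset_V_gcv (lf_la fam) (tr_cap tr).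
have [K' [_ _ c2 _ _]] := sumset_V_gcv (lf_mu fam) (Vmu_cap tr).
exact: closedI.
Qed.

(** The intersection that defines X0 is exchanged for the direct sum V (+) la0, to which
    [gcv_sumset] applies. *)
Lemma X0_gcv : gcv F X0 (X0 s0).
Proof.
have [_ Vc] := path_on_gcv pV Ds0; have [l0c cl] := la0_gcv.
have ll0 : subspace_of_space (la0 s0).
  by apply: linI; [exact: (tr_la tr).1|exact: sumset_lin (tr_lin tr) (tr_mu tr).1].
have [K [K0 bK _]] := finite_dim_bsum (tr_lin tr) (tr_dim tr) ll0 cl (X0_split_la tr).2.
have h := gcv_sumset FF K0 bK Vc l0c.
move=> e /h; apply: filterS2 complemented_near => s trs.
by rewrite (X0_split_la tr).1 (X0_split_la trs).1.
Qed.

End At.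

Hypothesis tr : forall s, D s -> complemented (w s) (la s) (mu s) (V s) n.

Lemma la0_path : path_on D la0.
Proof.
apply: gcv_path_on => s Ds.
- by apply: linI; [exact: (tr_la (tr Ds)).1|exact: sumset_lin (tr_lin (tr Ds)) (tr_mu (tr Ds)).1].
- by have [] := la0_gcv Ds (tr Ds).
- by have [] := la0_gcv Ds (tr Ds).
Qed.

Lemma mu0_path : path_on D mu0.
Proof.
apply: gcv_path_on => s Ds.
- by apply: linI; [exact: (tr_mu (tr Ds)).1|exact: sumset_lin (tr_lin (tr Ds)) (tr_la (tr Ds)).1].
- by have [] := mu0_gcv Ds (tr Ds).
- by have [] := mu0_gcv Ds (tr Ds).
Qed.

Lemma la1_path : path_on D la1.
Proof.
apply: gcv_path_on => s Ds.
- exact: at_la1_lin.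
- exact: at_la1_closed.
- exact: la1_gcv (tr Ds).
Qed.

Lemma mu1_path : path_on D mu1.
Proof.
apply: gcv_path_on => s Ds.
- exact: at_mu1_lin.
- exact: at_mu1_closed.
- exact: mu1_gcv (tr Ds).
Qed.

Lemma X0_path : path_on D X0.
Proof.
apply: gcv_path_on => s Ds.
- by apply: linI; apply: sumset_lin; by [exact: tr_lin (tr Ds)|exact: (tr_la (tr Ds)).1|exact: (tr_mu (tr Ds)).1].
- exact: X0_closed (tr Ds).
- exact: X0_gcv (tr Ds).
Qed.

Lemma X1_path : path_on D X1.
Proof.
apply: gcv_path_on => s Ds.
- by apply: sumset_lin; [exact: at_la1_lin|exact: at_mu1_lin].
- by have [K []] := X1_closed_bsum Ds (tr Ds).
- exact: X1_gcv (tr Ds).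
Qed.

End Compl.

(** Index 0 makes dim V0 equal to dim (la cap mu). A vector of la cap mu that annihilates V0
    annihilates V0 + la + mu, hence is 0; as la / la1 also has dimension dim V0, la cap mu is a
    complement of la1 in [la], and X = V0 + la1 + mu follows. *)
Lemma fredholm_complemented s0 V0 : D s0 -> subspace_of_space V0 ->
  fredholm_pair (la s0) (mu s0) 0 -> is_dsum setT V0 (sumset (la s0) (mu s0)) ->
  exists n, [/\ complemented (w s0) (la s0) (mu s0) V0 n & has_dim (la s0 `&` mu s0) n].
Proof.
move=> Ds0 lV [m [k [dm dk /eqP]]]; rewrite eq_sym subr_eq0 => /eqP[mk] [top cap].
rewrite -{}mk in dk *; exists m; split=> //.
have ws := lf_skew fam Ds0; have lla := lf_lla fam Ds0; have lmu := lf_lmu fam Ds0.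
have lA := lla.1; have lM := lmu.1; have lS := sumset_lin lA lM.
have Vla : V0 `&` la s0 = [set 0].
  by apply: capset0 => // x Vx lax; apply: (capset0_eq cap) => //; exact: sumset_l.
have dV : has_dim V0 m by apply: (complement_dim (@linT _ _) lV lS top cap).
have l1 : subspace_of_space (orth (w s0) V0 `&` la s0).
  by apply: linI => //; exact: orth_lin.
have cap1 : (la s0 `&` mu s0) `&` (orth (w s0) V0 `&` la s0) = [set 0].
  apply: capset0; [exact: linI|exact: l1|move=> x [lax mux] [xV _]].
  apply: (lf_nondeg fam Ds0) => y; have : sumset V0 (sumset (la s0) (mu s0)) y by rewrite -top.
  apply: orth_sumset => //; apply: orth_sumset => // z hz; first exact: (lagr_iso lla).
  exact: (lagr_iso lmu).
have q1 := dual_qdim ws lla lV dV Vla.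
have lI := linI lA lM.
have /(qdimP _ _ lI)[e /basis_modP[eI e0 _]] := dm.
have [||_ _ sp] := @basis_mod_of_dim _ _ (la s0) (orth (w s0) V0 `&` la s0) m e lA l1 q1.
- by move=> i; case: (eI i).
- by move=> c hc; apply: e0; apply: (capset0_eq cap1) => //; exact: lin_comb.
have lW := sumset_lin lV l1.
split=> //; first exact: (lf_nondeg fam Ds0).
- apply/seteqP; split=> // x _; have lT := sumset_lin lW lM.
  have : sumset V0 (sumset (la s0) (mu s0)) x by rewrite -top.
  apply: sumset_sub => //; first by move=> y Vy; apply: sumset_l => //; exact: sumset_l.
  apply: sumset_sub => //; last exact: sumset_r.
  move=> y /sp[c hc]; rewrite -[y](subrK (comb e c)); apply: linD => //.
    by apply: sumset_l => //; exact: sumset_r.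
  by apply: sumset_r => //; apply: lin_comb => // i; case: (eI i).
- apply: capset0 => // x [v Vv [l [lV' lal] xE]] mux.
  have v0 : v = 0.
    apply: (capset0_eq cap) => //.
    have -> : v = (- l) + x by rewrite -xE addrC addrK.
    by exists (- l); [exact: linN|exists x].
  have xl : x = l by rewrite -xE v0 add0r.
  have mul : mu s0 l by rewrite -xl.
  by rewrite xl; apply: (capset0_eq cap1); split.
Qed.

End Fam.
End Families.

(** * Comparison of a chart with a reference chart *)

Section LocalIndex.
Variables (R : realType) (X : completeNormedModType R[i]).
Implicit Types (x y : X) (A B : set X) (e : R).

Lemma orth_opp (w : X -> X -> R[i]) A : orth (fun x y => - w x y) A = orth w A.
Proof.
apply/seteqP; split=> x h y Ay; first by rewrite -[w x y]opprK h ?oppr0.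
by rewrite h ?oppr0.
Qed.

Lemma lagr_opp (w : X -> X -> R[i]) A : lagr w A -> lagr (fun x y => - w x y) A.
Proof. by move=> [lA AE]; split=> //; rewrite orth_opp. Qed.

Lemma gchart_opp (w : X -> X -> R[i]) la mu L d : gchart w la mu L d ->
  gchart (fun x y => - w x y) la mu L d.
Proof. by move=> [h1 h2 h3 h4]; split=> //; exact: lagr_opp. Qed.

(* The germ at a parameter s0, filtered by F, of a chart Lr for which the form
   on [la s] vanishes at s0; [j] spans [la s] modulo [Lr s].  The forms of all
   other charts near s0 are compared with the form of [Lr]. *)
Record reference (F : set_system R) (w : R -> X -> X -> R[i]) (la mu Lr : R -> set X)
    (m : nat) : Prop := Reference {
  rf_chart : \forall s \near F, gchart (w s) (la s) (mu s) (Lr s) m;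
  rf_data : exists (x j : R -> 'I_m -> X) (U : R), 0 < U /\
   [/\ \forall s \near F, forall i, rnorm (x s i) <= U /\ rnorm (j s i) <= U,
      \forall s \near F, forall i, la s (j s i) /\ forall l, w s (j s i) (x s l) = (i == l)%:R,
      \forall s \near F, forall c, la s c -> exists g, (la s `&` Lr s) (c - comb (j s) g),
      \forall s \near F, forall i, span (x s) (j s i - mpart (Lr s) (mu s) (j s i)) &
      forall e, 0 < e -> \forall s \near F, forall i,
        rnorm (j s i - mpart (Lr s) (mu s) (j s i)) <= e] }.

Lemma reference_finer F G w la mu Lr m : F `=>` G ->
  reference G w la mu Lr m -> reference F w la mu Lr m.
Proof.
move=> FG [h1 [x [j [U [U0 [h2 h3 h4 h5 h6]]]]]]; split; first exact: FG.
exists x, j, U; split=> //; split; try exact: FG.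
by move=> e /h6; exact: FG.
Qed.

Lemma comb_opp n (x : 'I_n -> X) c : comb (fun i => - x i) c = comb x (- c).
Proof. by apply: eq_bigr => i _; rewrite mxE scalerN scaleNr. Qed.

Lemma reference_opp F w la mu Lr m : Filter F -> (\forall s \near F, skew (w s)) ->
  reference F w la mu Lr m -> reference F (fun s x y => - w s x y) la mu Lr m.
Proof.
move=> FF ws [h1 [x [j [U [U0 [h2 h3 h4 h5 h6]]]]]]; split.
  by apply: filterS h1 => s; exact: gchart_opp.
exists (fun s i => - x s i), j, U; split=> //; split=> //.
- by apply: filterS h2 => s h i; rewrite rnormN.
- apply: filterS2 ws h3 => s wss h i; have [ji jx] := h i; split=> // l.
  by rewrite (skewNr wss) opprK.
- apply: filterS h5 => s h i; have [c _ <-] := h i.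
  by exists (- c) => //; rewrite comb_opp opprK.
Qed.

Section Index.
Variables (F : set_system R) (FF : Filter F) (la mu L Lr : R -> set X) (s0 : R) (d m : nat).

Section Positive.
Variable w : R -> X -> X -> R[i].
Hypotheses (ws : \forall s \near F, skew (w s)) (ws0 : skew (w s0)).
Hypothesis wb : exists2 K, 0 <= K & wbd K (w s0).
Hypothesis wc : fcv F w (w s0).
Hypotheses (la_cl : lincl F la) (la_c : gcv F la (la s0)).
Hypothesis mu_c : gcv F mu (mu s0).
Hypotheses (la_l : \forall s \near F, lagr (w s) (la s)) (la_l0 : lagr (w s0) (la s0)).
Hypotheses (mu_l : \forall s \near F, lagr (w s) (mu s)) (mu_l0 : lagr (w s0) (mu s0)).
Hypotheses (mu_cl0 : closed (mu s0)) (L_cl0 : closed (L s0)).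
Hypothesis L_c : gcv F L (L s0).
Hypotheses (ch : \forall s \near F, gchart (w s) (la s) (mu s) (L s) d).
Hypotheses (ch0 : gchart (w s0) (la s0) (mu s0) (L s0) d).
Hypothesis rf : reference F w la mu Lr m.

Lemma mpart_vcv (x : R -> X) x0 : vcv F x x0 ->
  vcv F (fun s => mpart (L s) (mu s) (x s)) (mpart (L s0) (mu s0) x0).
Proof.
move=> xc; have [[lL0 _] cap tot _] := ch0; have lM0 := mu_l0.1.
have [K K0 bK] := open_mapping lL0 lM0 L_cl0 mu_cl0 tot cap.
have [m0 l0] := mpartP tot x0.
have xE : x0 = (x0 - mpart (L s0) (mu s0) x0) + mpart (L s0) (mu s0) x0 by rewrite subrK.
have [||_ //] := vcv_component FF (a := fun s => x s - mpart (L s) (mu s) (x s))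
  (b := fun s => mpart (L s) (mu s) (x s)) (x := x) K0 bK lL0 lM0 L_c mu_c _ l0 m0.
  apply: filterS ch => s [_ _ t _]; have [p q] := mpartP t (x s).
  by split=> //; rewrite subrK.
by rewrite -xE.
Qed.

(** Positive vectors of [L] are transported from s0 by selection, which keeps their values away from
    0. Those of the reference form are taken at s itself, without any uniform bound. *)
Lemma local_morse_pos : \forall s \near F,
  (morse_pos (la s0) (cform (w s0) (mu s0) (L s0)) +
   morse_pos (la s) (cform (w s) (mu s) (Lr s)) <=
   morse_pos (la s) (cform (w s) (mu s) (L s)))%N.
Proof.
have [K K0 wb0] := wb; have [chr [x [j [U [U0 [bd jx sj lpj lpe]]]]]] := rf.
have [[lL0 _] cap0 tot0 qd0] := ch0; have lM0 := mu_l0.1; have lA0 := la_l0.1.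
set p := morse_pos (la s0) _.
have [z0 [D0 [z0la D0p z0D]]] : exists (z0 : 'I_p -> X) (D0 : 'I_p -> R),
    [/\ forall i, la s0 (z0 i), forall i, 0 < D0 i & forall i l,
     cform (w s0) (mu s0) (L s0) (z0 i) (z0 l) = (D0 i)%:C * (i == l)%:R].
  apply: (@morse_pos_family R X (la s0) (la s0 `&` L s0) _ d) => //.
  - exact: linI.
  - exact: (cform_linear ws0 mu_l0 ch0).
  - exact: (cform_hermitian ws0 la_l0 mu_l0 ch0).
  - exact: (cform_null ws0 mu_l0 ch0).
have [kap kap0 kapD] := min_positive D0p.
have /choice[z zP] : forall i, exists z : R -> X,
    (\forall s \near F, la s (z s)) /\ vcv F z (z0 i).
  by move=> i; have [z z1 z2] := gcv_select FF la_cl la_c (z0la i); exists z.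
have [KL KL0 bL] := open_mapping lL0 lM0 L_cl0 mu_cl0 tot0 cap0.
have bLs := gcv_bsum FF KL0 L_c mu_c bL.
pose Z := 1 + \sum_i rnorm (z0 i).
have zZ : \forall s \near F, forall i, rnorm (z i s) <= Z.
  apply: near_ord => i; have := vcv_le FF (zP i).2; apply: filterS => s h.
  apply: le_trans h _; rewrite addrC lerD2l (bigD1 i) //= lerDl sumr_ge0 // => l _.
  exact: rnorm_ge0.
have Z0 : 0 <= Z by rewrite addr_ge0 // sumr_ge0 // => l _; exact: rnorm_ge0.
have wbs := fcv_wbd FF wb0 wc.
pose K' := K + 1; pose KL' := 2 * KL.
have K'0 : 0 <= K' by rewrite addr_ge0.
have KL'0 : 0 <= KL' by rewrite mulr_ge0.
pose C1 := 2 * K' * Z * KL' * U.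
pose t := m%:R * (4 * p.+1%:R * C1 ^+ 2 / kap + 4 * K' * KL' * U ^+ 2).
have t0 : 0 <= t.
  apply: mulr_ge0 => //; apply: addr_ge0.
    by rewrite divr_ge0 ?(ltW kap0) // mulr_ge0 ?sqr_ge0.
  by rewrite mulr_ge0 ?sqr_ge0 // mulr_ge0 // mulr_ge0.
pose H := K' * U * m%:R.
have H0 : 0 <= H by rewrite !mulr_ge0 // ltW.
(* The three entries secure, in order, the hypotheses [et], [ep] and [eK] of the local estimate; the
   added ones keep the denominators positive. *)
pose e := Num.min (U / (t + 1)) (Num.min (kap / (4 * (p%:R + 1))) (1 / (t * H + 1))).
have p0 : (0 : R) <= p%:R by [].
have tH0 : 0 <= t * H by rewrite mulr_ge0.
have e0 : 0 < e.
  by rewrite !lt_min !divr_gt0 ?mulr_gt0 ?ltr_wpDl.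
have e1 : e * (t + 1) <= U by rewrite -ler_pdivlMr ?ltr_wpDl // /e ge_min lexx.
have e2 : e * (4 * (p%:R + 1)) <= kap.
  by rewrite -ler_pdivlMr ?mulr_gt0 ?ltr_wpDl // /e !ge_min lexx orbT.
have e3 : e * (t * H + 1) <= 1.
  by rewrite -ler_pdivlMr ?ltr_wpDl // /e !ge_min lexx !orbT.
have zc : \forall s \near F, forall i l,
    cabs (cform (w s) (mu s) (L s) (z i s) (z l s) - (D0 i)%:C * (i == l)%:R) <= e.
  apply: near_ord => i; apply: near_ord => l; rewrite -z0D.
  exact: (scv_form FF ws0 K0 wb0 wc (mpart_vcv (zP i).2) (zP l).2 e0).
have zla : \forall s \near F, forall i, la s (z i s).
  by apply: near_ord => i; exact: (zP i).1.
have lpe' := lpe e e0.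
near=> s.
have wss : skew (w s) by near: s.
have las : lagr (w s) (la s) by near: s.
have mus : lagr (w s) (mu s) by near: s.
have cs : gchart (w s) (la s) (mu s) (L s) d by near: s.
have crs : gchart (w s) (la s) (mu s) (Lr s) m by near: s.
have [[lL _] _ _ qdl] := cs; have [[lLr _] _ _ qdr] := crs.
have [f [E [fla E0 fE]]] := morse_pos_family las.1 (linI las.1 lLr)
  (cform_linear wss mus crs) (cform_hermitian wss las mus crs) (cform_null wss mus crs) qdr.
apply: (morse_pos_ge las.1 (linI las.1 lL) (cform_linear wss mus cs)
  (cform_hermitian wss las mus cs) (cform_null wss mus cs) qdl).
have bds : forall i, rnorm (x s i) <= U /\ rnorm (j s i) <= U by near: s.
have jxs : forall i, la s (j s i) /\ forall l, w s (j s i) (x s l) = (i == l)%:R by near: s.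
have wKs : wbd K' (w s) by near: s.
have bs : bsum KL' (L s) (mu s) by near: s.
apply: (@local_definite_dim R X (w s) wss _ _ _ _ _ _ las mus cs crs p m _ K' KL' U Z kap e
  K'0 KL'0 (ltW U0) Z0 kap0 (ltW e0) wKs bs (x s) (j s) (z ^~ s) f D0 E) => //.
- by move=> i; case: (bds i).
- by move=> i; case: (bds i).
- by move=> i; case: (jxs i).
- by move=> i; case: (jxs i).
- by near: s.
- by near: s.
- by near: s.
- by near: s.
- by near: s.
- by near: s.
- by apply: le_trans e1; rewrite ler_pM2l // -/C1 -/t lerDl.
- rewrite ler_pdivlMr //; apply: le_trans e2.
  by rewrite -mulrA ler_pM2l // mulrC ler_pM2l // lerDl.
- apply: le_trans e3; rewrite -/C1 -/t -/H mulrDr mulr1.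
  by rewrite [leLHS]mulrA [leLHS]mulrC lerDl ltW.
Unshelve. all: end_near. Qed.

End Positive.

Variable w : R -> X -> X -> R[i].
Hypotheses (ws : \forall s \near F, skew (w s)) (ws0 : skew (w s0)).
Hypothesis wb : exists2 K, 0 <= K & wbd K (w s0).
Hypothesis wc : fcv F w (w s0).
Hypotheses (la_cl : lincl F la) (la_c : gcv F la (la s0)).
Hypothesis mu_c : gcv F mu (mu s0).
Hypotheses (la_l : \forall s \near F, lagr (w s) (la s)) (la_l0 : lagr (w s0) (la s0)).
Hypotheses (mu_l : \forall s \near F, lagr (w s) (mu s)) (mu_l0 : lagr (w s0) (mu s0)).
Hypotheses (mu_cl0 : closed (mu s0)) (L_cl0 : closed (L s0)).
Hypothesis L_c : gcv F L (L s0).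
Hypotheses (ch : \forall s \near F, gchart (w s) (la s) (mu s) (L s) d).
Hypotheses (ch0 : gchart (w s0) (la s0) (mu s0) (L s0) d).
Hypothesis rf : reference F w la mu Lr m.
Hypothesis cap : \forall s \near F, exists z, has_dim (la s `&` mu s) z.
Hypothesis cap0 : has_dim (la s0 `&` mu s0) m.

Lemma local_morse_neg : \forall s \near F,
  (morse_neg (la s0) (cform (w s0) (mu s0) (L s0)) +
   morse_neg (la s) (cform (w s) (mu s) (Lr s)) <=
   morse_neg (la s) (cform (w s) (mu s) (L s)))%N.
Proof.
apply: (@local_morse_pos (fun s x y => - w s x y)) => //.
- by apply: filterS ws => s; exact: skew_opp.
- exact: skew_opp.
- by have [K K0 wK] := wb; exists K => // x y; rewrite cabsN.
- by move=> e /wc; apply: filterS => s h x y; rewrite -opprD cabsN.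
- by apply: filterS la_l => s; exact: lagr_opp.
- exact: lagr_opp.
- by apply: filterS mu_l => s; exact: lagr_opp.
- exact: lagr_opp.
- by apply: filterS ch => s; exact: gchart_opp.
- exact: gchart_opp.
- exact: reference_opp.
Qed.

(** The reference form lives on a quotient of dimension [m], exactly the nullity at s0. Counting for
    the chart at s0, the chart at s and the reference at s shows that both sides have the same total
    m^+ + m^-, so neither inequality can be strict. *)
Lemma local_morse : \forall s \near F,
  morse_pos (la s) (cform (w s) (mu s) (L s)) =
    (morse_pos (la s0) (cform (w s0) (mu s0) (L s0)) +
     morse_pos (la s) (cform (w s) (mu s) (Lr s)))%N /\
  morse_neg (la s) (cform (w s) (mu s) (L s)) =
    (morse_neg (la s0) (cform (w s0) (mu s0) (L s0)) +
     morse_neg (la s) (cform (w s) (mu s) (Lr s)))%N.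
Proof.
have count0 := chart_count ws0 la_l0 mu_l0 ch0 cap0.
have pos := local_morse_pos ws ws0 wb wc la_cl la_c mu_c la_l la_l0 mu_l mu_l0
  mu_cl0 L_cl0 L_c ch ch0 rf.
have neg := local_morse_neg; have [chr _] := rf.
near=> s.
have [z capz] : exists z, has_dim (la s `&` mu s) z by near: s.
have wss : skew (w s) by near: s.
have las : lagr (w s) (la s) by near: s.
have mus : lagr (w s) (mu s) by near: s.
have cs : gchart (w s) (la s) (mu s) (L s) d by near: s.
have crs : gchart (w s) (la s) (mu s) (Lr s) m by near: s.
have count := chart_count wss las mus cs capz.
have countr := chart_count wss las mus crs capz.
have ps : (morse_pos (la s0) (cform (w s0) (mu s0) (L s0)) +
  morse_pos (la s) (cform (w s) (mu s) (Lr s)) <=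
  morse_pos (la s) (cform (w s) (mu s) (L s)))%N by near: s.
have ns : (morse_neg (la s0) (cform (w s0) (mu s0) (L s0)) +
  morse_neg (la s) (cform (w s) (mu s) (Lr s)) <=
  morse_neg (la s) (cform (w s) (mu s) (L s)))%N by near: s.
lia.
Unshelve. all: end_near. Qed.

End Index.
End LocalIndex.

(** * Existence of charts *)

Section LagrangianFrames.
Variables (R : realType) (X : completeNormedModType R[i]).
Implicit Types (x y : X) (A B : set X) (e : R).

Section Pointwise.
Variables (w : X -> X -> R[i]) (la mu V : set X) (n : nat).
Hypothesis tr : complemented w la mu V n.
Variables (v : 'I_n -> X).
Hypothesis vb : basis_mod V [set 0] v.

Local Notation la0 := (la `&` sumset V mu).
Local Notation la1 := (orth w V `&` la).
Local Notation mu0 := (mu `&` sumset V la).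
Local Notation X0 := (sumset V la `&` sumset V mu).
Let ws := tr_skew tr.
Let la0_lin : subspace_of_space la0.
Proof. by apply: linI; [exact: (tr_la tr).1|exact: sumset_lin (tr_lin tr) (tr_mu tr).1]. Qed.
Let mu0_lin : subspace_of_space mu0.
Proof. by apply: linI; [exact: (tr_mu tr).1|exact: sumset_lin (tr_lin tr) (tr_la tr).1]. Qed.

(** The la1-components of a dual family in [la] pair to zero with [V] and may be dropped. *)
Lemma dual_la0 : exists j : 'I_n -> X,
  (forall i, la0 (j i)) /\ forall i k, w (j i) (v k) = (i == k)%:R.
Proof.
have [vV v0 _] := vb.
have [c lac|u [lau uv]] := dual_family ws (v := v) (tr_la tr).
  by apply: v0; apply: (capset0_eq (tr_cap tr)) => //; exact: lin_comb (tr_lin tr) _.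
have /choice[j jP] i : exists j, la0 j /\ la1 (u i - j).
  have : sumset la0 la1 (u i) by rewrite -(la_split tr).1.
  by case=> j lj [l ll <-]; exists j; rewrite addrC addKr.
exists j; split=> [i|i k]; first by case: (jP i).
have [_ la1u] := jP i; have o := la1u.1.
by rewrite -uv -[in RHS](subrK (j i) (u i)) (skewDl ws) (o _ (vV k)) add0r.
Qed.

Variable j : 'I_n -> X.
Hypotheses (jla : forall i, la0 (j i)) (jv : forall i k, w (j i) (v k) = (i == k)%:R).

Lemma la0_eq0 x : la0 x -> (forall k, w x (v k) = 0) -> x = 0.
Proof.
move=> lx h; apply: (capset0_eq (la_split tr).2) => //; split; last by case: lx.
by rewrite (spanE (tr_lin tr) vb); exact: orth_span.
Qed.

Lemma la0_comb x : la0 x -> x = comb j (\row_k w x (v k)).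
Proof.
move=> lx; apply/eqP; rewrite -subr_eq0; apply/eqP; apply: la0_eq0.
  by apply: linB => //; exact: lin_comb.
by move=> k; exact: dual_project.
Qed.

(* The correction of [v i] makes the [frame0 i] isotropic; adding a real multiple
   of the dual vector [j i] keeps them so, which leaves the freedom needed in
   [frame_transversal]. *)
Definition frame0 i := v i - comb j (\row_k (2^-1 * w (v i) (v k))).
Definition frame (t : nat) i := frame0 i + t%:R *: j i.

Lemma frame_jj i k : w (j i) (j k) = 0.
Proof. by apply: (lagr_iso (tr_la tr)); case: (jla i) (jla k) => ? _ []. Qed.

Lemma frame_combj i g : w (j i) (comb j g) = 0.
Proof. by rewrite (skew_combr ws) big1 // => k _; rewrite frame_jj mulr0. Qed.

Lemma frame_vj i k : w (v i) (j k) = - (i == k)%:R.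
Proof. by rewrite (skewC ws) jv conjC_nat eq_sym. Qed.

Lemma frame_jx t i k : w (j i) (frame t k) = (i == k)%:R.
Proof.
by rewrite (skewDr ws) (skewZr ws) frame_jj mulr0 addr0 (skewBr ws) frame_combj subr0.
Qed.

(** The corrections of [v i] and of [v k] each remove half of w (v i, v k), whence the factor 2^-1;
    the term with both corrections vanishes because [la] is isotropic. *)
Lemma frame0_xx i k : w (frame0 i) (frame0 k) = 0.
Proof.
rewrite (skewBl ws) !(skewBr ws) !(skew_combl ws).
rewrite (skew_combr ws) (eq_bigr (fun l => (- Num.conj (2^-1 * w (v k) (v l))) * (l == i)%:R)); last first.
  by move=> l _; rewrite mxE frame_vj eq_sym mulrN mulNr.
rewrite sum_delta_l (eq_bigr (fun l => (2^-1 * w (v i) (v l)) * (l == k)%:R)); last first.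
  by move=> l _; rewrite mxE jv.
rewrite sum_delta_l big1 => [|l _]; last by rewrite frame_combj mulr0.
have -> : Num.conj (2^-1 * w (v k) (v i)) = - (2^-1 * w (v i) (v k)).
  by rewrite rmorphM fmorphV rmorph_nat [w (v i) _](skewC ws) mulrN opprK.
by field.
Qed.

Lemma frame_xx t i k : w (frame t i) (frame t k) = 0.
Proof.
rewrite (skewDl ws) (skewZl ws) frame_jx (skewDr ws) frame0_xx add0r (skewZr ws).
rewrite conjC_nat (skewC ws) (skewBr ws) frame_combj jv subr0 conjC_nat eq_sym.
by rewrite mulrN addNr.
Qed.

Lemma frame_X0 t i : X0 (frame t i).
Proof.
have l0 := sumset_lin (tr_lin tr) la0_lin; rewrite (X0_split_la tr).1.
have [vV _ _] := vb; apply: linD => //.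
  apply: linB => //; first by apply: sumset_l => //; exact: vV.
  by apply: sumset_r; [exact: tr_lin tr|exact: lin_comb].
by apply: linZ => //; apply: sumset_r; [exact: tr_lin tr|exact: jla].
Qed.

Lemma X0_frame t z : X0 z -> exists c g, z = comb (frame t) c + comb j g.
Proof.
have lS : subspace_of_space (sumset (span (frame t)) (span j)).
  by apply: sumset_lin; exact: span_lin.
move=> X0z; suff [_ [c _ <-] [_ [g _ <-] <-]] : sumset (span (frame t)) (span j) z by exists c, g.
have jS : span j `<=` sumset (span (frame t)) (span j).
  by apply: sumset_r; exact: span_lin.
move: X0z; rewrite (X0_split_la tr).1; apply: sumset_sub => //; last first.
  by move=> l /la0_comb ->; apply: jS; eexists.
rewrite (spanE (tr_lin tr) vb); apply: span_sub => // i.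
have -> : v i = frame t i + comb j (\row_k (2^-1 * w (v i) (v k))) - t%:R *: j i.
  by rewrite /frame addrAC addrK subrK.
apply: linB => //; last by apply: linZ => //; apply: jS; exact: span_mem.
apply: linD => //; last by apply: jS; eexists.
by apply: (sumset_l (span_lin _)); exact: span_mem.
Qed.

Lemma frame_lagr t : span (frame t) = X0 `&` orth w (span (frame t)).
Proof.
apply/seteqP; split=> z.
  move=> Lz; split.
    move: Lz; apply: span_sub; last exact: frame_X0.
    by apply: linI; apply: sumset_lin; [exact: tr_lin tr|exact: (tr_la tr).1|
      exact: tr_lin tr|exact: (tr_mu tr).1].
  case: Lz => c _ <-; apply: (orth_span ws) => k.
  by rewrite (skew_combl ws) big1 // => i _; rewrite frame_xx mulr0.
case=> /(X0_frame t)[c [g ->]] o; suff -> : g = 0 by rewrite (linear0 (comb j)) addr0; exists c.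
apply/rowP => l; rewrite mxE; have := o _ (span_mem _ l).
rewrite (skewDl ws) (skew_combl ws) big1 => [|i _]; last by rewrite frame_xx mulr0.
rewrite add0r (skew_combl ws) (eq_bigr (fun i => g 0 i * (i == l)%:R)) ?sum_delta_l //.
by move=> i _; rewrite frame_jx.
Qed.

Lemma frame_comb_eq0 t c : (forall l, w (j l) (comb (frame t) c) = 0) -> c = 0.
Proof.
move=> h; apply/rowP => l; rewrite mxE; have /eqP := h l.
rewrite (skew_combr ws) (eq_bigr (fun i => Num.conj (c 0 i) * (i == l)%:R)); last first.
  by move=> i _; rewrite frame_jx eq_sym.
by rewrite sum_delta_l conjC_eq0 => /eqP.
Qed.

Lemma frame_la0 t : span (frame t) `&` la0 = [set 0].
Proof.
apply: capset0 => //; first exact: span_lin.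
move=> _ [c _ <-] [lac _]; rewrite (frame_comb_eq0 (t := t) (c := c)) ?(linear0 (comb _)) // => l.
by apply: (lagr_iso (tr_la tr)) => //; case: (jla l).
Qed.

(* Vectors of [mu0] in the spans of indices t <> r have orthogonal coordinates,
   because w vanishes on [mu0]; hence at most n of the spans meet [mu0]. *)
Lemma frame_transversal : exists t, span (frame t) `&` mu0 = [set 0].
Proof.
apply: contrapT => H.
have /choice[c cP] (t : 'I_n.+1) : exists c : 'rV[R[i]]_n, c != 0 /\ mu0 (comb (frame t) c).
  apply: contrapT => K; apply: H; exists t; apply: capset0; [exact: span_lin|exact: mu0_lin|].
  move=> _ [c _ <-] mc; have [->|c0] := eqVneq c 0; first by rewrite (linear0 (comb _)).
  by case: K; exists c.
pose dot (a b : 'rV[R[i]]_n) := \sum_i a 0 i * Num.conj (b 0 i).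
have jx (s t : nat) a b : w (comb (frame s) a) (comb (frame t) b) = (s%:R - t%:R) * dot a b.
  have fE r : comb (frame r) =1 fun c => comb frame0 c + r%:R *: comb j c.
    move=> c'; rewrite scaler_sumr -big_split; apply: eq_bigr => i _ /=.
    by rewrite scalerDr !scalerA mulrC.
  have j0 i k : w (j i) (frame0 k) = (i == k)%:R by rewrite -(frame_jx 0) /frame scale0r addr0.
  have y0 i k : w (frame0 i) (j k) = - (i == k)%:R by rewrite (skewC ws) j0 conjC_nat eq_sym.
  have cjj : w (comb j a) (comb j b) = 0.
    by rewrite (skew_combl ws) big1 // => i _; rewrite frame_combj mulr0.
  have cyy : w (comb frame0 a) (comb frame0 b) = 0.
    rewrite (skew_combl ws) big1 // => i _; rewrite (skew_combr ws) big1 ?mulr0 // => k _.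
    by rewrite frame0_xx mulr0.
  have cjy : w (comb j a) (comb frame0 b) = dot a b.
    rewrite (skew_combl ws); apply: eq_bigr => i _; congr (_ * _).
    rewrite (skew_combr ws) (eq_bigr (fun k => Num.conj (b 0 k) * (k == i)%:R)).
      by rewrite sum_delta_l.
    by move=> k _; rewrite j0 eq_sym.
  have cyj : w (comb frame0 a) (comb j b) = - dot a b.
    rewrite (skew_combl ws) -sumrN; apply: eq_bigr => i _; rewrite -mulrN; congr (_ * _).
    rewrite (skew_combr ws) (eq_bigr (fun k => (- Num.conj (b 0 k)) * (k == i)%:R)).
      by rewrite sum_delta_l.
    by move=> k _; rewrite y0 eq_sym mulrN mulNr.
  rewrite !fE (skewDl ws) !(skewDr ws) !(skewZl ws) !(skewZr ws) cjj cyy cjy cyj conjC_nat.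
  by ring.
have orto (s t : 'I_n.+1) : s != t -> dot (c s) (c t) = 0.
  move=> st; have /eqP := jx s t (c s) (c t).
  rewrite (lagr_iso (tr_mu tr)); [|by case: (cP s) => _ []|by case: (cP t) => _ []].
  rewrite eq_sym mulf_eq0 subr_eq0 eqr_nat => /orP[/eqP st'|/eqP //].
  by move/negP: st => []; apply/eqP/val_inj.
have dot_gt0 (t : 'I_n.+1) : dot (c t) (c t) != 0.
  apply/negP => /eqP/psumr_eq0P h; have [/negP ct0 _] := cP t; apply: ct0.
  apply/eqP/rowP => i; rewrite mxE; have /eqP := h (fun k _ => mul_conjC_ge0 _) i isT.
  by rewrite mul_conjC_eq0 => /eqP.
have [b b0 bH] := kernel_row (\matrix_(t < n.+1) c t) (ltnSn n).
case/negP: b0; apply/eqP/rowP => r; rewrite mxE.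
have : dot (b *m \matrix_(t < n.+1) c t) (c r) = 0.
  by rewrite bH /dot big1 // => i _; rewrite mxE mul0r.
have -> : dot (b *m \matrix_(t < n.+1) c t) (c r) = \sum_t b 0 t * dot (c t) (c r).
  rewrite /dot; under eq_bigr do rewrite mxE mulr_suml.
  rewrite exchange_big; apply: eq_bigr => t _; rewrite mulr_sumr; apply: eq_bigr => i _.
  by rewrite mxE mulrA.
rewrite (bigD1 r) //= big1 ?addr0 => [/eqP|t tr']; last by rewrite orto ?mulr0.
by rewrite mulf_eq0 (negPf (dot_gt0 r)) orbF => /eqP.
Qed.

Lemma la_frame c : la c -> exists g, la1 (c - comb j g).
Proof.
rewrite {1}(la_split tr).1 => -[l /la0_comb -> [k kl <-]].
by exists (\row_k w l (v k)); rewrite addrAC subrr add0r.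
Qed.

Lemma frame_lpart t i : span (frame t) `&` mu0 = [set 0] ->
  span (frame t) (j i - mpart (sumset (span (frame t)) la1) mu (j i)).
Proof.
move=> Lmu; have lL := span_lin (frame t).
have ch := inner_chart tr lL (frame_lagr t) (frame_la0 t) Lmu.
have lW := (chart_lagr ch).1; have lM := (tr_mu tr).1.
have [_ jX] := jla i.
have : sumset (span (frame t)) mu (j i).
  move: jX; apply: sumset_sub; [exact: sumset_lin| |exact: sumset_r].
  exact: (inner_mu_tot tr lL (frame_lagr t) Lmu).
case=> l Ll [m mm jE].
have la1L : subspace_of_space la1 by apply: linI; [exact: orth_lin|exact: (tr_la tr).1].
have LmE : sumset (span (frame t)) la1 (j i - m) by rewrite -jE addrK; exact: sumset_l.
by rewrite (mpart_uniq lW lM (chart_cap ch) (chart_tot ch) mm LmE) -jE addrK.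
Qed.

End Pointwise.
End LagrangianFrames.

(** * Convergence of dual families and frames *)

Section FrameConvergence.
Variables (R : realType) (X : completeNormedModType R[i]).
Implicit Types (x y : X) (A B : set X) (e : R).

Section Filters.
Variables (T : Type) (F : set_system T) (FF : Filter F).

(** Selected vectors j' tending to j0 are almost dual to [v], and the defect of duality gives the
    coordinates of j' - j with respect to the exact dual family j. *)
Lemma dual_vcv (w : T -> X -> X -> R[i]) w0 (A : T -> set X) A0 n
    (v j : T -> 'I_n -> X) (v0 j0 : 'I_n -> X) K :
  skew w0 -> 0 <= K -> wbd K w0 -> fcv F w w0 -> (\forall s \near F, skew (w s)) ->
  lincl F A -> gcv F A A0 -> (forall i, A0 (j0 i)) ->
  (forall i k, w0 (j0 i) (v0 k) = (i == k)%:R) ->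
  (forall k, vcv F (v ^~ k) (v0 k)) ->
  (\forall s \near F, [/\ forall i, A s (j s i),
    forall i k, w s (j s i) (v s k) = (i == k)%:R &
    forall x, A s x -> (forall k, w s x (v s k) = 0) -> x = 0]) ->
  forall i, vcv F (j ^~ i) (j0 i).
Proof.
move=> w0s K0 wb wc ws Al Ac j0A j0v vc jA.
have /choice[j' j'P] i : exists j' : T -> X, (\forall s \near F, A s (j' s)) /\ vcv F j' (j0 i).
  by have [j' a b] := gcv_select FF Al Ac (j0A i); exists j'.
pose B := \sum_i (rnorm (j0 i) + 1).
have B0 : 0 <= B by rewrite sumr_ge0 // => i _; rewrite addr_ge0 ?rnorm_ge0.
move=> i e e0.
have n0 : (0 : R) <= n%:R by [].
pose h := Num.min (1 / (2 * n%:R ^+ 2 + 1)) (e / (4 * n%:R * B + 1)).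
have h0 : 0 < h by rewrite lt_min !divr_gt0 // ltr_wpDl // !mulr_ge0 ?sqr_ge0.
have h1 : h * (2 * n%:R ^+ 2 + 1) <= 1.
  by rewrite -ler_pdivlMr ?ltr_wpDl ?mulr_ge0 ?sqr_ge0 // /h ge_min lexx.
have h2 : h * (4 * n%:R * B + 1) <= e.
  by rewrite -ler_pdivlMr ?ltr_wpDl ?mulr_ge0 // /h ge_min lexx orbT.
have jv : \forall s \near F, forall i k, cabs (w s (j' i s) (v s k) - (i == k)%:R) <= h.
  apply: near_ord => l; apply: near_ord => k; rewrite -j0v.
  exact: (scv_form FF w0s K0 wb wc (j'P l).2 (vc k) h0).
have jB : \forall s \near F, forall i, rnorm (j' i s) <= rnorm (j0 i) + 1.
  by apply: near_ord => l; exact: (vcv_le FF (j'P l).2).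
have j'A : \forall s \near F, forall i, A s (j' i s) by apply: near_ord => l; exact: (j'P l).1.
have je : \forall s \near F, rnorm (j' i s - j0 i) <= e / 2 by apply: (j'P i).2; rewrite divr_gt0.
near=> s.
have [lA _] : subspace_of_space (A s) /\ closed (A s) by near: s.
have wss : skew (w s) by near: s.
have [jsA jsv jsu] : [/\ forall i, A s (j s i),
    forall i k, w s (j s i) (v s k) = (i == k)%:R &
    forall x, A s x -> (forall k, w s x (v s k) = 0) -> x = 0] by near: s.
have jvs : forall i k, cabs (w s (j' i s) (v s k) - (i == k)%:R) <= h by near: s.
have jBs : forall i, rnorm (j' i s) <= rnorm (j0 i) + 1 by near: s.
have j'As : forall i, A s (j' i s) by near: s.
pose J := \sum_i rnorm (j s i).
have J0 : 0 <= J by rewrite sumr_ge0 // => l _; rewrite rnorm_ge0.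
have jJ l : rnorm (j s l) <= J.
  by rewrite /J (bigD1 l) //= lerDl sumr_ge0 // => k _; rewrite rnorm_ge0.
have dif l : rnorm (j' l s - j s l) <= n%:R * h * J.
  have -> : j' l s - j s l = comb (j s) (\row_k (w s (j' l s) (v s k) - (l == k)%:R)).
    have -> : (\row_k (w s (j' l s) (v s k) - (l == k)%:R)) =
        (\row_k w s (j' l s - j s l) (v s k)).
      by apply/rowP => k; rewrite !mxE (skewBl wss) jsv.
    apply/eqP; rewrite -subr_eq0; apply/eqP; apply: jsu.
      by apply: linB => //; [exact: linB|exact: lin_comb].
    by move=> k; exact: dual_project.
  apply: le_trans (rnorm_comb _ jJ) _; apply: ler_wpM2r => //.
  apply: le_trans (ler_sum _ (G := fun=> h) _) _; first by move=> k _; rewrite mxE.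
  by rewrite sumr_const card_ord mulr_natl.
(* The estimate of j' - j involves the unknown norms of j; as h n^2 <= 1 / 2, these are bounded by
   absorption. *)
have JB : J <= 2 * B.
  have : J <= B + n%:R * (n%:R * h * J).
    have -> : n%:R * (n%:R * h * J) = \sum_(l < n) (n%:R * h * J).
      by rewrite sumr_const card_ord mulr_natl.
    rewrite -big_split; apply: ler_sum => l _ /=.
    have -> : j s l = j' l s - (j' l s - j s l) by rewrite subKr.
    by apply: le_trans (rnormB _ _) _; exact: lerD.
  have : h * (2 * n%:R ^+ 2) <= 1 by nra.
  move=> hh; have := ler_wpM2r J0 hh; nra.
have -> : j s i - j0 i = (j' i s - j0 i) - (j' i s - j s i) by rewrite opprB [RHS]addrC subrKA.
apply: le_trans (rnormB _ _) _.
have e1 : rnorm (j' i s - j0 i) <= e / 2 by near: s.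
have e2 := dif i.
have : n%:R * h * J <= e / 2.
  have := ler_wpM2l (mulr_ge0 n0 (ltW h0)) JB; nra.
lra.
Unshelve. all: end_near. Qed.

(** The dual vectors [u] bound coordinates by the norm of the combination, so moving the basis
    vectors by h moves a combination by a small multiple of its norm. *)
Lemma gcv_span w0 n (x : T -> 'I_n -> X) (x0 u : 'I_n -> X) K :
  skew w0 -> 0 <= K -> wbd K w0 -> (forall i l, w0 (u i) (x0 l) = (i == l)%:R) ->
  (forall i, vcv F (x ^~ i) (x0 i)) -> gcv F (fun s => span (x s)) (span x0).
Proof.
move=> ws K0 wb ux xc e e0.
pose C := \sum_i K * rnorm (u i).
have C0 : 0 <= C by rewrite sumr_ge0 // => i _; rewrite mulr_ge0 ?rnorm_ge0.
have cC (c : 'rV[R[i]]_n) : \sum_i cabs (c 0 i) <= C * rnorm (comb x0 c).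
  rewrite mulr_suml; apply: ler_sum => i _.
  have -> : cabs (c 0 i) = cabs (w0 (u i) (comb x0 c)); last exact: wb.
  rewrite (skew_combr ws) (eq_bigr (fun l => Num.conj (c 0 l) * (l == i)%:R)).
    by rewrite sum_delta_l cabs_conj.
  by move=> l _; rewrite ux eq_sym.
pose h := Num.min (1 / (2 * C + 1)) (e / (2 * C + 1)).
have C1 : 0 < 2 * C + 1 by rewrite ltr_wpDl // mulr_ge0.
have h0 : 0 < h by rewrite lt_min !divr_gt0.
have h1 : h * (2 * C + 1) <= 1 by rewrite -ler_pdivlMr // /h ge_min lexx.
have h2 : h * (2 * C + 1) <= e by rewrite -ler_pdivlMr // /h ge_min lexx orbT.
have xh : \forall s \near F, forall i, rnorm (x s i - x0 i) <= h.
  by apply: near_ord => i; exact: xc.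
apply: filterS xh => s xh.
have dif (c : 'rV[R[i]]_n) : rnorm (comb (x s) c - comb x0 c) <= (\sum_i cabs (c 0 i)) * h.
  by rewrite -comb_funB; exact: rnorm_comb.
have n0 (c : 'rV[R[i]]_n) : 0 <= \sum_i cabs (c 0 i) by rewrite sumr_ge0 // => i _; exact: cabs_ge0.
have cC' (c : 'rV[R[i]]_n) : \sum_i cabs (c 0 i) <= 2 * C * rnorm (comb (x s) c).
  have := cC c; have := dif c; rewrite rdistC => d.
  have := rnormD (comb x0 c - comb (x s) c) (comb (x s) c); rewrite subrK => d' d''.
  have := ler_wpM2l C0 (le_trans d' (lerD d (lexx _))); have := n0 c.
  set N := \sum_i _ in d d' d'' *; move=> N0; have := rnorm_ge0 (comb (x s) c); nra.
split=> _ [c _ <-].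
  exists (comb x0 c); first by exists c.
  apply: le_trans (dif c) _; have := cC' c; have := n0 c.
  set N := \sum_i _; move=> N0; have := rnorm_ge0 (comb (x s) c); nra.
exists (comb (x s) c); first by exists c.
rewrite rdistC; apply: le_trans (dif c) _; have := cC c; have := n0 c.
set N := \sum_i _; move=> N0; have := rnorm_ge0 (comb x0 c); nra.
Qed.

Lemma vcv_frame (w : T -> X -> X -> R[i]) w0 n (v j : T -> 'I_n -> X) (v0 j0 : 'I_n -> X) K t i :
  skew w0 -> 0 <= K -> wbd K w0 -> fcv F w w0 ->
  (forall k, vcv F (v ^~ k) (v0 k)) -> (forall k, vcv F (j ^~ k) (j0 k)) ->
  vcv F (fun s => frame (w s) (v s) (j s) t i) (frame w0 v0 j0 t i).
Proof.
move=> ws K0 wb wc vc jc; apply: (vcv_add FF); last first.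
  by apply: (vcv_scale FF) => // e e0; apply: nearW => s; rewrite subrr cabs0 ltW.
apply: (vcv_add FF) => //.
have -> : - comb j0 (\row_k (2^-1 * w0 (v0 i) (v0 k))) =
    \sum_k (- (2^-1 * w0 (v0 i) (v0 k))) *: j0 k.
  by rewrite -sumrN; apply: eq_bigr => k _; rewrite mxE scaleNr.
have -> : (fun s => - comb (j s) (\row_k (2^-1 * w s (v s i) (v s k)))) =
    (fun s => \sum_k (- (2^-1 * w s (v s i) (v s k))) *: j s k).
  by apply/funext => s; rewrite -sumrN; apply: eq_bigr => k _; rewrite mxE scaleNr.
apply: (vcv_sum FF) => k; apply: (vcv_scale FF) => // e e0.
have := scv_form FF ws K0 wb wc (vc i) (vc k) e0; apply: filterS => s h.
rewrite -opprD cabsN -mulrBr cabsM; apply: le_trans h.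
have h2 : cabs (2^-1 : R[i]) <= 1.
  have -> : (2^-1 : R[i]) = (2^-1)%:C by rewrite rmorphV ?unitfE // rmorph_nat.
  by rewrite cabs_real ger0_norm // invf_le1 // ler1n.
by rewrite -[leRHS]mul1r ler_wpM2r // cabs_ge0.
Qed.

End Filters.
End FrameConvergence.

(** * Continuous Lagrangian frames *)

Section FramePaths.
Variables (R : realType) (X : completeNormedModType R[i]).
Implicit Types (x y : X) (A B : set X) (e : R) (D : set R).
Variables (D : set R) (w : R -> X -> X -> R[i]) (la mu : R -> set X).
Hypothesis fam : lagr_family D w la mu.
Variables (V : R -> set X) (n : nat).
Hypothesis pV : path_on D V.

Local Notation la0 := (fun s => la s `&` sumset (V s) (mu s)).
Local Notation la1 := (fun s => orth (w s) (V s) `&` la s).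
Local Notation mu0 := (fun s => mu s `&` sumset (V s) (la s)).
Local Notation mu1 := (fun s => orth (w s) (V s) `&` mu s).
Local Notation X0 := (fun s => sumset (V s) (la s) `&` sumset (V s) (mu s)).
Local Notation X1 := (fun s => sumset (la1 s) (mu1 s)).
Local Notation F s := (within D (nbhs (s : R))).
Let FF s : Filter (F s) := within_filter D (nbhs_filter s).

(** [gcv_basis] gives continuity at s0 only. A basis continuous at all nearby parameters is obtained
    by projecting a basis of V s0 to V s along the fixed complement la1 s0 + mu s0. *)
Lemma basis_near s0 : D s0 -> complemented (w s0) (la s0) (mu s0) (V s0) n ->
  exists v : R -> 'I_n -> X, \forall s \near F s0,
    basis_mod (V s) [set 0] (v s) /\ forall i, vcv (F s) (v ^~ i) (v s i).
Proof.
move=> Ds0 tr; have ws := lf_skew fam Ds0; have [K K0 wb] := lf_bdd fam Ds0.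
have [Vl Vc] := path_on_gcv pV Ds0; have lV := tr_lin tr; have lM := (tr_mu tr).1.
have l1 := at_la1_lin fam V Ds0.
have lB : subspace_of_space (sumset (la1 s0) (mu s0)) by exact: sumset_lin.
have lW : subspace_of_space (sumset (V s0) (la1 s0)) by exact: sumset_lin.
have [K1 [K10 bK1 cW]] := finite_dim_bsum lV (tr_dim tr) l1 (at_la1_closed fam (V := V) Ds0)
  (at_V_la1_cap fam Ds0 tr).
have cM := path_closed (lf_mu fam) Ds0.
have [K2 K20 bK2] := open_mapping lW lM cW cM (tr_top tr) (tr_dir tr).
have cB : closed (sumset (la1 s0) (mu s0)).
  apply: (sumset_closed l1 lM (at_la1_closed fam (V := V) Ds0) cM K20).
  by apply: bsumS bK2 => //; exact: sumset_r.
have VB : V s0 `&` sumset (la1 s0) (mu s0) = [set 0].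
  apply: capset0 => // x Vx [l ll [m mm lE]].
  have m0 : m = 0.
    apply: (capset0_eq (tr_dir tr)) => //.
    have -> : m = (l + m) + (- l) by rewrite addrC addKr.
    exists (l + m); first by rewrite lE.
    by exists (- l) => //; exact: linN.
  move: Vx; rewrite -lE m0 addr0 => Vl'; apply: (capset0_eq (tr_cap tr)) => //.
  by case: ll.
have VBT : sumset (V s0) (sumset (la1 s0) (mu s0)) = setT by rewrite sumsetA (tr_top tr).
have [K3 K30 bK3] := open_mapping lV lB (path_closed pV Ds0) cB VBT VB.
have Bl s : lincl (F s) (fun=> sumset (la1 s0) (mu s0)) by apply: nearW.
have Bc s := gcv_cst (FF s) (sumset (la1 s0) (mu s0)).
have dir := gcv_direct (FF s0) K30 Vl (Bl s0) Vc (Bc s0) bK3 VBT.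
have /(qdimP _ _ lV)[v0 v0b] := tr_dim tr.
have [v0V v00 _] := v0b.
have [c lac|u [lau uv]] := dual_family ws (v := v0) (tr_la tr).
  by apply: v00; apply: (capset0_eq (tr_cap tr)) => //; exact: lin_comb.
pose v s i := mpart (sumset (la1 s0) (mu s0)) (V s) (v0 i).
have vE s : sumset (V s) (sumset (la1 s0) (mu s0)) = setT -> forall i,
    [/\ V s (v s i), sumset (la1 s0) (mu s0) (v0 i - v s i) & v0 i = v s i + (v0 i - v s i)].
  move=> T i; rewrite sumsetC in T; have [p q] := mpartP T (v0 i).
  by split=> //; rewrite addrC subrK.
have vc s : D s -> bsum (2 * K3) (V s) (sumset (la1 s0) (mu s0)) ->
    sumset (V s) (sumset (la1 s0) (mu s0)) = setT -> forall i, vcv (F s) (v ^~ i) (v s i).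
  move=> Ds bs Ts i; have [Vsl Vsc] := path_on_gcv pV Ds.
  have K30' : 0 <= 2 * K3 by rewrite mulr_ge0.
  have dirs := gcv_direct (FF s) K30' Vsl (Bl s) Vsc (Bc s) bs Ts.
  have [p q r] := vE s Ts i.
  have [||//] := vcv_component (FF s) (a := v ^~ i) (b := fun s => v0 i - v s i)
    (x := fun=> v0 i) K30' bs (path_lin pV Ds) lB Vsc (Bc s) _ p q.
    by apply: filterS dirs => s' [_ T']; exact: vE.
  by rewrite -r; exact: vcv_cst.
have v00E i : v s0 i = v0 i.
  rewrite /v; apply: mpart_uniq => //; [by rewrite setIC|by rewrite sumsetC|].
  by rewrite subrr; exact: lin0.
have vc0 i : vcv (F s0) (v ^~ i) (v0 i).
  rewrite -v00E; apply: vc => //; move=> a b Va Bb; apply: le_trans (bK3 a b Va Bb) _.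
  by rewrite ler_wpM2r ?rnorm_ge0 // ler_peMl // ler1n.
pose h : R := 1 / (2 * n%:R + 1).
have h0 : 0 < h by rewrite divr_gt0 // ltr_wpDl // mulr_ge0.
have hn : h * n%:R <= 1 / 2.
  have : h * (2 * n%:R + 1) = 1 by rewrite /h mul1r mulVf // gt_eqF // ltr_wpDl // mulr_ge0.
  move: h0; set z : R := n%:R; move: (h) => h'; lra.
have gr : \forall s \near F s0, forall i l, cabs (w s0 (u i) (v s l) - (i == l)%:R) <= h.
  apply: near_ord => i; apply: near_ord => l; rewrite -uv.
  apply: (scv_form (FF s0) (w := fun=> w s0) ws K0 wb _ (vcv_cst (FF s0) _) (vc0 l) h0).
  move=> e e0; apply: nearW => _ x y; rewrite subrr cabs0 !mulr_ge0 ?rnorm_ge0 //; exact: ltW.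
have dim := (orth_cap_gcv fam Ds0 pV (lf_la fam) (tr_la tr) (tr_cap tr) (tr_dim tr)).2.
have Dn := withinD D s0.
exists v; near=> s.
have Ds : D s by near: s.
have [bs Ts] : bsum (2 * K3) (V s) (sumset (la1 s0) (mu s0)) /\
  sumset (V s) (sumset (la1 s0) (mu s0)) = setT by near: s.
have grs : forall i l, cabs (w s0 (u i) (v s l) - (i == l)%:R) <= h by near: s.
have dims : has_dim (V s) n by near: s.
split; last exact: vc.
have lVs := path_lin pV Ds.
apply: (basis_mod_of_dim lVs _ dims).
- exact: lin_set0.
- by move=> i; have [] := vE s Ts i.
move=> c /= c0; pose G : 'M[R[i]]_n := \matrix_(l, i) w s0 (u i) (v s l).
have hG i l : cabs (G i l - (i == l)%:R) <= h by rewrite mxE eq_sym.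
pose c' : 'rV[R[i]]_n := \row_l Num.conj (c 0 l).
have G0 : c' *m G = 0.
  apply/rowP => i; rewrite !mxE; have : w s0 (u i) (comb (v s) c) = 0 by rewrite c0 (skew0r ws).
  by rewrite (skew_combr ws) => wc0; rewrite -[RHS]wc0; apply: eq_bigr => l _; rewrite !mxE.
apply/rowP => i; have /rowP/(_ i) := gram_inj hG hn G0.
by rewrite !mxE => /eqP; rewrite conjC_eq0 => /eqP.
Unshelve. all: end_near. Qed.

Hypothesis tr : forall s, D s -> complemented (w s) (la s) (mu s) (V s) n.

Definition frame_at (x j : R -> 'I_n -> X) s :=
  [/\ [/\ forall i, la0 s (j s i), forall i k, w s (j s i) (x s k) = (i == k)%:R &
        forall c, la s c -> exists g, la1 s (c - comb (j s) g)],
      span (x s) = X0 s `&` orth (w s) (span (x s)),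
      span (x s) `&` la0 s = [set 0] /\ span (x s) `&` mu0 s = [set 0],
      forall i, span (x s) (j s i - mpart (sumset (span (x s)) (la1 s)) (mu s) (j s i)) &
      forall i, vcv (F s) (x ^~ i) (x s i) /\ vcv (F s) (j ^~ i) (j s i)].

Lemma X0X1_bsum s : D s -> exists2 K, 0 <= K & bsum K (X0 s) (X1 s).
Proof.
move=> Ds; have trs := tr Ds; have [t c] := X_split trs.
have [_ [_ _ c1]] := X1_closed_bsum fam pV Ds trs.
apply: open_mapping => //.
- by apply: linI; apply: sumset_lin; by [exact: (tr_lin trs)|exact: (tr_la trs).1|exact: (tr_mu trs).1].
- by apply: sumset_lin; [exact: (at_la1_lin fam V Ds)|exact: (at_mu1_lin fam V Ds)].
- exact: (X0_closed fam pV Ds trs).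
Qed.

Lemma la1_X1 s : D s -> la1 s `<=` X1 s.
Proof. by move=> Ds; apply: sumset_l; exact: (at_mu1_lin fam V Ds). Qed.

Lemma inner_path D' (L0 : R -> set X) : D' `<=` D -> path_on D' L0 ->
  (forall s, D' s -> L0 s `<=` X0 s) -> path_on D' (fun s => sumset (L0 s) (la1 s)).
Proof.
move=> DD p0 L0X; have l1 := path_on_sub DD (la1_path fam pV tr).
apply: gcv_path_on => s D's.
- by apply: sumset_lin; [exact: (path_lin p0 D's)|exact: (path_lin l1 D's)].
- have [K K0 bK] := X0X1_bsum (DD _ D's).
  apply: (@sumset_closed _ _ (L0 s) (la1 s) K (path_lin p0 D's) (path_lin l1 D's)
    (path_closed p0 D's) (path_closed l1 D's) K0).
  by apply: bsumS bK; [exact: L0X|exact: (la1_X1 (DD _ D's))].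
- have [K K0 bK] := X0X1_bsum (DD _ D's).
  have [_ c0] := path_on_gcv p0 D's; have [_ c1] := path_on_gcv l1 D's.
  apply: (gcv_sumset (within_filter D' (nbhs_filter s)) K0 _ c0 c1).
  by apply: bsumS bK; [exact: L0X|exact: (la1_X1 (DD _ D's))].
Qed.

Lemma frame_path D' (x j : R -> 'I_n -> X) : D' `<=` D -> (forall s, D' s -> frame_at x j s) ->
  path_on D' (fun s => span (x s)).
Proof.
move=> DD fr; apply: gcv_path_on => s D's.
- exact: span_lin.
- have [[_ jx _] _ _ _ _] := fr s D's; apply: finite_dim_closed => c c0.
  have ws := lf_skew fam (DD _ D's).
  apply/rowP => l; rewrite mxE; have /eqP : w s (j s l) (comb (x s) c) = 0 by rewrite c0 (skew0r ws).
  rewrite (skew_combr ws) (eq_bigr (fun i => Num.conj (c 0 i) * (i == l)%:R)); last first.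
    by move=> i _; rewrite jx eq_sym.
  by rewrite sum_delta_l conjC_eq0 => /eqP.
- have [[_ jx _] _ _ _ xc] := fr s D's.
  have [K K0 wb] := lf_bdd fam (DD _ D's).
  apply: (gcv_finer (within_finer DD)).
  exact: (gcv_span (FF s) (lf_skew fam (DD _ D's)) K0 wb jx (fun i => (xc i).1)).
Qed.

(** The index t is chosen for transversality to mu0 at s0 only; this persists because the sum of
    span x + la1 and [mu] is topologically direct at s0. Transversality to la0 holds for every t. *)
Lemma frame_near s0 : D s0 -> exists x j : R -> 'I_n -> X,
  \forall s \near F s0, frame_at x j s.
Proof.
move=> Ds0; have [v vP] := basis_near Ds0 (tr Ds0).
have [_ l0c] := path_on_gcv (la0_path fam pV tr) Ds0.
pose P s j := (forall i, la0 s (j i)) /\ forall i k, w s (j i) (v s k) = (i == k)%:R.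
have /choice[j jP] s : exists j : 'I_n -> X, D s -> basis_mod (V s) [set 0] (v s) -> P s j.
  have [[Ds vb]|h] := pselect (D s /\ basis_mod (V s) [set 0] (v s)).
    by have [j jP] := dual_la0 (tr Ds) vb; exists j.
  by exists (fun=> 0) => Ds vb; case: h.
(* Continuity of [j] at a nearby s requires the basis property at all s' near that s, hence an open
   neighbourhood. *)
have vP2 : \forall s \near F s0, \forall s' \near F s, D s' /\ basis_mod (V s') [set 0] (v s').
  have [U oU [Us0 UP]] : exists2 U : set R, open U & U s0 /\ forall s, U s -> D s -> basis_mod (V s) [set 0] (v s).
    have : \forall s \near nbhs s0, D s -> basis_mod (V s) [set 0] (v s).
      have vP' : nbhs s0 [set s | D s -> basis_mod (V s) [set 0] (v s) /\
        forall i, vcv (F s) (v ^~ i) (v s i)] := vP.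
      by apply: (@filterS _ (nbhs s0) _ _ _ _ vP') => s h Ds; exact: (h Ds).1.
    rewrite nbhsE => -[U [oU Us0] UP]; exists U => //; split=> // s Us; exact: UP.
  have : \forall s \near nbhs s0, U s by exact: open_nbhs_nbhs.
  apply: filterS => s Us _; have : \forall s' \near nbhs s, U s' by exact: open_nbhs_nbhs.
  by apply: filterS => s' Us' Ds'; split=> //; exact: UP.
have jc : \forall s \near F s0, forall i, vcv (F s) (j ^~ i) (j s i).
  apply: filterS3 vP vP2 (withinD D s0) => s [vb vc] vn Ds.
  have [K K0 wb] := lf_bdd fam Ds; have [jl jv] := jP s Ds vb.
  have [l0l l0cs] := path_on_gcv (la0_path fam pV tr) Ds.
  apply: (dual_vcv (FF s) (lf_skew fam Ds) K0 wb (lf_fcv fam Ds) _ l0l l0cs jl jv vc).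
    by apply: filterS (withinD D s) => s'; exact: (lf_skew fam).
  apply: filterS vn => s' [Ds' vb']; have [jl' jv'] := jP s' Ds' vb'; split=> //.
  by move=> x; exact: (la0_eq0 (tr Ds') vb').
have [vb0 vc0] : basis_mod (V s0) [set 0] (v s0) /\ forall i, vcv (F s0) (v ^~ i) (v s0 i).
  have := nbhs_singleton (vP : nbhs s0 _); exact.
have [jl0 jv0] := jP s0 Ds0 vb0.
have jc0 : forall i, vcv (F s0) (j ^~ i) (j s0 i).
  have := nbhs_singleton (jc : nbhs s0 _); exact.
have [t t0] := frame_transversal (tr Ds0) jl0 jv0.
pose x s := frame (w s) (v s) (j s) t.
have xc s : D s -> (forall i, vcv (F s) (v ^~ i) (v s i)) ->
    (forall i, vcv (F s) (j ^~ i) (j s i)) -> forall i, vcv (F s) (x ^~ i) (x s i).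
  move=> Ds vc jcs i; have [K K0 wb] := lf_bdd fam Ds.
  exact: (vcv_frame (FF s) _ _ (lf_skew fam Ds) K0 wb (lf_fcv fam Ds) vc jcs).
pose L s := sumset (span (x s)) (la1 s).
have lL s : D s -> subspace_of_space (L s).
  by move=> Ds; apply: sumset_lin; [exact: span_lin|exact: (at_la1_lin fam V Ds)].
have ch0 : gchart (w s0) (la s0) (mu s0) (L s0) n.
  apply: (inner_chart (tr Ds0) (span_lin _)) => //; first exact: (frame_lagr (tr Ds0) vb0).
  exact: (frame_la0 (tr Ds0) jl0 jv0).
have xX0 s : D s -> basis_mod (V s) [set 0] (v s) -> span (x s) `<=` X0 s.
  move=> Ds vb; have [jl jv] := jP s Ds vb.
  by rewrite (frame_lagr (tr Ds) vb jl jv t) => y [].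
have [K K0 wb] := lf_bdd fam Ds0; have [K1 K10 bK1] := X0X1_bsum Ds0.
have bK2 : bsum K1 (span (x s0)) (la1 s0).
  by apply: bsumS bK1; [exact: xX0|exact: la1_X1].
have jx0 i k : w s0 (j s0 i) (x s0 k) = (i == k)%:R by exact: (frame_jx (tr Ds0) jl0 jv0).
have Lc : gcv (F s0) L (L s0).
  have sc := gcv_span (FF s0) (lf_skew fam Ds0) K0 wb jx0 (xc s0 Ds0 vc0 jc0).
  exact: (gcv_sumset (FF s0) K10 bK2 sc (la1_gcv fam pV Ds0 (tr Ds0))).
have [_ mc] := path_on_gcv (lf_mu fam) Ds0.
have L0c : closed (L s0).
  apply: (sumset_closed (span_lin _) (at_la1_lin fam V Ds0) _ (at_la1_closed fam (V := V) Ds0) K10 bK2).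
  apply: finite_dim_closed => c c0; apply: (frame_comb_eq0 (tr Ds0) jl0 jv0 (t := t)) => l.
  by rewrite c0 (skew0r (lf_skew fam Ds0)).
have [K3 K30 bK3] := open_mapping (lL s0 Ds0) (tr_mu (tr Ds0)).1 L0c
  (path_closed (lf_mu fam) Ds0) (chart_tot ch0) (chart_cap ch0).
have bn := gcv_bsum (FF s0) K30 Lc mc bK3.
have Dn := withinD D s0.
exists x, j; near=> s.
have Ds : D s by near: s.
have [vb vc] : basis_mod (V s) [set 0] (v s) /\ forall i, vcv (F s) (v ^~ i) (v s i) by near: s.
have jcs : forall i, vcv (F s) (j ^~ i) (j s i) by near: s.
have bs : bsum (2 * K3) (L s) (mu s) by near: s.
have [jl jv] := jP s Ds vb; have trs := tr Ds.
have Lmu : span (x s) `&` mu0 s = [set 0].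
  apply: capset0; first exact: span_lin.
    by apply: linI; [exact: (tr_mu trs).1|exact: (sumset_lin (tr_lin trs) (tr_la trs).1)].
  move=> y Ly [muy _]; apply: (capset0_eq (bsum_cap0 (lL s Ds) (tr_mu trs).1 bs)) => //.
  by apply: (sumset_l (at_la1_lin fam V Ds)).
split=> //.
- split=> //; first exact: (frame_jx trs jl jv).
  by move=> c; exact: (la_frame trs vb jl jv).
- exact: (frame_lagr trs vb jl jv t).
- by split=> //; exact: (frame_la0 trs jl jv).
- by move=> i; exact: (frame_lpart trs vb jl jv i Lmu).
- by move=> i; split=> //; exact: xc.
Unshelve. all: end_near. Qed.

(** la cap mu lies in la0, which also has dimension [n], so the two coincide. *)
Lemma la0_cap s : D s -> has_dim (la s `&` mu s) n -> la0 s `<=` mu s.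
Proof.
move=> Ds dI; have trs := tr Ds; have lI := linI (tr_la trs).1 (tr_mu trs).1.
have /(qdimP _ _ lI)[e /basis_modP[eI e0 _]] := dI.
have l0 : subspace_of_space (la0 s).
  by apply: linI; [exact: (tr_la trs).1|exact: sumset_lin (tr_lin trs) (tr_mu trs).1].
have [|_ _ sp] := basis_mod_of_dim l0 (lin_set0 X) (la0_dim trs) (e := e) _ e0.
  by move=> i; have [] := cap_in_mu0 trs (eI i).
move=> y /sp[c /eqP]; rewrite subr_eq0 => /eqP ->.
by apply: (lin_comb _ (tr_mu trs).1) => i; case: (eI i).
Qed.

(** At s0 the [j i] lie in [mu], so their components along the chart vanish there and tend to 0
    nearby. *)
Lemma frame_reference s0 (x j : R -> 'I_n -> X) : D s0 -> has_dim (la s0 `&` mu s0) n ->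
  (forall s, D s -> frame_at x j s) ->
  reference (F s0) w la mu (fun s => sumset (span (x s)) (la1 s)) n.
Proof.
move=> Ds0 dI fr; pose L s := sumset (span (x s)) (la1 s).
have xX0 s : D s -> span (x s) `<=` X0 s by move=> Ds; have [_ -> _ _ _] := fr s Ds; move=> y [].
have ch s : D s -> gchart (w s) (la s) (mu s) (L s) n.
  move=> Ds; have [_ xE [xl xm] _ _] := fr s Ds.
  exact: (inner_chart (tr Ds) (span_lin _)).
have pL : path_on D L by apply: inner_path => //; exact: (frame_path (j := j)).
have [Ll Lc] := path_on_gcv pL Ds0; have [_ mc] := path_on_gcv (lf_mu fam) Ds0.
have [[jl jx sj] xE _ lp vc] := fr s0 Ds0.
have Dn := withinD D s0.
split; first by apply: filterS Dn.
pose U := 1 + \sum_i (rnorm (x s0 i) + rnorm (j s0 i)).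
have U0 : 0 < U by rewrite ltr_pwDl // sumr_ge0 // => i _; rewrite addr_ge0 ?rnorm_ge0.
have UU i : rnorm (x s0 i) + rnorm (j s0 i) + 1 <= U.
  rewrite /U addrC lerD2l (bigD1 i) //= lerDl sumr_ge0 // => k _.
  by rewrite addr_ge0 ?rnorm_ge0.
exists x, j, U; split=> //; split.
- apply: near_ord => i; have [xc jc] := vc i.
  apply: filterS2 (vcv_le (FF s0) xc) (vcv_le (FF s0) jc) => s h1 h2.
  have := UU i; have := rnorm_ge0 (x s0 i); have := rnorm_ge0 (j s0 i); split; lra.
- by apply: filterS Dn => s /fr[[h1 h2 _] _ _ _ _] i; split=> //; case: (h1 i).
- apply: filterS Dn => s Ds c lc; have [[_ _ h] _ _ _ _] := fr s Ds.
  have [g gP] := h c lc; exists g; split; first by case: gP.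
  by apply: sumset_r => //; exact: span_lin.
- by apply: filterS Dn => s /fr[_ _ _ h _].
move=> e e0; apply: near_ord => i; have [xc jc] := vc i.
have tots : \forall s \near F s0, gchart (w s) (la s) (mu s) (L s) n by apply: filterS Dn.
have mp := mpart_vcv (FF s0) mc (tr_mu (tr Ds0)) (path_closed (lf_mu fam) Ds0)
  (path_closed pL Ds0) Lc tots (ch s0 Ds0) jc.
have jm : mpart (L s0) (mu s0) (j s0 i) = j s0 i.
  by apply: (mpart_mu (chart_lagr (ch s0 Ds0)).1 (tr_mu (tr Ds0)).1
    (chart_cap (ch s0 Ds0)) (chart_tot (ch s0 Ds0))); exact: la0_cap.
have e2 : 0 < e / 2 by rewrite divr_gt0.
rewrite jm in mp; apply: filterS2 (jc _ e2) (mp _ e2) => s h1 h2.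
apply: le_trans (rnorm_dist (j s0 i) _ _) _; rewrite [rnorm (j s0 i - _)]rdistC.
lra.
Qed.

End FramePaths.

(** * Charts and references near a parameter *)

Section Charts.
Variables (R : realType) (X : completeNormedModType R[i]).
Implicit Types (x y : X) (A B : set X) (e : R) (D : set R).

Lemma within_open D (U : set R) (s0 : R) : open U -> U s0 ->
  within D (nbhs s0) `=>` within (D `&` U) (nbhs s0).
Proof.
move=> oU Us0 P; rewrite /within /=; have : \forall s \near nbhs s0, U s by exact: open_nbhs_nbhs.
by apply: filterS2 => s Us h Ds; exact: h.
Qed.

Lemma frame_at_sub D D' w la mu V n (x j : R -> 'I_n -> X) s : D' `<=` D ->
  frame_at D w la mu V x j s -> frame_at D' w la mu V x j s.
Proof.
move=> DD [h1 h2 h3 h4 h5]; split=> // i; have [h6 h7] := h5 i.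
by split=> e; [move/h6|move/h7]; exact: within_finer.
Qed.

Lemma near_within_open D (s0 : R) (P : R -> Prop) : (\forall s \near within D (nbhs s0), P s) ->
  exists U : set R, [/\ open U, U s0 & forall s, D s -> U s -> P s].
Proof.
rewrite /prop_near1 /within /= nbhsE => -[U [oU Us0] UP].
by exists U; split=> // s Ds /UP; exact.
Qed.

Definition chart_on D (w : R -> X -> X -> R[i]) (la mu L : R -> set X) d :=
  path_on D L /\ forall s, D s -> gchart (w s) (la s) (mu s) (L s) d.

Variables (D : set R) (w : R -> X -> X -> R[i]) (la mu : R -> set X).
Hypothesis fam : lagr_family D w la mu.

(** The chart may live on a smaller set [D'], such as an interval of a partition that ends at [s0],
    while the reference is common to all charts. *)
Lemma chart_local D' (L Lr : R -> set X) (s0 : R) d m : D' `<=` D -> D' s0 ->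
  chart_on D' w la mu L d ->
  reference (within D (nbhs s0)) w la mu Lr m -> has_dim (la s0 `&` mu s0) m ->
  \forall s \near within D' (nbhs s0),
  morse_pos (la s) (cform (w s) (mu s) (L s)) =
    (morse_pos (la s0) (cform (w s0) (mu s0) (L s0)) +
     morse_pos (la s) (cform (w s) (mu s) (Lr s)))%N /\
  morse_neg (la s) (cform (w s) (mu s) (L s)) =
    (morse_neg (la s0) (cform (w s0) (mu s0) (L s0)) +
     morse_neg (la s) (cform (w s) (mu s) (Lr s)))%N.
Proof.
move=> DD D's0 [pL ch] rf dI; have fam' := lagr_family_sub DD fam.
have [lal lac] := path_on_gcv (lf_la fam') D's0; have [_ muc] := path_on_gcv (lf_mu fam') D's0.
have [_ Lc] := path_on_gcv pL D's0; have Dn := withinD D' s0.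
apply: (local_morse (within_filter D' (nbhs_filter s0)) (d := d) (m := m)) => //.
- by apply: filterS Dn => s; exact: (lf_skew fam').
- exact: (lf_skew fam' D's0).
- exact: (lf_bdd fam' D's0).
- exact: (lf_fcv fam' D's0).
- by apply: filterS Dn => s; exact: (lf_lla fam').
- exact: (lf_lla fam' D's0).
- by apply: filterS Dn => s; exact: (lf_lmu fam').
- exact: (lf_lmu fam' D's0).
- exact: (path_closed (lf_mu fam') D's0).
- exact: (path_closed pL D's0).
- by apply: filterS Dn => s; exact: ch.
- exact: ch.
- exact: (reference_finer (within_finer DD) rf).
- by apply: filterS Dn => s; exact: (lf_cap fam').
Qed.

Lemma frame_chart V n (x j : R -> 'I_n -> X) : path_on D V ->
  (forall s, D s -> complemented (w s) (la s) (mu s) (V s) n) ->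
  (forall s, D s -> frame_at D w la mu V x j s) ->
  chart_on D w la mu (fun s => sumset (span (x s)) (orth (w s) (V s) `&` la s)) n.
Proof.
move=> pV tr fr; split.
  apply: (inner_path fam pV tr) => //; first exact: (frame_path fam (j := j) _ fr).
  by move=> s Ds; have [_ -> _ _ _] := fr s Ds; move=> y [].
move=> s Ds; have [_ xE [xl xm] _ _] := fr s Ds.
exact: (inner_chart (tr s Ds) (span_lin _)).
Qed.

Lemma path_cst D' A : subspace_of_space A -> closed A -> path_on D' (fun=> A).
Proof.
move=> lA cA; apply: gcv_path_on => // s _.
exact: (gcv_cst (within_filter D' (nbhs_filter s))).
Qed.

Lemma complement_exists A B k : subspace_of_space A -> subspace_of_space B ->
  fredholm_pair A B k -> exists V0 n, [/\ subspace_of_space V0, has_dim V0 n,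
    closed V0 & is_dsum setT V0 (sumset A B)].
Proof.
move=> lA lB [m [n [_ /(qdimP _ _ (@linT _ X))[v [_ v0 vs]] _]]].
have lS := sumset_lin lA lB.
have c0 c : comb v c = 0 -> c = 0 by move=> c0; apply: v0; rewrite c0; exact: lin0.
exists (span v), n; split; [exact: span_lin| |exact: finite_dim_closed|split].
- apply/(qdimP _ _ (span_lin v)); exists v; apply/basis_modP; split=> //.
  by move=> i; exact: span_mem.
- apply/seteqP; split=> // x _; have [c hc] := vs x I.
  by exists (comb v c); [exists c|exists (x - comb v c) => //; rewrite addrC subrK].
- apply: capset0 => //; first exact: span_lin.
  by move=> _ [c _ <-] /v0 ->; rewrite (linear0 (comb v)).
Qed.

(** The complement is kept constant near [s0], as the Maslov index requires, and its dimension is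
    the nullity at [s0]; so one frame yields both a chart and a reference. *)
Lemma tagged_frame (s0 : R) : D s0 -> fredholm_pair (la s0) (mu s0) 0 ->
  exists (V0 : set X) n (U : set R) (x j : R -> 'I_n -> X),
  [/\ open U /\ U s0,
      (forall s, D s -> U s -> complemented (w s) (la s) (mu s) V0 n),
      (forall s, D s -> U s -> frame_at (D `&` U) w la mu (fun=> V0) x j s),
      is_dsum setT V0 (sumset (la s0) (mu s0)) /\ closed V0 &
      has_dim (la s0 `&` mu s0) n].
Proof.
move=> Ds0 fr; have lA := (lf_lla fam Ds0).1; have lB := (lf_lmu fam Ds0).1.
have [V0 [k [lV _ cV ds]]] := complement_exists lA lB fr.
have [n [tr dI]] := fredholm_complemented fam Ds0 lV fr ds.
have pV D' : path_on D' (fun=> V0) by exact: path_cst.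
have [U1 [oU1 U1s0 tr1]] := near_within_open (complemented_near fam (pV D) Ds0 tr).
have s1 : D `&` U1 `<=` D by move=> s [].
have fam1 := lagr_family_sub s1 fam.
have [x [j fn]] := @frame_near _ _ _ _ _ _ fam1 (fun=> V0) n (pV _)
  (fun s h => tr1 s h.1 h.2) s0 (conj Ds0 U1s0).
have [U2 [oU2 U2s0 fr2]] := near_within_open fn.
exists V0, n, (U1 `&` U2), x, j; split=> //.
- by split=> //; exact: openI.
- by move=> s Ds [U1s _]; exact: tr1.
- move=> s Ds [U1s U2s]; apply: (frame_at_sub (D := D `&` U1)); last exact: fr2.
  by move=> t [Dt [U1t _]].
Qed.

Lemma reference_exists (s0 : R) : D s0 -> fredholm_pair (la s0) (mu s0) 0 ->
  exists Lr n, reference (within D (nbhs s0)) w la mu Lr n /\ has_dim (la s0 `&` mu s0) n.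
Proof.
move=> Ds0 fr; have [V0 [n [U [x [j [[oU Us0] tr fa [ds cV] dI]]]]]] := tagged_frame Ds0 fr.
have s1 : D `&` U `<=` D by move=> s [].
have fam1 := lagr_family_sub s1 fam.
have lV := tr_lin (tr s0 Ds0 Us0).
exists (fun s => sumset (span (x s)) (orth (w s) V0 `&` la s)), n; split=> //.
apply: (reference_finer (within_open oU Us0)).
apply: (frame_reference fam1 (path_cst _ lV cV)) => //.
- by move=> s [Ds Us]; exact: tr.
- by move=> s [Ds Us]; exact: fa.
Qed.

End Charts.

(** * Gluing along an interval *)

Section Gluing.
Variable R : realType.
Implicit Types (a b c u v r : R) (t : seq R).

(** Cousin's lemma, by the supremum of the reachable end points. The local hypothesis allows u = c
    or v = c, so one-sided intervals and the ends [a], [b] are included. *)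
Lemma cousin (P : R -> R -> Prop) a b : a <= b ->
  (forall u v z, a <= u -> u <= v -> v <= z -> z <= b -> P u v -> P v z -> P u z) ->
  (forall c, a <= c -> c <= b -> exists2 r, 0 < r & forall u v, a <= u -> u <= c ->
     c <= v -> v <= b -> c - r < u -> v < c + r -> P u v) -> P a b.
Proof.
move=> ab Pcat Ploc; pose S := [set s | a <= s /\ s <= b /\ P a s].
have Sa : S a.
  split; [exact: lexx|split=> //]; have [r r0 h] := Ploc a (lexx a) ab.
  by apply: h => //; lra.
have ubS : ubound S b by move=> s [_ []].
have supS : has_sup S by split; [exists a|exists b].
pose c := sup S.
have ac : a <= c by apply: ub_le_sup => //; exists b.
have cb : c <= b by apply: ge_sup => //; exists a.
have [r r0 h] := Ploc c ac cb.
have [s [as_ [sb Ps]] cs] := sup_adherent r0 supS.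
have sc : s <= c by apply: ub_le_sup => //; exists b.
have [v [cv vb vr]] : exists v, [/\ c <= v, v <= b, v < c + r & v = b \/ c < v].
  have [bcr|bcr] := ltP b (c + r / 2).
    by exists b; split=> //; [lra|left].
  by exists (c + r / 2); split=> //; [lra|lra|right; lra].
move=> vlt; have Pv : P a v by apply: (Pcat a s v) => //; [lra|apply: h => //; lra].
case: vlt => [<- //|vc]; suff : v <= c by lra.
by apply: ub_le_sup; [exists b|split; [lra|]].
Qed.

Section Values.
Variable Q : R -> R -> int -> Prop.

(** The common shape of both Maslov indices: [Q] says which values one interval of a partition may
    contribute. *)
Definition partition_value a b (k : int) := exists t (kk : nat -> int),
  [/\ itv_partition a b t,
      forall i, (i < size t)%N -> Q (node a b t i) (node a b t i.+1) (kk i) &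
      k = \sum_(i < size t) kk i].

Lemma partition_value_nil a : partition_value a a 0.
Proof. by exists [::], (fun=> 0); rewrite /itv_partition /= big_ord0; split. Qed.

Lemma partition_value_cons a b v k l : a < v -> Q a v k -> partition_value v b l ->
  partition_value a b (k + l).
Proof.
move=> av Qk [t [kk [[pt lt] ok ->]]].
exists (v :: t), (fun i => if i is i'.+1 then kk i' else k); split.
- by split=> //=; rewrite av.
- by case=> [|i] //= /ok.
- by rewrite big_ord_recl.
Qed.

Lemma partition_value_ind (P : R -> R -> int -> Prop) :
  (forall a, P a a 0) ->
  (forall a b v k l, a < v -> v <= b -> Q a v k -> P v b l -> P a b (k + l)) ->
  forall a b k, partition_value a b k -> P a b k.
Proof.
move=> P0 PS a b k [t [kk [pt ok ->]]]; elim: t a kk pt ok => [|v t IH] a kk pt ok.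
  by case: pt => _ /eqP/= <-; rewrite big_ord0.
have pt' := pt; case: pt => /= /andP[av pt] lt.
rewrite big_ord_recl; apply: (PS a b v) => //.
- exact: (itv_partition_le (conj pt lt)).
- exact: (ok 0).
- by apply: (IH v (fun i => kk i.+1)) => // i it; exact: (ok i.+1).
Qed.

Lemma partition_value_single a b k : a < b -> Q a b k -> partition_value a b k.
Proof. by move=> ab /(partition_value_cons ab)/(_ (partition_value_nil b)); rewrite addr0. Qed.

Lemma partition_value_cat a v b k l : partition_value a v k -> partition_value v b l ->
  partition_value a b (k + l).
Proof.
move=> pk; move: pk b l; apply: (@partition_value_ind (fun a v k => forall b l,
  partition_value v b l -> partition_value a b (k + l))) => [u b l|u z y k1 k2 uy _ Qk IH b l pl].
  by rewrite add0r.
by rewrite -addrA; apply: (partition_value_cons uy Qk); exact: IH.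
Qed.

Lemma partition_value_exists a b : a <= b ->
  (forall c, a <= c -> c <= b -> exists2 r, 0 < r & forall u v, a <= u -> u <= c ->
     c <= v -> v <= b -> c - r < u -> v < c + r -> u < v -> exists k, Q u v k) ->
  exists k, partition_value a b k.
Proof.
move=> ab h; apply: (@cousin (fun a b => exists k, partition_value a b k)) => //.
  by move=> u v z _ _ _ _ [k pk] [l pl]; exists (k + l); exact: partition_value_cat pk pl.
move=> c ac cb; have [r r0 hr] := h c ac cb; exists r => // u v au uc cv vb h1 h2.
have : u <= v by exact: le_trans uc cv.
rewrite le_eqVlt => /orP[/eqP <-|uv]; first by exists 0; exact: partition_value_nil.
have [k Qk] := hr u v au uc cv vb h1 h2 uv.
by exists k; exact: partition_value_single.
Qed.

Lemma partition_value_jump a b k (f : R -> int) :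
  (forall u v k, a <= u -> u < v -> v <= b -> Q u v k -> k = f v - f u) ->
  partition_value a b k -> k = f b - f a.
Proof.
move=> Qf pk; have : a <= a -> b <= b -> k = f b - f a; last by apply.
move: pk; suff : forall a' b' k, partition_value a' b' k -> a <= a' -> b' <= b ->
  k = f b' - f a' by move=> h; exact: h.
apply: partition_value_ind => [u _ _|u z y k1 k2 uy yz Qk IH au zb]; first by rewrite subrr.
rewrite (Qf u y k1 au uy (le_trans yz zb) Qk) IH //; last by apply: le_trans au _; exact: ltW.
by rewrite addrC subrKA.
Qed.

End Values.

Lemma locally_constant (g : R -> int) a b : a <= b ->
  (forall c, c \in `[a, b] -> \forall s \near within `[a, b] (nbhs c), g s = g c) -> g b = g a.
Proof.
move=> ab h; apply: (@cousin (fun u v => g v = g u)) => //.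
  by move=> u v z _ _ _ _ <- ->.
move=> c ac cb; have /h : c \in `[a, b] by rewrite in_itv /= ac cb.
rewrite /prop_near1 /within /= => /nbhs_ballP[r /= r0 hr]; exists r => // u v au uc cv vb ru vr.
have E s : a <= s -> s <= b -> c - r < s -> s < c + r -> g s = g c.
  move=> as_ sb h1 h2; apply: hr; last by rewrite in_itv /= as_ sb.
  by rewrite /ball /= ltr_distlC h1 h2.
by rewrite !E //; lra.
Qed.

(* [J c] prescribes the increments of [f] near c. *)
Lemma potential_exists (J : R -> R -> int) a b : a <= b ->
  (forall c, c \in `[a, b] -> exists2 r, 0 < r & exists h : R -> int,
     forall s0, s0 \in `[a, b] -> `|s0 - c| < r ->
       \forall s \near within `[a, b] (nbhs s0), h s = h s0 + J s0 s) ->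
  exists f : R -> int, forall s0, s0 \in `[a, b] ->
    \forall s \near within `[a, b] (nbhs s0), f s = f s0 + J s0 s.
Proof.
move=> ab h; pose P u v := exists f : R -> int, forall s0, s0 \in `[u, v] ->
    \forall s \near within `[u, v] (nbhs s0), f s = f s0 + J s0 s.
apply: (@cousin P) => //.
  move=> u v z _ uv vz _ [f fP] [g gP].
  exists (fun s => if s <= v then f s else g s - g v + f v) => s0.
  rewrite in_itv /= => /andP[us0 s0z].
  have [s0v|vs0|s0v] := ltrgtP s0 v.
  - have := fP s0; rewrite in_itv /= us0 (ltW s0v) => /(_ isT).
    have : \forall s \near nbhs s0, s < v by exact: lt_nbhsl.
    rewrite /prop_near1 /within /=; apply: filterS2 => s sv hs.
    rewrite (ltW sv) => suz; apply: hs; move: suz; rewrite !in_itv /= => /andP[-> _].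
    exact: ltW.
  - have := gP s0; rewrite in_itv /= s0z (ltW vs0) => /(_ isT).
    have : \forall s \near nbhs s0, v < s by exact: lt_nbhsr.
    rewrite /prop_near1 /within /=; apply: filterS2 => s sv hs.
    rewrite leNgt sv /= => suz; rewrite hs; last first.
      by move: suz; rewrite !in_itv /= => /andP[_ ->]; rewrite ltW.
    by ring.
  - have := fP v; rewrite in_itv /= uv lexx => /(_ isT).
    have := gP v; rewrite in_itv /= vz lexx => /(_ isT).
    rewrite s0v => gn fn.
    refine (@filterS2 _ (nbhs v) _ _ _ _ _ (gn : nbhs v _) (fn : nbhs v _)) => s hg hf suz.
    have [sv|vs] := leP s v.
      by apply: hf; move: suz; rewrite /= !in_itv /= sv => /andP[-> _].
    by rewrite hg; [ring|move: suz; rewrite /= !in_itv /= (ltW vs) => /andP[_ ->]].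
move=> c ac cb; have /h[r r0 [f fP]] : c \in `[a, b] by rewrite in_itv /= ac cb.
exists r => // u v au uc cv vb ru vr; exists f => s0.
rewrite in_itv /= => /andP[us0 s0v].
have /fP : s0 \in `[a, b] by rewrite in_itv /= (le_trans au us0) (le_trans s0v vb).
have rs : `|s0 - c| < r by rewrite ltr_norml; apply/andP; split; lra.
move=> /(_ rs); apply: within_finer => s; rewrite /= !in_itv /= => /andP[us sv].
by rewrite (le_trans au us) (le_trans sv vb).
Qed.
End Gluing.

(** * The Maslov index *)

Section Values.
Variables (R : realType) (X : completeNormedModType R[i]).
Implicit Types (A B : set X) (D : set R) (sg : mas_sign).

Lemma skewform_skew (w : skewform X) : skew w.
Proof.
split=> [a x y z|x y]; first by rewrite linearPl.
by have := hermC w x y; rewrite expr1 mulN1r.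
Qed.

(** With the sign on m^- both indices become increments, value at the end minus value at the
    beginning. *)
Definition signed_morse sg B (q : X -> X -> R[i]) : int :=
  match sg with
  | MasPlus => (morse_pos B q)%:Z
  | MasMinus => - (morse_neg B q)%:Z
  end.

Lemma morse_jumpE sg (B : R -> set X) q u v : morse_jump sg B q u v =
  signed_morse sg (B v) (q v) - signed_morse sg (B u) (q u).
Proof. by case: sg => //=; rewrite opprK addrC. Qed.

(** The condition y + T y in [al] with T y in [L] determines T y modulo L cap al = N, so any choice
    of values is linear modulo [N]. *)
Lemma quotient_graph (al be L N : set X) : subspace_of_space al ->
  subspace_of_space be -> subspace_of_space L -> L `&` al = N ->
  be `<=` sumset al L -> al `<=` sumset be L ->
  exists T, quotient_operator be L N T /\ al = graph_over be N T.
Proof.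
move=> lal lbe lL <- beS alS.
have ex y : exists l, be y -> L l /\ al (y + l).
  have [by_|] := pselect (be y); last by exists 0.
  have [a al_a [l Ll yE]] := beS y by_.
  by exists (- l) => _; split; [exact: linN|rewrite -yE addrK].
have [T TP] := choice ex.
have N_be y : be y -> L (T y) /\ al (y + T y) by move=> /TP.
(* Nothing puts [N] inside [be]; the value - y outside [be] still maps [N] into itself. *)
pose T' y := if asbool (be y) then T y else - y.
have TE y : be y -> T' y = T y by move=> /asboolP; rewrite /T' => ->.
exists T'; split; first split.
- by move=> y by_; rewrite TE //; case: (N_be y by_).
- move=> y [Ly aly]; rewrite /T'; case: asboolP => [/N_be[LT alT]|_]; last by split; exact: linN.
  by split=> //; rewrite -[T y](addKr y); apply: linD => //; exact: linN.
- move=> a x y bx by_; have bxy : be (a *: x + y) by exact: linP.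
  rewrite !TE //; have [Lx ax] := N_be _ bx; have [Ly ay] := N_be _ by_.
  have [Lxy axy] := N_be _ bxy; split; first by apply: linB => //; exact: linP.
  have -> : T (a *: x + y) - (a *: T x + T y) =
      (a *: x + y + T (a *: x + y)) - (a *: (x + T x) + (y + T y)).
    by rewrite scalerDr [X in _ = _ - X]addrACA [in RHS]opprD [RHS]addrACA subrr add0r.
  by apply: linB => //; exact: linP.
apply/seteqP; split=> [x alx|_ [_ [y by_ <-] [n [_ aln] <-]]]; last first.
  by rewrite TE //; apply: linD => //; case: (N_be y by_).
have [y by_ [l Ll xE]] := alS x alx; have [LT alT] := N_be y by_.
exists (y + T' y); first by exists y.
exists (l - T y); last by rewrite TE // addrACA subrr addr0.
split; first exact: linB.
have -> : l - T y = x - (y + T y) by rewrite -xE opprD addrACA subrr add0r.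
exact: linB.
Qed.

Section Family.
Variables (D : set R) (w : R -> skewform X) (la mu : R -> set X).
Local Notation ww := (fun s x y => w s x y).
Hypothesis fam : lagr_family D ww la mu.
Hypothesis fr : forall s, D s -> fredholm_pair (la s) (mu s) 0.

Definition chart_value sg (L : R -> set X) s : int :=
  signed_morse sg (la s) (cform (w s) (mu s) (L s)).

(** The increments [J c] come from the reference at [c] and do not refer to a chart. Integrating
    them gives f, and the value of every chart differs from f by a locally constant function. *)
Lemma maslov_potential sg a b : a <= b -> `[a, b] `<=` D ->
  exists f : R -> int, forall u v (L : R -> set X) d, a <= u -> u <= v -> v <= b ->
    chart_on `[u, v] ww la mu L d ->
    chart_value sg L v - chart_value sg L u = f v - f u.
Proof.
move=> ab abD.
have /choice[Lr rP] (s : R) : exists Lr : R -> set X, D s -> exists m : nat,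
    reference (within D (nbhs s)) ww la mu Lr m /\ has_dim (la s `&` mu s) m.
  have [Ds|nD] := pselect (D s); last by exists (fun=> set0) => /nD.
  by have [Lr [m mP]] := reference_exists fam Ds (fr Ds); exists Lr => _; exists m.
pose J (c s : R) : int := signed_morse sg (la s) (cform (w s) (mu s) (Lr c s)).
have loc D' L d c : D' `<=` D -> D' c -> chart_on D' ww la mu L d ->
    \forall s \near within D' (nbhs c), chart_value sg L s = chart_value sg L c + J c s.
  move=> DD D'c ch; have [m [rf dI]] := rP c (DD _ D'c).
  have := chart_local fam DD D'c ch rf dI; apply: filterS => s [p n].
  rewrite /chart_value /J /signed_morse; case: (sg); first by rewrite p PoszD.
  by rewrite n PoszD opprD.
(* Near each [c], the values of the single chart built from [tagged_frame] have the prescribed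
   increments at every nearby parameter. *)
have [|f fP] := @potential_exists _ J a b ab.
  move=> c /abD Dc.
  have [V0 [n [U [x [j [[oU Uc] tr fa [_ cV] _]]]]]] := tagged_frame fam Dc (fr Dc).
  have DUD : D `&` U `<=` D by move=> s [].
  have fam' := lagr_family_sub DUD fam.
  have ch := frame_chart fam' (path_cst (D `&` U) (tr_lin (tr c Dc Uc)) cV)
    (fun s h => tr s h.1 h.2) (fun s h => fa s h.1 h.2).
  have /nbhs_ballP[r r0 rU] : nbhs c U by exact: open_nbhs_nbhs.
  exists r => //; eexists => s0 /abD Ds0 s0r.
  have Us0 : U s0 by apply: rU; rewrite /ball /= distrC.
  have := loc _ _ _ s0 DUD (conj Ds0 Us0) ch.
  move=> /(within_open oU Us0) h; exact: (within_finer abD h).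
exists f => u v L d au uv vb ch.
have uvab : `[u, v] `<=` `[a, b].
  by move=> s; rewrite /= !in_itv /= => /andP[h1 h2]; rewrite (le_trans au h1) (le_trans h2 vb).
suff : chart_value sg L v - f v = chart_value sg L u - f u.
  by move=> h; lia.
apply: (@locally_constant _ (fun s => chart_value sg L s - f s)) => // c cuv.
have h1 := loc _ _ _ c (subset_trans uvab abD) cuv ch.
have h2 := within_finer uvab (fP c (uvab _ cuv)).
apply: filterS2 h1 h2 => s -> ->; lia.
Qed.

End Family.
End Values.

(** * Both Maslov indices as increments of the potential *)

Section MaslovValues.
Variables (R : realType) (X : completeNormedModType R[i]).
Implicit Types (A B : set X) (D : set R) (sg : mas_sign).

Lemma has_dim_lin A n : has_dim A n -> subspace_of_space A.
Proof.
move=> [f [fA _ Af]]; have -> : A = span (fun i => f (delta_mx 0 i)); last exact: span_lin.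
apply/seteqP; split=> x.
  by move=> /Af[_ [c _ <-] [_ -> <-]]; exists c; rewrite // addr0 linear_comb.
by move=> [c _ <-]; apply: fA; exists c; rewrite // linear_comb.
Qed.

Section Partitions.
Variables (w : R -> skewform X).

Definition chart_jump sg (P N al be : R -> set X) u v k := exists L T,
  maslov_chart w P N al be u v L T /\
  k = morse_jump sg be (fun s x y => w s x (T s y)) u v.

Lemma fd_maslov_valueE sg P N al be a b :
  fd_maslov_value sg w P N al be a b = partition_value (chart_jump sg P N al be) a b.
Proof.
apply/seteqP; split=> k.
  move=> [t [L [T [pt ch ->]]]].
  exists t, (fun i => morse_jump sg be (fun s x y => w s x (T i s y))
    (node a b t i) (node a b t i.+1)); split=> // i it.
  by exists (L i), (T i); split=> //; exact: ch.
move=> [t [kk [pt ok ->]]].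
have /choice[LT LTP] i : exists LT : (R -> set X) * (R -> X -> X), (i < size t)%N ->
    maslov_chart w P N al be (node a b t i) (node a b t i.+1) LT.1 LT.2 /\
    kk i = morse_jump sg be (fun s x y => w s x (LT.2 s y)) (node a b t i) (node a b t i.+1).
  case: (ltnP i (size t)) => [/ok[L [T h]]|_]; first by exists (L, T).
  by exists (fun=> set0, fun _ => id).
exists t, (fun i => (LT i).1), (fun i => (LT i).2); split=> //.
  by move=> i /LTP[].
by apply: eq_bigr => i _; case: (LTP i (ltn_ord i)).
Qed.

Definition reduced_jump sg (la mu : R -> set X) u v k := exists V,
  reducing_space w la mu u v V /\
  let W s := sumset V (la s) in
  let N s := ann (w s) (W s) in
  fd_maslov_value sg w W N
    (fun s => reduction (W s) (N s) (la s)) (fun s => reduction (W s) (N s) (mu s)) u v k.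

Lemma maslov_valueE sg la mu a b :
  maslov_value sg w la mu a b = partition_value (reduced_jump sg la mu) a b.
Proof.
apply/seteqP; split=> k.
  move=> [t [V [kk [pt red ok ->]]]]; exists t, kk; split=> // i it.
  by exists (V i); split; [exact: red|exact: ok].
move=> [t [kk [pt ok ->]]].
have /choice[V VP] i : exists V, (i < size t)%N -> reducing_space w la mu (node a b t i) (node a b t i.+1) V /\
  let W s := sumset V (la s) in
  let N s := ann (w s) (W s) in
  fd_maslov_value sg w W N
    (fun s => reduction (W s) (N s) (la s)) (fun s => reduction (W s) (N s) (mu s))
    (node a b t i) (node a b t i.+1) (kk i).
  case: (ltnP i (size t)) => [/ok[V h]|_]; first by exists V.
  by exists set0.
exists t, V, kk; split=> //; by move=> i /VP[].
Qed.
End Partitions.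

Section Family.
Variables (D : set R) (w : R -> skewform X) (la mu : R -> set X).
Local Notation ww := (fun s x y => w s x y).
Hypothesis fam : lagr_family D ww la mu.

(** The record treats [la] and [mu] differently; the splitting into mu1 and V + la restores the
    symmetry. *)
Lemma complemented_sym (V : R -> set X) n s : D s -> complemented (w s) (la s) (mu s) (V s) n ->
  complemented (w s) (mu s) (la s) (V s) n.
Proof.
move=> Ds tr; have [t c] := X_mu1_split fam Ds tr.
have lM1 := at_mu1_lin fam V Ds; have lV := tr_lin tr; have lA := (tr_la tr).1.
split; [exact: tr_skew tr|exact: (tr_nondeg tr)|exact: tr_mu tr|exact: tr_la tr|exact: lV|
  exact: tr_dim tr|exact: Vmu_cap tr| |].
  by rewrite [sumset (V s) _]sumsetC -sumsetA.
apply: capset0 => //; first exact: sumset_lin.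
move=> x [v Vv [m mm xE]] lax.
have m0 : m = 0.
  apply: (capset0_eq c) => //; exists (- v); first exact: linN.
  by exists x => //; rewrite -xE addKr.
by rewrite -xE m0 addr0 in lax *; exact: (capset0_eq (tr_cap tr)).
Qed.

Lemma inner_sum_mu (V : R -> set X) n s L :
  complemented (w s) (la s) (mu s) (V s) n ->
  lagrangian_in (w s) (sumset (V s) (la s) `&` sumset (V s) (mu s)) L ->
  L `&` (la s `&` sumset (V s) (mu s)) = [set 0] ->
  L `&` (mu s `&` sumset (V s) (la s)) = [set 0] ->
  sumset (V s) (la s) `&` sumset (V s) (mu s) `<=` sumset L (mu s `&` sumset (V s) (la s)).
Proof.
move=> trs [lL LE] Lla Lmu; pose X0 := sumset (V s) (la s) `&` sumset (V s) (mu s).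
have lV := tr_lin trs; have lA := (tr_la trs).1; have lM := (tr_mu trs).1.
have lX0 : subspace_of_space X0 by apply: linI; exact: sumset_lin.
move=> y X0y; have : sumset L (mu s) y.
  case: X0y => _; apply: sumset_sub; [exact: sumset_lin| |exact: sumset_r].
  exact: (inner_mu_tot trs lL LE Lmu).
case=> l Ll [m mm yE]; exists l => //; exists m => //; split=> //.
have X0l : X0 l by move: Ll; rewrite LE => -[].
have -> : m = y - l by rewrite -yE addrAC subrr add0r.
by case: (linB lX0 X0y X0l).
Qed.

Lemma inner_sum_la (V : R -> set X) n s L : D s ->
  complemented (w s) (la s) (mu s) (V s) n ->
  lagrangian_in (w s) (sumset (V s) (la s) `&` sumset (V s) (mu s)) L ->
  L `&` (la s `&` sumset (V s) (mu s)) = [set 0] ->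
  L `&` (mu s `&` sumset (V s) (la s)) = [set 0] ->
  sumset (V s) (la s) `&` sumset (V s) (mu s) `<=` sumset L (la s `&` sumset (V s) (mu s)).
Proof.
move=> Ds trs [lL LE] Lla Lmu; pose X0 := sumset (V s) (la s) `&` sumset (V s) (mu s).
have lV := tr_lin trs; have lA := (tr_la trs).1; have lM := (tr_mu trs).1.
have lX0 : subspace_of_space X0 by apply: linI; exact: sumset_lin.
have LE' : L = sumset (V s) (mu s) `&` sumset (V s) (la s) `&` orth (w s) L.
  by rewrite [X in X `&` _]setIC.
move=> y X0y; have : sumset L (la s) y.
  case: X0y => + _; apply: sumset_sub; [exact: sumset_lin| |exact: sumset_r].
  exact: (inner_mu_tot (complemented_sym Ds trs) lL LE' Lla).
case=> l Ll [m mm yE]; exists l => //; exists m => //; split=> //.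
have X0l : X0 l by move: Ll; rewrite LE => -[].
have -> : m = y - l by rewrite -yE addrAC subrr add0r.
by case: (linB lX0 X0y X0l).
Qed.

Section Inner.
Variables (V : R -> set X) (n : nat).
Hypothesis pV : path_on D V.
Hypothesis tr : forall s, D s -> complemented (w s) (la s) (mu s) (V s) n.

Local Notation la0 := (fun s => la s `&` sumset (V s) (mu s)).
Local Notation la1 := (fun s => orth (w s) (V s) `&` la s).
Local Notation mu0 := (fun s => mu s `&` sumset (V s) (la s)).
Local Notation X0 := (fun s => sumset (V s) (la s) `&` sumset (V s) (mu s)).

Lemma inner_value sg s L T : D s -> lagrangian_in (w s) (X0 s) L ->
  L `&` la0 s = [set 0] -> L `&` mu0 s = [set 0] ->
  (forall y, mu0 s y -> L (T y)) -> la0 s = [set y + T y | y in mu0 s] ->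
  signed_morse sg (mu0 s) (fun x y => w s x (T y)) =
  signed_morse sg (la s) (cform (w s) (mu s) (sumset L (la1 s))).
Proof.
move=> Ds [lL LE] Lla Lmu TL gr; have trs := tr Ds; have ws := tr_skew trs.
have ch := inner_chart trs lL LE Lla Lmu; have lV := tr_lin trs.
have lA := (tr_la trs).1; have lM := (tr_mu trs).1.
have lmu0 : subspace_of_space (mu0 s) by apply: linI => //; exact: sumset_lin.
have lla1 := at_la1_lin fam V Ds.
have beE y : mu0 s y -> exists m k, [/\ mu s m, (la s `&` sumset L (la1 s)) k & y = m + k].
  move=> [muy _]; exists y, 0; split=> //; last by rewrite addr0.
  by split; [exact: lin0|exact: lin0 (chart_lagr ch).1].
have TL' y : mu0 s y -> sumset L (la1 s) (T y) /\ la s (y + T y).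
  move=> my; split; first by apply: sumset_l => //; exact: TL.
  by have [] : la0 s (y + T y) by rewrite gr; exists y.
have mp a : la s a -> mu0 s (mpart (sumset L (la1 s)) (mu s) a).
  exact: (inner_mpart trs lL LE Lla Lmu TL gr).
have pos := chart_morse_pos ws (tr_la trs) (tr_mu trs) ch lmu0 beE TL' mp.
have neg := chart_morse_neg ws (tr_la trs) (tr_mu trs) ch lmu0 beE TL' mp.
by rewrite /signed_morse; case: sg; [rewrite pos|rewrite neg].
Qed.

Lemma inner_jump sg u v k : u <= v -> `[u, v] `<=` D ->
  chart_jump w sg X0 (fun=> [set 0]) la0 mu0 u v k ->
  exists L, chart_on `[u, v] ww la mu L n /\
    k = chart_value w la mu sg L v - chart_value w la mu sg L u.
Proof.
move=> uv uvD [L [T [[pL ch] ->]]]; exists (fun s => sumset (L s) (la1 s)).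
have Luv s : s \in `[u, v] -> [/\ lagrangian_in (w s) (X0 s) (L s),
   L s `&` la0 s = [set 0], L s `&` mu0 s = [set 0] , forall y, mu0 s y -> L s (T s y) &
   la0 s = [set y + T s y | y in mu0 s]].
  move=> suv; have [h1 h2 h3 [h4 _ _] h5] := ch s suv; split=> //.
  rewrite h5; apply/seteqP; split=> [_ [y my [_ -> <-]]|y my].
    by rewrite addr0.
  by exists y => //; exists 0 => //; rewrite addr0.
split; first split.
- apply: (inner_path fam pV tr uvD pL) => s suv; have [[_ ->] _ _ _ _] := Luv s suv.
  by move=> y [].
- move=> s suv; have [[lL LE] h2 h3 _ _] := Luv s suv.
  exact: (inner_chart (tr (uvD _ suv)) lL LE h2 h3).
rewrite morse_jumpE; congr (_ - _).
  have vuv : v \in `[u, v] by rewrite in_itv /= uv lexx.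
  by have [h1 h2 h3 h4 h5] := Luv v vuv; apply: inner_value => //; exact: uvD.
have uuv : u \in `[u, v] by rewrite in_itv /= uv lexx.
by have [h1 h2 h3 h4 h5] := Luv u uuv; apply: inner_value => //; exact: uvD.
Qed.

Lemma inner_jump_exists sg a b : a <= b -> `[a, b] `<=` D ->
  exists k, partition_value (chart_jump w sg X0 (fun=> [set 0]) la0 mu0) a b k.
Proof.
move=> ab abD; apply: partition_value_exists => // c ac cb.
have Dc : D c by apply: abD; rewrite /= in_itv /= ac cb.
have [x [j /near_within_open[U [oU Uc fa]]]] := frame_near fam pV tr Dc.
have DUD : D `&` U `<=` D by move=> s [].
have pL : path_on (D `&` U) (fun s => span (x s)).
  by apply: (frame_path fam (j := j) DUD) => s [Ds Us]; exact: fa.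
have /nbhs_ballP[r r0 rU] : nbhs c U by exact: open_nbhs_nbhs.
exists r => // u v au uc cv vb ru vr uv.
have uvDU : `[u, v] `<=` D `&` U.
  move=> s; rewrite /= in_itv /= => /andP[us sv]; split.
    by apply: abD; rewrite /= in_itv /= (le_trans au us) (le_trans sv vb).
  by apply: rU; rewrite /ball /= ltr_distlC; apply/andP; split; lra.
have LP s : s \in `[u, v] -> [/\ lagrangian_in (w s) (X0 s) (span (x s)),
    span (x s) `&` la0 s = [set 0] & span (x s) `&` mu0 s = [set 0]].
  move=> /uvDU[Ds Us]; have [_ xE [h1 h2] _ _] := fa s Ds Us.
  by split=> //; split; first exact: span_lin.
have /choice[T TP] s : exists T, s \in `[u, v] ->
    quotient_operator (mu0 s) (span (x s)) [set 0] T /\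
    la0 s = graph_over (mu0 s) [set 0] T.
  have [suv|] := boolP (s \in `[u, v]); last by exists id.
  have [h1 h2 h3] := LP s suv; have [Ds _] := uvDU s suv; have trs := tr Ds.
  have lV := tr_lin trs; have lA := (tr_la trs).1; have lM := (tr_mu trs).1.
  have la0L : subspace_of_space (la0 s) by apply: linI => //; exact: sumset_lin.
  have mu0L : subspace_of_space (mu0 s) by apply: linI => //; exact: sumset_lin.
  have h := inner_sum_mu trs h1 h2 h3.
  have h' := inner_sum_la Ds trs h1 h2 h3.
  suff [T TP] : exists T, quotient_operator (mu0 s) (span (x s)) [set 0] T /\
    la0 s = graph_over (mu0 s) [set 0] T by exists T.
  apply: quotient_graph => //.
  - exact: span_lin.
  - by move=> y my; rewrite sumsetC; apply: h'; exact: (mu0_sub trs).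
  - by move=> y ly; rewrite sumsetC; apply: h; exact: (la0_sub trs).
exists (morse_jump sg mu0 (fun s x y => w s x (T s y)) u v).
exists (fun s => span (x s)), T; split=> //; split; first exact: path_on_sub uvDU pL.
by move=> s suv; have [h1 h2 h3] := LP s suv; have [q g] := TP s suv; split.
Qed.

End Inner.

Section Reduced.
Variables (V : set X) (n : nat).
Local Notation W := (fun s => sumset V (la s)).
Local Notation N := (fun s => ann (w s) (W s)).
Local Notation al := (fun s => reduction (W s) (N s) (la s)).
Local Notation be := (fun s => reduction (W s) (N s) (mu s)).

Lemma reduced_fd_jump sg u v k : `[u, v] `<=` D -> u <= v ->
  has_dim V n ->
  (forall s, s \in `[u, v] ->
     [/\ V `&` la s = [set 0], V `&` mu s = [set 0] &
         setT = sumset (sumset V (ann (w s) V `&` la s)) (mu s)]) ->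
  chart_jump w sg W N al be u v k ->
  exists L, chart_on `[u, v] ww la mu L n /\
    k = chart_value w la mu sg L v - chart_value w la mu sg L u.
Proof.
move=> uvD uv dV rd [L [T [[pL ch] ->]]]; exists L.
have lV := has_dim_lin dV.
have ptw s : s \in `[u, v] -> gchart (w s) (la s) (mu s) (L s) n /\
    forall sg, signed_morse sg (be s) (fun x y => w s x (T s y)) = chart_value w la mu sg L s.
  move=> suv; have Ds := uvD _ suv; have [Vla Vmu top] := rd s suv.
  have [[lL LE] Lal Lbe qT alE] := ch s suv.
  have ws := lf_skew fam Ds; have nd := lf_nondeg fam Ds.
  have lla := lf_lla fam Ds; have lmu := lf_lmu fam Ds.
  have c := reduced_chart ws nd lla lmu lV dV Vla (esym top) lL LE Lal Lbe qT alE.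
  split=> // sg'.
  have lbe := reduced_be_lin ws lla lmu lV.
  have beE := reduced_beE ws lla lV Lal (mu := mu s).
  have TL := reduced_T ws lla lV qT alE.
  have mp := reduced_mpart ws nd lla lmu lV dV Vla (esym top) lL LE Lal Lbe qT alE.
  have pos := chart_morse_pos ws lla lmu c lbe beE TL mp.
  have neg := chart_morse_neg ws lla lmu c lbe beE TL mp.
  by rewrite /chart_value /signed_morse; case: sg'; [rewrite pos|rewrite neg].
split; first by split=> // s /ptw[].
rewrite morse_jumpE; congr (_ - _).
  by have [] := ptw v; rewrite ?in_itv /= ?uv ?lexx.
by have [] := ptw u; rewrite ?in_itv /= ?uv ?lexx.
Qed.
End Reduced.

Hypothesis fr : forall s, D s -> fredholm_pair (la s) (mu s) 0.

Lemma reduced_jump_potential sg a b (f : R -> int) : `[a, b] `<=` D ->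
  (forall u v (L : R -> set X) d, a <= u -> u <= v -> v <= b ->
    chart_on `[u, v] ww la mu L d ->
    chart_value w la mu sg L v - chart_value w la mu sg L u = f v - f u) ->
  forall u v k, a <= u -> u < v -> v <= b ->
    reduced_jump w sg la mu u v k -> k = f v - f u.
Proof.
move=> abD fP u v k au uv vb [V [[[n dV] _ rd]]].
rewrite /= fd_maslov_valueE; apply: partition_value_jump => u' v' k' uu' uv' vv' cj.
have uv'D : `[u', v'] `<=` D.
  move=> s; rewrite /= in_itv /= => /andP[h1 h2]; apply: abD; rewrite /= in_itv /=.
  by rewrite (le_trans au (le_trans uu' h1)) (le_trans h2 (le_trans vv' vb)).
have [|L [ch ->]] := @reduced_fd_jump V n sg u' v' k' uv'D (ltW uv') dV _ cj.
  move=> s; rewrite in_itv /= => /andP[h1 h2]; apply: rd.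
  by rewrite in_itv /= (le_trans uu' h1) (le_trans h2 vv').
apply: (fP u' v' L n _ (ltW uv') _ ch); [exact: le_trans au uu'|exact: le_trans vv' vb].
Qed.

(** Around each parameter a constant complement V0 reduces the pair, and the preimage of a chart is
    span x + la1: the frame spans a Lagrangian of X0, and la1 is the radical [N]. A single chart
    suffices on each short interval. *)
Lemma reduced_jump_exists sg a b : a <= b -> `[a, b] `<=` D ->
  exists k, partition_value (reduced_jump w sg la mu) a b k.
Proof.
move=> ab abD; apply: partition_value_exists => // c ac cb.
have Dc : D c by apply: abD; rewrite /= in_itv /= ac cb.
have [V0 [n [U [x [j [[oU Uc] tr fa [ds cV] _]]]]]] := tagged_frame fam Dc (fr Dc).
have DUD : D `&` U `<=` D by move=> s [].
have fam' := lagr_family_sub DUD fam; have lV := tr_lin (tr c Dc Uc).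
have pV : path_on (D `&` U) (fun=> V0) by exact: path_cst.
have tr' s : (D `&` U) s -> complemented (w s) (la s) (mu s) V0 n by case=> *; exact: tr.
have [pL ch] := frame_chart fam' pV tr' (fun s h => fa s h.1 h.2).
have /nbhs_ballP[r r0 rU] : nbhs c U by exact: open_nbhs_nbhs.
exists r => // u v au uc cv vb ru vr uv.
have uvDU : `[u, v] `<=` D `&` U.
  move=> s; rewrite /= in_itv /= => /andP[us sv]; split.
    by apply: abD; rewrite /= in_itv /= (le_trans au us) (le_trans sv vb).
  by apply: rU; rewrite /ball /= ltr_distlC; apply/andP; split; lra.
pose W s := sumset V0 (la s); pose N s := ann (w s) (W s).
pose al s := reduction (W s) (N s) (la s); pose be s := reduction (W s) (N s) (mu s).
pose L s := sumset (span (x s)) (orth (w s) V0 `&` la s).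
have LP s : s \in `[u, v] -> [/\ lagrangian_in (w s) (W s) (L s), L s `&` al s = N s,
    L s `&` be s = N s & exists T, quotient_operator (be s) (L s) (N s) T /\
      al s = graph_over (be s) (N s) T].
  move=> /uvDU DUs; have [Ds Us] := DUs; have trs := tr' s DUs.
  have [_ xE [xla xmu] _ _] := fa s Ds Us.
  have ws := lf_skew fam Ds; have lla := lf_lla fam Ds; have lmu := lf_lmu fam Ds.
  have lA := lla.1; have lM := lmu.1.
  have lx := span_lin (x s); have ll1 := at_la1_lin fam (fun=> V0) Ds.
  have lW : subspace_of_space (W s) by exact: sumset_lin.
  have lN : subspace_of_space (N s) := orth_lin ws _.
  have [[lL LE] Lmu Ltot _] := ch s DUs.
  have NE : N s = orth (w s) V0 `&` la s := reducedN ws lla lV.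
  have alE : al s = la s := reduced_al ws lla lV.
  have lbe : subspace_of_space (be s) := reduced_be_lin ws lla lmu lV.
  have laW : la s `<=` W s by exact: sumset_r.
  have LW : L s `<=` W s.
    apply: sumset_sub => //; last by move=> y [_ /laW].
    by rewrite xE => y [[]].
  have Nbe : N s `<=` be s by apply: sumset_r; exact: linI.
  have NL : N s `<=` L s by rewrite NE; exact: sumset_r.
  have Lal : L s `&` al s = N s.
    by rewrite alE NE setIC; exact: (inner_cap trs lx xE xla).
  have VL : V0 `<=` sumset (la s) (L s).
    move=> y Vy; have X0y : (sumset V0 (la s) `&` sumset V0 (mu s)) y.
      by split; exact: sumset_l.
    have [|||l Ll [m [lam _] <-]] := inner_sum_la (V := fun=> V0) Ds trs (L := span (x s)) _ _ _ X0y => //.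
    rewrite addrC; exists m => //; exists l => //; exact: (sumset_l ll1).
  split=> //.
  - by split=> //; rewrite [X in _ = _ `&` X](_ : _ = L s) ?setIidr.
  - apply/seteqP; split=> [y [Ly [m [mum _] [k Nk yE]]]|y Ny]; last first.
      by split; [exact: NL|exact: Nbe].
    have m0 : m = 0.
      apply: (capset0_eq Lmu) => //; have -> : m = y - k by rewrite -yE addrK.
      by apply: linB => //; exact: NL.
    by rewrite -yE m0 add0r.
  - apply: quotient_graph; rewrite ?alE //.
    + by rewrite -Lal alE.
    + apply: sumset_sub; first exact: sumset_lin.
        move=> y [_]; apply: sumset_sub; [exact: sumset_lin|exact: VL|exact: sumset_l].
      by move=> y /NL; exact: sumset_r.
    + move=> y lay; have : sumset (L s) (mu s) y by rewrite Ltot.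
      move=> [l Ll [m mum yE]]; exists m; last by exists l => //; rewrite addrC.
      apply: (sumset_l lN); split=> //; have -> : m = y - l by rewrite -yE addrAC subrr add0r.
      by apply: linB => //; [exact: laW|exact: LW].
have /choice[T TP] s : exists T, s \in `[u, v] -> quotient_operator (be s) (L s) (N s) T /\
      al s = graph_over (be s) (N s) T.
  by have [/LP[_ _ _ [T TP]]|_] := boolP (s \in `[u, v]); [exists T|exists id].
exists (morse_jump sg be (fun s x y => w s x (T s y)) u v).
exists V0; split.
  split; first by exists n; exact: tr_dim (tr c Dc Uc).
    by exists c => //; rewrite in_itv /= uc cv.
  move=> s /uvDU[Ds Us]; have trs := tr s Ds Us.
  by split; [exact: tr_cap trs|exact: Vmu_cap trs|rewrite (tr_top trs)].
rewrite /= fd_maslov_valueE; apply: partition_value_single => //.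
exists L, T; split=> //; split; first exact: path_on_sub uvDU pL.
by move=> s suv; have [h1 h2 h3 _] := LP s suv; have [q g] := TP s suv; split.
Qed.

(** The potential forces every admissible value to be f b - f a; existence of a partition makes the
    set of values nonempty. *)
Lemma maslov_isE sg a b (f : R -> int) : a <= b -> `[a, b] `<=` D ->
  (forall u v (L : R -> set X) d, a <= u -> u <= v -> v <= b ->
    chart_on `[u, v] ww la mu L d ->
    chart_value w la mu sg L v - chart_value w la mu sg L u = f v - f u) ->
  maslov_is sg w la mu a b (f b - f a).
Proof.
move=> ab abD fP; rewrite /maslov_is maslov_valueE.
have jump k : partition_value (reduced_jump w sg la mu) a b k -> k = f b - f a.
  by apply: partition_value_jump; exact: reduced_jump_potential.
apply/seteqP; split=> k; first exact: jump.
by move=> ->; have [l pl] := reduced_jump_exists sg ab abD; rewrite -(jump l pl).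
Qed.

Lemma inner_maslov_isE sg (V : R -> set X) n a b (f : R -> int) :
  path_on D V -> (forall s, D s -> complemented (w s) (la s) (mu s) (V s) n) ->
  a <= b -> `[a, b] `<=` D ->
  (forall u v (L : R -> set X) d, a <= u -> u <= v -> v <= b ->
    chart_on `[u, v] ww la mu L d ->
    chart_value w la mu sg L v - chart_value w la mu sg L u = f v - f u) ->
  fd_maslov_is sg w (fun s => sumset (V s) (la s) `&` sumset (V s) (mu s)) (fun=> [set 0])
    (fun s => la s `&` sumset (V s) (mu s)) (fun s => mu s `&` sumset (V s) (la s)) a b
    (f b - f a).
Proof.
move=> pV tr ab abD fP; rewrite /fd_maslov_is fd_maslov_valueE.
set Q := chart_jump _ _ _ _ _ _.
have jump k : partition_value Q a b k -> k = f b - f a.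
  apply: partition_value_jump => u v l au uv vb.
  have uvD : `[u, v] `<=` D.
    move=> s; rewrite /= in_itv /= => /andP[h1 h2]; apply: abD; rewrite /= in_itv /=.
    by rewrite (le_trans au h1) (le_trans h2 vb).
  move=> /(inner_jump pV tr (ltW uv) uvD)[L [ch ->]].
  exact: (fP u v L n au (ltW uv) vb ch).
apply/seteqP; split=> k; first exact: jump.
by move=> ->; have [l pl] := inner_jump_exists pV tr sg ab abD; rewrite -(jump l pl).
Qed.

End Family.
End MaslovValues.

(** * From the stated hypotheses to families, and the graph form *)

Section Bridge.
Variables (R : realType) (X : completeNormedModType R[i]).

Lemma lec_Re (a b : R[i]) : a <= b -> complex.Re a <= complex.Re b.
Proof. by rewrite lecE => /andP[]. Qed.

(** Norms are real, so real parts of the inequality only involve the real part of [C]. *)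
Lemma cabs_le (w : skewform X) (C : R[i]) x y : `|w x y| <= C * `|x| * `|y| ->
  cabs (w x y) <= complex.Re C * rnorm x * rnorm y.
Proof.
move=> /lec_Re; rewrite -/(cabs _) !rnormE.
by case: C => a b /=; rewrite !(mulr0, subr0, mul0r, addr0).
Qed.

Lemma lagr_family_of (D : set R) (w : R -> skewform X) (la mu : R -> set X) :
  (forall s, D s -> symplectic (w s)) -> form_continuous_on D w ->
  path_on D la -> path_on D mu ->
  (forall s, D s -> [/\ lagrangian (w s) (la s), lagrangian (w s) (mu s) &
     fredholm_pair (la s) (mu s) 0]) ->
  lagr_family D (fun s x y => w s x y) la mu.
Proof.
move=> sw cw pl pm lf; split=> //.
- by move=> s _; exact: skewform_skew.
- by move=> s Ds x h; have [_ nd] := sw s Ds; apply: nd.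
- move=> s Ds; have [[C hC] _] := sw s Ds.
  exists `|complex.Re C|; first exact: normr_ge0.
  move=> x y; apply: le_trans (cabs_le (hC x y)) _.
  by rewrite !ler_wpM2r ?rnorm_ge0 // ler_norm.
- move=> s Ds e e0; have e0' : 0 < e%:C :> R[i] by rewrite ltcR.
  apply: filterS (cw s Ds _ e0') => s' h x y.
  have := lec_Re (h x y); rewrite -/(cabs _) !rnormE /=.
  by rewrite !(mulr0, subr0, mul0r, addr0).
- by move=> s Ds; have [[lA AE] _ _] := lf s Ds; split=> //; rewrite {1}AE setTI.
- by move=> s Ds; have [_ [lA AE] _] := lf s Ds; split=> //; rewrite {1}AE setTI.
- by move=> s Ds; have [_ _ [m [n [h _ _]]]] := lf s Ds; exists m.
Qed.

Section Operator.
Variables (w : skewform X) (la mu V W : set X) (n : nat) (A : X -> X).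
Hypothesis tr : complemented w la mu V n.
Local Notation la0 := (la `&` sumset V mu).
Local Notation mu0 := (mu `&` sumset V la).
Local Notation X0 := (sumset V la `&` sumset V mu).
Hypothesis lW : lagrangian_in w X0 W.
Hypotheses (AW : forall y, mu0 y -> W (A y)) (gr : la0 = [set y + A y | y in mu0]).
Let ws := tr_skew tr.

Lemma graph_in_la0 y : mu0 y -> la0 (y + A y).
Proof. by move=> my; rewrite gr; exists y. Qed.

Lemma graph_form_hermitian x y : mu0 x -> mu0 y -> w y (A x) = Num.conj (w x (A y)).
Proof.
move=> mx my; have : w (x + A x) (y + A y) = 0.
  by apply: (lagr_iso (tr_la tr)); [case: (graph_in_la0 mx)|case: (graph_in_la0 my)].
have xy : w x y = 0 by apply: (lagr_iso (tr_mu tr)); [case: mx|case: my].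
have Axy : w (A x) (A y) = 0.
  by have := AW my; have := AW mx; case: lW => _ ->; move=> [_ o] Wy; apply: o; rewrite [X in X _](lW.2).
rewrite (skewDl ws) !(skewDr ws) xy Axy add0r addr0 => /eqP; rewrite addr_eq0 => /eqP ->.
by rewrite rmorphN -(skewC ws).
Qed.

(** By isotropy of [mu], w (x, A y) = w (x, y + A y), and the vectors y + A y fill la0; the radical
    is thus mu0 cap la0, as la0 is Lagrangian in X0. *)
Lemma graph_form_radical :
  [set x | mu0 x /\ forall y, mu0 y -> w x (A y) = 0] = la `&` mu.
Proof.
have E x y : mu0 x -> mu0 y -> w x (A y) = w x (y + A y).
  move=> mx my; rewrite (skewDr ws).
  have -> : w x y = 0 by apply: (lagr_iso (tr_mu tr)); [case: mx|case: my].
  by rewrite add0r.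
apply/seteqP; split=> x.
  move=> [mx h]; split; last by case: mx.
  suff : la0 x by case.
  rewrite (la0_lagr tr); split; first exact: (mu0_sub tr).
  by move=> z; rewrite gr => -[y my <-]; rewrite -E // h.
move=> /(cap_in_mu0 tr)[lx mx]; split=> // y my; rewrite E //.
by apply: (lagr_iso (tr_la tr)); [case: lx|case: (graph_in_la0 my)].
Qed.

End Operator.
End Bridge.

Theorem theorem1p1 (R : realType) (X : completeNormedModType R[i]) (eps : R)
    (w : R -> skewform X) (la mu V : R -> set X) :
  0 < eps ->
  (forall s, s \in `]- eps, eps[ -> symplectic (w s)) ->
  form_continuous_on `]- eps, eps[ w ->
  path_on `]- eps, eps[ la ->
  path_on `]- eps, eps[ mu ->
  (forall s, s \in `]- eps, eps[ ->
     [/\ lagrangian (w s) (la s), lagrangian (w s) (mu s) &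
         fredholm_pair (la s) (mu s) 0]) ->
  path_on `]- eps, eps[ V ->
  (forall s, s \in `]- eps, eps[ -> exists n, has_dim (V s) n) ->
  is_dsum setT (V 0) (sumset (la 0) (mu 0)) ->
  let la0 s := la s `&` sumset (V s) (mu s) in
  let la1 s := ann (w s) (V s) `&` la s in
  let mu0 s := mu s `&` sumset (V s) (la s) in
  let mu1 s := ann (w s) (V s) `&` mu s in
  let X0 s := sumset (V s) (la s) `&` sumset (V s) (mu s) in
  let X1 s := sumset (la1 s) (mu1 s) in
  exists delta : R, [/\ 0 < delta, delta < eps &
    (* (a) *)
    [/\ (forall s, s \in `]- delta, delta[ ->
          X0 s = ann (w s) (X1 s) /\ X1 s = ann (w s) (X0 s)),
        path_on `]- delta, delta[ X0 &
        path_on `]- delta, delta[ X1] /\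
    (* (b) *)
    (forall s, s \in `]- delta, delta[ ->
      [/\ is_dsum (X0 s) (V s) (la0 s) /\ is_dsum (X0 s) (V s) (mu0 s),
          is_dsum (X1 s) (la1 s) (mu1 s),
          (exists n : nat,
            [/\ has_dim (V 0) n, has_dim (V s) n,
                has_dim (la0 s) n, has_dim (mu0 s) n &
                has_dim (X0 s) n.*2]) &
          is_dsum setT (X0 s) (X1 s)]) /\
    (* (c) *)
    [/\ (forall s, s \in `]- delta, delta[ ->
          is_dsum (la s) (la0 s) (la1 s) /\ is_dsum (mu s) (mu0 s) (mu1 s)),
        path_on `]- delta, delta[ la0 /\ path_on `]- delta, delta[ mu0,
        path_on `]- delta, delta[ la1 /\ path_on `]- delta, delta[ mu1,
        (forall s, s \in `]- delta, delta[ ->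
          [/\ symplectic_on (X0 s) (w s),
              lagrangian_in (w s) (X0 s) (la0 s) &
              lagrangian_in (w s) (X0 s) (mu0 s)]) &
        (forall s, s \in `]- delta, delta[ ->
          [/\ symplectic_on (X1 s) (w s),
              lagrangian_in (w s) (X1 s) (la1 s) &
              lagrangian_in (w s) (X1 s) (mu1 s)])] /\
    (* (d) *)
    (forall (sg : mas_sign) (s1 s2 : R),
      s1 <= s2 -> `[s1, s2] `<=` `]- delta, delta[ ->
      exists k : int,
        maslov_is sg w la mu s1 s2 k /\
        fd_maslov_is sg w X0 (fun=> [set 0]) la0 mu0 s1 s2 k) /\
    (* (e) *)
    (forall W : R -> set X,
      path_on `]- delta, delta[ W ->
      (forall s, s \in `]- delta, delta[ ->
        [/\ lagrangian_in (w s) (X0 s) (W s),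
            W s `&` la0 s = [set 0] & W s `&` mu0 s = [set 0]]) ->
      exists A : R -> X -> X,
        (forall s, s \in `]- delta, delta[ ->
          linear_operator (mu0 s) (W s) (A s) /\
          la0 s = [set y + A s y | y in mu0 s]) /\
        let Q s x y := w s x (A s y) in
        [/\ (forall s, s \in `]- delta, delta[ ->
              forall x y, mu0 s x -> mu0 s y -> Q s y x = Num.conj (Q s x y)),
            (forall s1 s2, s1 <= s2 -> `[s1, s2] `<=` `]- delta, delta[ ->
              maslov_is MasPlus w la mu s1 s2
                ((morse_pos (mu0 s2) (Q s2))%:Z
                 - (morse_pos (mu0 s1) (Q s1))%:Z)),
            (forall s1 s2, s1 <= s2 -> `[s1, s2] `<=` `]- delta, delta[ ->
              maslov_is MasMinus w la mu s1 s2
                ((morse_neg (mu0 s1) (Q s1))%:Z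
                 - (morse_neg (mu0 s2) (Q s2))%:Z)) &
            (forall s, s \in `]- delta, delta[ ->
              has_dim (la s `&` mu s) (nullity (mu0 s) (Q s)))])].
Proof.
move=> eps0 sw cw pl pm lf pV dV ds la0 la1 mu0 mu1 X0 X1.
have D00 : `]- eps, eps[%classic (0 : R) by rewrite /= in_itv /= oppr_lt0 eps0.
have fam0 := lagr_family_of sw cw pl pm lf.
have [_ _ fr0] := lf 0 D00.
have [n [tr0 _]] := fredholm_complemented fam0 D00 (path_lin pV D00) fr0 ds.
have [U [oU U0 trU]] := near_within_open (complemented_near fam0 pV D00 tr0).
have /nbhs_ballP[r r0 rU] : nbhs (0 : R) U by exact: open_nbhs_nbhs.
(* Half of [eps] makes [delta < eps] strict; [r] keeps the interval inside the neighbourhood where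
   the decomposition persists. *)
pose delta := Num.min (eps / 2) r.
have d0 : 0 < delta by rewrite lt_min divr_gt0.
have de : delta < eps by rewrite gt_min; apply/orP; left; lra.
exists delta; split=> //.
pose D := `]- delta, delta[%classic.
have DD : D `<=` `]- eps, eps[%classic.
  by move=> s; rewrite /D /= !in_itv /= => /andP[h1 h2]; apply/andP; split; lra.
have tr s : D s -> complemented (w s) (la s) (mu s) (V s) n.
  move=> Ds; apply: trU; first exact: DD.
  apply: rU; rewrite /ball /= sub0r normrN ltr_norml; move: Ds; rewrite /D /= in_itv /=.
  have dr : delta <= r by rewrite ge_min lexx orbT.
  by move=> /andP[h1 h2]; apply/andP; split; lra.
have fam := lagr_family_sub DD fam0; have pVD := path_on_sub DD pV.
have fr s : D s -> fredholm_pair (la s) (mu s) 0 by move=> /DD/lf[].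
have plin M s : path_on D M -> D s -> subspace_of_space (M s) by move=> p Ds; exact: path_lin p Ds.
have pla0 := la0_path fam pVD tr; have pmu0 := mu0_path fam pVD tr.
have pla1 := la1_path fam pVD tr; have pmu1 := mu1_path fam pVD tr.
have pX0 := X0_path fam pVD tr; have pX1 := X1_path fam pVD tr.
split; [|split; [|split; [|split]]].
- split=> //; move=> s Ds; split; [exact: X0_orthE (tr s Ds)|exact: X1_orthE (tr s Ds)].
- move=> s Ds; have trs := tr s Ds; split.
  + by split; [exact: X0_split_la trs|exact: X0_split_mu trs].
  + exact: X1_split trs.
  + exists n; split; [exact: tr_dim tr0|exact: tr_dim trs|exact: la0_dim trs|
      exact: mu0_dim trs|exact: X0_dim trs].
  + exact: X_split trs.
- split=> //.
  + by move=> s Ds; split; [exact: la_split (tr s Ds)|exact: mu_split (tr s Ds)].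
  + move=> s Ds; have trs := tr s Ds; split; [exact: X0_nondeg trs| |].
      by split; [exact: plin pla0 Ds|exact: la0_lagr trs].
    by split; [exact: plin pmu0 Ds|exact: mu0_lagr trs].
  + move=> s Ds; have trs := tr s Ds; split; [exact: X1_nondeg trs| |].
      by split; [exact: plin pla1 Ds|exact: la1_lagr trs].
    by split; [exact: plin pmu1 Ds|exact: mu1_lagr trs].
(* Both indices are increments of the same potential, which gives (d) without relating their
   partitions. *)
- move=> sg s1 s2 s12 sD; have [f fP] := maslov_potential fam fr sg s12 sD.
  exists (f s2 - f s1); split; first exact: (maslov_isE fam fr s12 sD fP).
  exact: (inner_maslov_isE fam pVD tr s12 sD fP).
move=> W pW WP.
have /choice[A AP] s : exists A : X -> X, D s ->
    linear_operator (mu0 s) (W s) A /\ la0 s = [set y + A y | y in mu0 s].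
  have [Ds|] := pselect (D s); last by exists id.
  have [h1 h2 h3] := WP s Ds; have trs := tr s Ds.
  have [T [[q1 _ q3] g]] : exists T, quotient_operator (mu0 s) (W s) [set 0] T /\
      la0 s = graph_over (mu0 s) [set 0] T; first apply: quotient_graph => //.
  - exact: plin pla0 Ds.
  - exact: plin pmu0 Ds.
  - exact: h1.1.
  - by move=> y my; rewrite sumsetC; apply: (inner_sum_la fam Ds trs h1 h2 h3); exact: (mu0_sub trs).
  - by move=> y ly; rewrite sumsetC; apply: (inner_sum_mu trs h1 h2 h3); exact: (la0_sub trs).
  exists T => _; split; first split=> // a x y mx my.
    by apply/eqP; rewrite -subr_eq0; apply/eqP; exact: q3.
  rewrite g; apply/seteqP; split=> [_ [y my [_ -> <-]]|y my]; first by rewrite addr0.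
  by exists y => //; exists 0 => //; rewrite addr0.
exists A; split=> // Q.
pose L s := sumset (W s) (la1 s).
have WX s : D s -> W s `<=` X0 s by move=> /WP[[_ ->] _ _] y [].
(* Enlarged by la1, the given [W] is one chart over the whole interval, so its increment is that of
   the potential. *)
have pL : path_on D L by exact: (inner_path fam pVD tr (fun _ h => h) pW WX).
have jump sg s1 s2 : s1 <= s2 -> `[s1, s2] `<=` D ->
    maslov_is sg w la mu s1 s2 (morse_jump sg mu0 Q s1 s2).
  move=> s12 sD; have [f fP] := maslov_potential fam fr sg s12 sD.
  have val s : s \in `[s1, s2] -> signed_morse sg (mu0 s) (Q s) = chart_value w la mu sg L s.
    move=> /sD Ds; have [h1 h2 h3] := WP s Ds; have [[AW _] gr] := AP s Ds.
    exact: (inner_value fam tr sg Ds h1 h2 h3 AW gr).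
  rewrite morse_jumpE !val ?in_itv /= ?s12 ?lexx //.
  rewrite (fP s1 s2 L n) //; first exact: (maslov_isE fam fr s12 sD fP).
  split; first exact: path_on_sub sD pL.
  move=> s /sD Ds; have [[lW WE] h2 h3] := WP s Ds.
  exact: (inner_chart (tr s Ds) lW WE h2 h3).
split.
- move=> s Ds x y mx my; have [h1 _ _] := WP s Ds; have [[AW _] gr] := AP s Ds.
  exact: (graph_form_hermitian (tr s Ds) h1 AW gr).
- by move=> s1 s2; exact: (jump MasPlus).
- by move=> s1 s2; exact: (jump MasMinus).
- move=> s Ds; have [h1 _ _] := WP s Ds; have [[AW _] gr] := AP s Ds.
  rewrite /nullity (graph_form_radical (tr s Ds) gr).
  have [z dz] := lf_cap fam Ds.
  by apply: (@xgetPex _ 0%N); exists z.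
Qed.
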